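(* Let $d\geq 1$ and let $\alpha$ be a positive integer. Let $X_1,X_2,\dots$ be i.i.d. $\mathbb{Z}^d$-valued random variables which are genuinely $d$-dimensional, and let $S_0=0$, $S_n=\sum_{j=1}^n X_j$. Let $L_n(\alpha)$ be the $\alpha$-fold self-intersection local time of $(S_n)$ and $L_n(\alpha\mid\epsilon,d)$ the corresponding quantity for the simple symmetric random walk in $\mathbb{Z}^d$. Then there are constants $c_{\alpha,X},C_{\alpha,X}$ (depending on $\alpha$ and the law of $X_1$, but not on $n$) such that for all $n$, $$\operatorname{Var}(L_n(\alpha)) \leq c_{\alpha,X}\, \operatorname{Var}\big(L_n(\alpha\mid\epsilon,d)\big)\leq C_{\alpha,X}\, v_{d,\alpha}(n),$$ where $v_{1,\alpha}(n)=n^{1+\alpha}$, $v_{2,\alpha}(n)=n^2\log(n)^{2\alpha-4}$, $v_{3,\alpha}(n)=n\log n$, and $v_{d,\alpha}(n)=n$ for $d\geq 4$.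
   Context: For a random walk $(S_n)$ in $\mathbb{Z}^d$, the local time at $x\in\mathbb{Z}^d$ is $l(n,x)=\sum_{j=1}^n \mathbf{1}(S_j=x)$, and the $\alpha$-fold self-intersection local time is $L_n(\alpha)=\sum_{x\in\mathbb{Z}^d} l(n,x)^\alpha$. The i.i.d. increments (and the walk) are called genuinely $d$-dimensional if the support of the random variable $X_1-X_2$ linearly generates $\mathbb{R}^d$. The simple symmetric random walk in $\mathbb{Z}^d$ has i.i.d. increments with $\mathbb{P}(X=\pm e_k)=1/(2d)$, $k=1,\dots,d$, where $e_k$ is the $k$-th unit coordinate vector; $L_n(\alpha\mid\epsilon,d)$ denotes its $\alpha$-fold self-intersection local time.
   Formalization: ''For all n'' is proved for all n ≥ 3: at n = 2 the simple walk has S_1 ≠ S_2, so its variance is 0, while a walk with 0 < P(X=0) < 1 has Var(L_2(α)) > 0 for α ≥ 2, so the first inequality fails; for n ≤ 1 all variances are 0. *)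

(* Defs.v *)
From HB Require Import structures.
From mathcomp Require Import all_boot all_order all_algebra.
From mathcomp Require Import all_classical all_reals all_analysis.
Set Implicit Arguments. Unset Strict Implicit. Unset Printing Implicit Defensive.
Import Order.TTheory GRing.Theory Num.Theory.
Local Open Scope ring_scope.

(* A path of n increments X_1..X_n in Z^d; increment X_{i+1} is x i, i : 'I_n. *)

Definition partial_sum (d n : nat) (x : {ffun 'I_n -> 'rV[int]_d}) (j : nat)
  : 'rV[int]_d := \sum_(i < n | (i < j)%N) x i.

Definition local_time (d n : nat) (x : {ffun 'I_n -> 'rV[int]_d}) (y : 'rV[int]_d)
  : nat := (\sum_(j < n) ((partial_sum x j.+1 == y) : nat))%N.

Definition visited (d n : nat) (x : {ffun 'I_n -> 'rV[int]_d}) : seq 'rV[int]_d :=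
  undup [seq partial_sum x (nat_of_ord j).+1 | j : 'I_n <- enum 'I_n].

(* L_n(alpha) = sum_y l(n,y)^alpha; only visited sites contribute (alpha >= 1). *)
Definition SILT (d n a : nat) (x : {ffun 'I_n -> 'rV[int]_d}) : nat :=
  (\sum_(y <- visited x) (local_time x y) ^ a)%N.

Definition is_law (R : realType) (d : nat) (mu : 'rV[int]_d -> R) : Prop :=
  (forall z, 0 <= mu z) /\
  (\esum_(z in [set: 'rV[int]_d]) (mu z)%:E = 1%E).

Definition path_weight (R : realType) (d n : nat) (mu : 'rV[int]_d -> R)
  (x : {ffun 'I_n -> 'rV[int]_d}) : R := \prod_(i < n) mu (x i).

(* expectation of a (nonnegative, bounded) function of the first n increments *)
Definition expect (R : realType) (d n : nat) (mu : 'rV[int]_d -> R)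
  (g : {ffun 'I_n -> 'rV[int]_d} -> R) : R :=
  fine (\esum_(x in [set: {ffun 'I_n -> 'rV[int]_d}]) (path_weight mu x * g x)%:E).

Definition variance (R : realType) (d n : nat) (mu : 'rV[int]_d -> R)
  (g : {ffun 'I_n -> 'rV[int]_d} -> R) : R :=
  expect mu (fun x => g x ^+ 2) - (expect mu g) ^+ 2.

Definition var_SILT (R : realType) (d : nat) (mu : 'rV[int]_d -> R) (n a : nat) : R :=
  variance mu (fun x : {ffun 'I_n -> 'rV[int]_d} => (SILT a x)%:R).

(* genuinely d-dimensional: the support of X_1 - X_2, i.e. {p - q | mu p > 0, mu q > 0},
   linearly generates R^d (every real vector is a finite real linear combination). *)
Definition genuinely_d_dim (R : realType) (d : nat) (mu : 'rV[int]_d -> R) : Prop :=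
  forall v : 'rV[R]_d, exists (m : nat) (p q : 'I_m -> 'rV[int]_d) (c : 'I_m -> R),
    (forall i, 0 < mu (p i) /\ 0 < mu (q i)) /\
    v = \sum_(i < m) c i *: map_mx (fun z : int => z%:~R) (p i - q i).

Definition srw_law (R : realType) (d : nat) (z : 'rV[int]_d) : R :=
  if [exists k : 'I_d, (z == delta_mx 0 k) || (z == - delta_mx 0 k)]
  then ((2 * d)%:R)^-1 else 0.

Definition vrate (R : realType) (d a n : nat) : R :=
  match d with
  | 1 => (n%:R) ^+ (1 + a)
  | 2 => (n%:R) ^+ 2 * (ln (n%:R : R)) ^ ((2 * a)%:Z - 4)
  | 3 => n%:R * ln (n%:R : R)
  | _ => n%:R
  end.

(* Main.v *)
(* L_n(a) counts the a-tuples i of times at which the walk sits at one common site, so its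
   variance is a sum over pairs (i, j) of such tuples.

   Upper bound, for any law. If i has no time in the span of j, cutting out the loop that j
   forces turns the joint probability into P(i') P(j); summed over (i, j) these pairs contribute at
   most (E L)^2 and cancel against it. Up to pairs at one common site, all others visit two sites u,
   v in a pattern containing u v u v. With H bounding the Green function G_n and T bounding
   the sums of G_n(x) G_n(-x) G_n(x), this gives
   Var L <= C (n H^(2a-1) + n H^(2a-4) T). A genuinely d-dimensional law has d linearly
   independent differences of atoms, and an anti-concentration estimate along them bounds the
   m-step transition probabilities by K m^(-d/2), hence H and T. General laws are reduced
   to finitely supported ones by truncation.

   Lower bound, for the simple walk. Condition on the coordinate directions of the steps. Every
   indicator of a coincidence is then a function of independent signs whose Walsh coefficients on B
   have the sign (-1)^(|B|/2), so all conditional covariances are nonnegative and one may keep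
   only a subfamily of pairs: j is placed inside the last gap of i. These pairs already give the
   rate. For a = 1 the variance is 0. *)

Require Import Defs.
From HB Require Import structures.
From mathcomp Require Import all_classical all_reals all_analysis.
From mathcomp Require Import all_boot all_order all_algebra.
From mathcomp Require Import perm ring lra zify.
Import Order.TTheory GRing.Theory Num.Theory.
Set Implicit Arguments. Unset Strict Implicit. Unset Printing Implicit Defensive.
Local Open Scope ring_scope.

(** * Expectations over finitely many independent letters *)

Section ProductExpectation.
Variables (R : realFieldType) (T : finType) (w : T -> R).

(** The subtraction of (E L)^2 must lose no constant: L >= n, so (E L)^2 >= n^2 is above the rate
    for d >= 3. Cutting out a loop suits this, being an exact identity of probabilities and, for
    fixed j, a permutation of the tuples i. For the remaining pairs constants may be lost, so only
    the word of sites read along the union of their times is kept; boundedly many pairs share such a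
    set of times. Each letter of a word costs one Green function: the first, summed over its site,
    gives n, the alternations of u v u v give G(x) G(-x) G(x) with x = v - u, and every further
    letter costs H. T is bounded by the sum of k(a) (b+1) k(b) over b <= a < n with k(m) =
    (m+1)^(-d/2), and the nested pairs of the lower bound reproduce this double sum, which is why
    the orders agree. The sign (-1)^(|B|/2) is multiplicative over disjoint blocks, so it is checked
    for one balanced block only. The two variances are compared through the rate alone. *)

Definition pE (I : finType) (F : {ffun I -> T} -> R) : R :=
  \sum_(x : {ffun I -> T}) (\prod_i w (x i)) * F x.

Definition depends_on (I : finType) (A : {set I}) (S : Type) (F : {ffun I -> T} -> S) :=
  forall x y : {ffun I -> T}, {in A, x =1 y} -> F x = F y.

Section Linearity.
Variable I : finType.
Implicit Types F G : {ffun I -> T} -> R.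

Lemma eq_pE F G : F =1 G -> pE F = pE G.
Proof. by move=> e; apply: eq_bigr => x _; rewrite e. Qed.

Lemma pE_sum (J : Type) (r : seq J) (P : pred J) (F : J -> {ffun I -> T} -> R) :
  pE (fun x => \sum_(j <- r | P j) F j x) = \sum_(j <- r | P j) pE (F j).
Proof.
rewrite /pE exchange_big /=; apply: eq_bigr => x _.
by rewrite mulr_sumr.
Qed.

Lemma pEZ c F : pE (fun x => c * F x) = c * pE F.
Proof. by rewrite /pE mulr_sumr; apply: eq_bigr => x _; rewrite mulrCA. Qed.

Lemma pED F G : pE (fun x => F x + G x) = pE F + pE G.
Proof. by rewrite /pE -big_split; apply: eq_bigr => x _; rewrite mulrDr. Qed.

Lemma pEB F G : pE (fun x => F x - G x) = pE F - pE G.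
Proof. by rewrite /pE -sumrB; apply: eq_bigr => x _; rewrite mulrBr. Qed.

Lemma pE_cst c : pE (fun _ : {ffun I -> T} => c) = (\sum_t w t) ^+ #|I| * c.
Proof.
rewrite /pE -mulr_suml; congr (_ * _).
by rewrite -(bigA_distr_bigA (fun (_ : I) t => w t)) prodr_const.
Qed.

(** Exchangeability of the increments: a stretch of the path may be moved elsewhere in time without
    changing an expectation. *)
Lemma pE_reindex (s : {perm I}) F :
  pE (fun x => F [ffun i => x (s i)]) = pE F.
Proof.
rewrite /pE [RHS](reindex (fun x : {ffun I -> T} => [ffun i => x (s i)])) /=.
  apply: eq_bigr => x _; congr (_ * _).
  rewrite (reindex_perm s); apply: eq_bigr => i _; by rewrite ffunE.
exists (fun x : {ffun I -> T} => [ffun i => x ((s^-1)%g i)]) => x _;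
  by apply/ffunP => i; rewrite !ffunE ?permK ?permKV.
Qed.

Hypothesis w_ge0 : forall t, 0 <= w t.

Lemma le_pE F G : (forall x, F x <= G x) -> pE F <= pE G.
Proof.
by move=> le; apply: ler_sum => x _; rewrite ler_wpM2l ?prodr_ge0.
Qed.

Lemma pE_ge0 F : (forall x, 0 <= F x) -> 0 <= pE F.
Proof. by move=> ge; apply: sumr_ge0 => x _; rewrite mulr_ge0 ?prodr_ge0. Qed.

Hypothesis w_sum1 : \sum_t w t = 1.

Lemma pE1 c : pE (fun _ : {ffun I -> T} => c) = c.
Proof. by rewrite pE_cst w_sum1 expr1n mul1r. Qed.

(* Swapping the coordinates outside [A] between two independent copies turns
   [F x * G y] into [F x * G x]. *)
Lemma pE_indep (A : {set I}) F G :
  depends_on A F -> depends_on (~: A) G ->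
  pE (fun x => F x * G x) = pE F * pE G.
Proof.
move=> dF dG.
pose mix (x y : {ffun I -> T}) := [ffun i => if i \in A then x i else y i].
have -> : pE F * pE G =
  \sum_(z : {ffun I -> T} * {ffun I -> T})
    (\prod_i w (z.1 i)) * (\prod_i w (z.2 i)) * (F z.1 * G z.2).
  rewrite /pE mulr_suml -(pair_bigA _ (fun x y : {ffun I -> T} =>
    (\prod_i w (x i)) * (\prod_i w (y i)) * (F x * G y))) /=.
  apply: eq_bigr => x _; rewrite mulr_sumr; apply: eq_bigr => y _.
  by rewrite mulrACA.
rewrite (reindex (fun z : {ffun I -> T} * {ffun I -> T} => (mix z.1 z.2, mix z.2 z.1))) /=; last first.
  exists (fun z => (mix z.1 z.2, mix z.2 z.1)) => -[x y] _ /=;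
    congr pair; apply/ffunP => i; rewrite !ffunE; by case: (i \in A).
transitivity (\sum_(x : {ffun I -> T}) \sum_(y : {ffun I -> T})
    (\prod_i w (x i)) * (\prod_i w (y i)) * (F x * G x)).
  rewrite {1}/pE; apply: eq_bigr => x _.
  rewrite -[LHS]mul1r -[X in X * _](pE1 1) /pE mulr_suml.
  by apply: eq_bigr => y _; rewrite mulr1 mulrCA mulrA.
rewrite (pair_bigA _ (fun x y : {ffun I -> T} =>
    (\prod_i w (x i)) * (\prod_i w (y i)) * (F x * G x))) /=.
apply: eq_bigr => -[x y] _ /=; congr (_ * (_ * _)).
- rewrite -!big_split /=; apply: eq_bigr => i _; rewrite !ffunE.
  by case: ifP => // _; rewrite mulrC.
- by apply: dF => i iA; rewrite ffunE iA.
- by apply: dG => i; rewrite inE ffunE => /negbTE ->.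
Qed.

Lemma depends_onW (A B : {set I}) (S : Type) (F : {ffun I -> T} -> S) :
  A \subset B -> depends_on A F -> depends_on B F.
Proof. by move=> /subsetP AB dF x y e; apply: dF => i /AB; apply: e. Qed.

Lemma pE_indep_seq (r : seq {set I}) (f : {set I} -> {ffun I -> T} -> R) :
  pairwise (fun A B : {set I} => [disjoint A & B]) r ->
  {in r, forall A, depends_on A (f A)} ->
  pE (fun x => \prod_(A <- r) f A x) = \prod_(A <- r) pE (f A).
Proof.
elim: r => [|A r IHr] /=.
  by move=> _ _; rewrite big_nil -[RHS](pE1 1); apply: eq_pE => x; rewrite big_nil.
move=> /andP[/allP Ar pr] dep; rewrite big_cons -IHr//; last first.
  by move=> B Br; apply: dep; rewrite inE Br orbT.
rewrite -(@pE_indep A); first by apply: eq_pE => x; rewrite big_cons.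
  by apply: dep; rewrite mem_head.
move=> x y e; apply: eq_big_seq => B Br.
apply: dep => [|i iB]; first by rewrite inE Br orbT.
apply: e; rewrite inE; apply: contraTN iB => iA.
by rewrite (disjointFr (Ar _ Br) iA).
Qed.

End Linearity.

Definition ffcons n (t : T) (x : {ffun 'I_n -> T}) : {ffun 'I_n.+1 -> T} :=
  [ffun i => oapp x t (unlift ord0 i)].

Lemma ffcons0 n t (x : {ffun 'I_n -> T}) : ffcons t x ord0 = t.
Proof. by rewrite ffunE unlift_none. Qed.

Lemma ffconsS n t (x : {ffun 'I_n -> T}) i : ffcons t x (lift ord0 i) = x i.
Proof. by rewrite ffunE liftK. Qed.

Lemma pE_cons n (F : {ffun 'I_n.+1 -> T} -> R) :
  pE F = \sum_t w t * pE (fun x => F (ffcons t x)).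
Proof.
transitivity (\sum_t \sum_(x : {ffun 'I_n -> T})
    w t * ((\prod_i w (x i)) * F (ffcons t x))); last first.
  by apply: eq_bigr => t _; rewrite mulr_sumr.
rewrite (pair_bigA _ (fun t (x : {ffun 'I_n -> T}) =>
  w t * ((\prod_i w (x i)) * F (ffcons t x)))) /=.
rewrite /pE (reindex (fun z : T * {ffun 'I_n -> T} => ffcons z.1 z.2)) /=.
  apply: eq_bigr => -[t x] _ /=; rewrite big_ord_recl ffcons0 mulrA.
  by congr (_ * _ * _); apply: eq_bigr => i _; rewrite ffconsS.
exists (fun y : {ffun 'I_n.+1 -> T} => (y ord0, [ffun i => y (lift ord0 i)])).
- move=> [t x] _ /=; rewrite ffcons0; congr pair.
  by apply/ffunP => i; rewrite ffunE ffconsS.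
- move=> y _ /=; apply/ffunP => i; rewrite ffunE.
  by case: unliftP => [j ->|->] //=; rewrite ffunE.
Qed.

End ProductExpectation.

(** * Counting a word as a scattered subsequence *)

Section Occurrences.

Lemma big_powersetU1 (I : finType) (t : I) (B : {set I}) (F : {set I} -> nat) :
  t \notin B ->
  (\sum_(U : {set I} | U \subset t |: B) F U =
   \sum_(U : {set I} | U \subset B) F U + \sum_(U : {set I} | U \subset B) F (t |: U))%N.
Proof.
move=> tB; rewrite (bigID (fun U : {set I} => t \in U)) /= addnC; congr (_ + _)%N.
  apply: eq_bigl => U; apply/andP/idP => [[UB tU]|UB].
    by rewrite -(setU1K tB) subsetD1 UB.
  rewrite (subset_trans UB (subsetUr _ _)); split=> //.
  by apply: contra tB; apply: (subsetP UB).
rewrite (reindex_onto (fun U => t |: U) (fun U => U :\ t)) /=; last first.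
  by move=> U /andP[_ tU]; rewrite setD1K.
apply: eq_bigl => U; rewrite setU11 andbT.
apply/andP/idP => [[UB /eqP <-]|UB].
  by rewrite -(setU1K tB) setSD.
split; first by rewrite setUS.
by rewrite setU1K// (contra _ tB)//; apply: (subsetP UB).
Qed.

Variable V : eqType.

(* [occ y s] counts the occurrences of [y] as a (scattered) subsequence of [s]. *)
Fixpoint occ (y s : seq V) : nat :=
  if s is z :: s' then
    occ y s' + (if y is y0 :: y' then (z == y0) * occ y' s' else 0)
  else nilp y.

Lemma occ_nil s : occ [::] s = 1.
Proof. by elim: s => //= z s ->. Qed.

(** A set of positions of [l] is a choice of scattered subsequence. Sets of times along which a
    given word is read are thus counted by [occ], whose recursion follows the path step by step. *)
Lemma sum_subset_occ (I : finType) (f : I -> V) (l : seq I) (y : seq V) :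
  uniq l ->
  (\sum_(U : {set I} | U \subset [set t in l]) ([seq f t | t <- l & t \in U] == y) = occ y (map f l))%N.
Proof.
elim: l y => [|t l IHl] y /=.
  move=> _; rewrite (_ : [set t in [::]] = set0); last by apply/setP => i; rewrite !inE.
  rewrite (big_pred1 set0) => [|U]; first by case: y.
  by rewrite subset0.
move=> /andP[tl ul]; rewrite set_cons big_powersetU1 ?inE//.
congr (_ + _)%N.
  rewrite -IHl//; apply: eq_bigr => U UB.
  rewrite ifN//; apply: contra tl => /(subsetP UB); by rewrite inE.
have e U : [seq f i | i <- l & i \in t |: U] = [seq f i | i <- l & i \in U].
  congr map; apply: eq_in_filter => i il; rewrite !inE.
  by case: eqP => // it; rewrite -it il in tl.
case: y => [|y0 y].
  by rewrite big1// => U UB; rewrite setU11.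
rewrite -IHl// big_distrr/=; apply: eq_bigr => U UB.
by rewrite setU11/= e eqseq_cons mulnb.
Qed.

End Occurrences.

(** * Transition kernel, Green function and expected occurrences *)

Section Walk.
Variables (R : realFieldType) (T : finType) (w : T -> R) (V : zmodType) (xi : T -> V).

Definition walk n (x : {ffun 'I_n -> T}) (j : nat) : V :=
  \sum_(i < n | (i < j)%N) xi (x i).

Lemma walk_cons n t (x : {ffun 'I_n -> T}) j :
  walk (ffcons t x) j.+1 = xi t + walk x j.
Proof.
rewrite /walk big_mkcond big_ord_recl /= ffcons0; congr (_ + _).
rewrite [RHS]big_mkcond; apply: eq_bigr => i _.
by rewrite ffconsS /bump leq0n add1n ltnS.
Qed.

Definition sites n (z : V) (x : {ffun 'I_n -> T}) : seq V :=
  [seq z + walk x t.+1 | t : 'I_n <- enum 'I_n].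

Lemma sites_cons n z t (x : {ffun 'I_n -> T}) :
  sites z (ffcons t x) = (z + xi t) :: sites (z + xi t) x.
Proof.
rewrite /sites enum_ordSl /= walk_cons {1}/walk big_pred0 ?addr0//.
congr (_ :: _); rewrite -map_comp; apply: eq_map => i /=.
by rewrite walk_cons addrA.
Qed.

(** The probability of being at [x] after [m] steps from 0. *)
Fixpoint kern (m : nat) (x : V) : R :=
  if m is m'.+1 then \sum_t w t * kern m' (x - xi t) else (x == 0)%:R.

(** Expected number of visits to [x]. Time 0 is left out, as in the local time, so at 0 only genuine
    returns count. *)
Definition green n (x : V) : R := \sum_(m < n) kern m.+1 x.

Lemma greenS n x : green n.+1 x = \sum_t w t * ((x == xi t)%:R + green n (x - xi t)).
Proof.
rewrite /green big_ord_recl /=.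
under [RHS]eq_bigr do rewrite mulrDr.
rewrite big_split/=; congr (_ + _).
  by apply: eq_bigr => t _; rewrite subr_eq0.
under [RHS]eq_bigr do rewrite mulr_sumr.
by rewrite exchange_big/=; apply: eq_bigr => i _.
Qed.

Hypothesis w_ge0 : forall t, 0 <= w t.
Hypothesis w_sum1 : \sum_t w t = 1.

Lemma kern_ge0 m x : 0 <= kern m x.
Proof.
elim: m x => [|m IHm] x /=; first exact: ler0n.
by apply: sumr_ge0 => t _; rewrite mulr_ge0.
Qed.

Lemma green_ge0 n x : 0 <= green n x.
Proof. by apply: sumr_ge0 => i _; apply: kern_ge0. Qed.

Lemma green_leS n x : green n x <= green n.+1 x.
Proof. by rewrite /green big_ord_recr lerDl; apply: kern_ge0. Qed.

Lemma green_mono m n x : (m <= n)%N -> green m x <= green n x.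
Proof.
by move=> mn; rewrite -(subnK mn); elim: (n - m)%N => // k IH; apply: le_trans IH (green_leS _ _).
Qed.

Lemma sum_kern_le1 m (s : seq V) : uniq s -> \sum_(x <- s) kern m x <= 1.
Proof.
elim: m s => [|m IHm] s us /=.
  case: (boolP (0 \in s)) => [s0|s0].
    rewrite (bigD1_seq 0)//= eqxx big1 ?addr0// => x /negbTE ->//.
  rewrite big_seq big1// => x xs; case: eqP => // x0; by rewrite x0 (negbTE s0) in xs.
rewrite exchange_big/= -w_sum1; apply: ler_sum => t _.
rewrite -mulr_sumr ler_piMr// -(big_map (fun x => x - xi t) xpredT) IHm//.
by rewrite map_inj_uniq//; apply: addIr.
Qed.

Lemma sum_green_le n (s : seq V) : uniq s -> \sum_(x <- s) green n x <= n%:R.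
Proof.
move=> us; rewrite exchange_big -[n in n%:R]card_ord -sumr_const.
by apply: ler_sum => i _; apply: (@sum_kern_le1 i.+1).
Qed.

(** Expected number of increasing choices of times in 1, ..., n at which the walk started from [z]
    reads [y]. *)
Definition Eocc (y : seq V) (z : V) n : R := pE w (fun x : {ffun 'I_n -> T} => (occ y (sites z x))%:R).

Lemma Eocc_nil z n : Eocc [::] z n = 1.
Proof. by rewrite -[RHS](pE1 'I_n w_sum1 1); apply: eq_pE => x; rewrite occ_nil. Qed.

(* Decompose at the first visited letter; [green] counts the visits to it. *)
Lemma Eocc_cons y0 y B n z : 0 <= B -> (forall m, (m <= n)%N -> Eocc y y0 m <= B) ->
  Eocc (y0 :: y) z n <= green n (y0 - z) * B.
Proof.
move=> B0; elim: n z => [|n IHn] z hB.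
  rewrite /green big_ord0 mul0r /Eocc /pE big1// => x _.
  by rewrite /sites enum_ord0 /= mulr0.
rewrite /Eocc pE_cons greenS mulr_suml; apply: ler_sum => t _.
rewrite -mulrA; apply: ler_wpM2l => //.
under eq_pE do rewrite sites_cons /= natrD natrM.
rewrite pED pEZ addrC mulrDl; apply: lerD.
  have -> : (z + xi t == y0) = (y0 - z == xi t) by rewrite subr_eq addrC eq_sym.
  case: eqP => [e|_]; last by rewrite !mul0r.
  rewrite !mul1r; have -> : z + xi t = y0 by rewrite -e addrC subrK.
  exact: hB.
by rewrite -addrA -opprD; apply: IHn => m mn; apply: hB; apply: leqW.
Qed.

End Walk.

(** * Words in two sites *)

Definition site (V : Type) (u v : V) (b : bool) := if b then u else v.

(** The letters that continue an alternation after the letter [b], which itself is not included. *)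
Fixpoint alt (b : bool) k : seq bool := if k is k'.+1 then ~~ b :: alt (~~ b) k' else [::].

Lemma size_alt b k : size (alt b k) = k.
Proof. by elim: k b => //= k IHk b; rewrite IHk. Qed.

Section Words.
Variables (R : realFieldType) (T : finType) (w : T -> R) (V : zmodType) (xi : T -> V).
Hypothesis w_ge0 : forall t, 0 <= w t.
Hypothesis w_sum1 : \sum_t w t = 1.
Variables (n : nat) (H : R).
Hypothesis H_ge0 : 0 <= H.
Hypothesis green_le : forall x, green w xi n x <= H.

Lemma Eocc_le y z m : (m <= n)%N -> Eocc w xi y z m <= H ^+ size y.
Proof.
elim: y z m => [|y0 y IHy] z m mn; first by rewrite Eocc_nil// expr0.
have hB k : (k <= m)%N -> Eocc w xi y y0 k <= H ^+ size y.
  by move=> km; apply: IHy; apply: leq_trans mn.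
rewrite exprS; apply: le_trans (Eocc_cons w_ge0 _ (exprn_ge0 _ H_ge0) hB) _.
rewrite ler_wpM2r ?exprn_ge0//.
by apply: le_trans (green_le (y0 - z)); apply: green_mono.
Qed.

Fixpoint green_path (z : V) (s : seq V) : R :=
  if s is y :: s' then green w xi n (y - z) * green_path y s' else 1.

Lemma green_path_ge0 z s : 0 <= green_path z s.
Proof. by elim: s z => //= y s IHs z; rewrite mulr_ge0 ?green_ge0. Qed.

(** Over two letters, a letter that does not continue the alternation repeats the current one. It
    costs a factor [H] and leaves the walk at the current site, so the alternation resumes there
    with its exact Green functions. *)
Lemma Eocc_word u v (s : seq bool) b k m : (m <= n)%N -> subseq (alt b k) s ->
  Eocc w xi (map (site u v) s) (site u v b) m <=
  H ^+ (size s - k) * green_path (site u v b) (map (site u v) (alt b k)).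
Proof.
elim: s b k m => [|c s IHs] b [|k] m mn.
- by rewrite Eocc_nil//= expr0 mulr1.
- by [].
- by move=> _; rewrite mulr1 subn0 -(size_map (site u v)); apply: Eocc_le.
have step b' k' : subseq (alt b' k') s ->
    Eocc w xi [seq site u v i | i <- b' :: s] (site u v b) m <=
    green w xi n (site u v b' - site u v b) *
     (H ^+ (size s - k') * green_path (site u v b') (map (site u v) (alt b' k'))).
  move=> ss; rewrite map_cons.
  have hB p : (p <= m)%N -> _ := fun pm => IHs b' k' p (leq_trans pm mn) ss.
  have B0 : 0 <= H ^+ (size s - k') * green_path (site u v b') (map (site u v) (alt b' k')).
    by rewrite mulr_ge0 ?exprn_ge0 ?green_path_ge0.
  by apply: le_trans (Eocc_cons w_ge0 _ B0 hB) _; rewrite ler_wpM2r// green_mono.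
rewrite [subseq _ _]/=; case: eqP => [cb|/eqP cb] ss.
  rewrite -cb; apply: le_trans (step _ _ ss) _.
  by rewrite [size _]/= subSS mulrCA.
have {cb} -> : c = b by case: b c cb {IHs step ss} => -[].
apply: le_trans (step b k.+1 ss) _.
rewrite mulrA; apply: ler_wpM2r; first exact: green_path_ge0.
have sk : (k.+1 <= size s)%N by rewrite -(size_alt b k.+1); apply: size_subseq.
by rewrite [size _]/= subSn// exprS ler_wpM2r ?exprn_ge0.
Qed.

Lemma sum_Eocc_nseq r (A : seq V) : uniq A ->
  \sum_(u <- A) Eocc w xi (nseq r.+1 u) 0 n <= n%:R * H ^+ r.
Proof.
move=> uA; apply: (@le_trans _ _ (\sum_(u <- A) green w xi n u * H ^+ r)).
  apply: ler_sum => u _; rewrite -[u in green _ _ _ u]subr0.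
  apply: Eocc_cons => //; first exact: exprn_ge0.
  by move=> m mn; rewrite -{2}(size_nseq r u); apply: Eocc_le.
by rewrite -mulr_suml ler_wpM2r ?exprn_ge0 ?sum_green_le.
Qed.

Variable T3 : R.
Hypothesis green3_le : forall A : seq V, uniq A ->
  \sum_(x <- A) green w xi n x * green w xi n (- x) * green w xi n x <= T3.

(** With x = v - u, the three alternations after the first letter give G(x) G(-x) G(x), at most [T3]
    after summing over one site; the first letter summed over its own site gives [n]; the other
    [size s - 4] letters cost [H] each. *)
Lemma sum_Eocc_word (s : seq bool) (A : seq V) : uniq A ->
  subseq [:: true; false; true; false] s ->
  \sum_(u <- A) \sum_(v <- A) Eocc w xi (map (site u v) s) 0 n <=
  n%:R * (H ^+ (size s - 4) * T3).
Proof.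
move=> uA; case: s => // c s ss.
(* The first letter of [s] always serves as first letter of the alternation: if it is [false], the
   whole pattern lies in the rest of [s], and its first three letters suffice. *)
have {}ss : subseq (alt c 3) s.
  move: ss => /=; case: c => // ss.
  by apply: subseq_trans ss; apply: (prefix_subseq _ [:: false]).
have T3ge : 0 <= T3 by apply: le_trans (green3_le (isT : uniq [::])); rewrite big_nil.
rewrite [size _]/= subSS.
have bnd u v : Eocc w xi (map (site u v) (c :: s)) 0 n <=
    green w xi n (site u v c) * (H ^+ (size s - 3) *
    (green w xi n (site u v (~~ c) - site u v c) * green w xi n (- (site u v (~~ c) - site u v c)) *
     green w xi n (site u v (~~ c) - site u v c))).
  rewrite map_cons -[site u v c in X in X * _]subr0.
  apply: Eocc_cons => //.
    by rewrite !mulr_ge0 ?exprn_ge0 ?green_ge0.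
  move=> m mn; apply: le_trans (Eocc_word _ _ mn ss) _.
  by rewrite /= negbK opprB mulr1 !mulrA.
apply: (@le_trans _ _ (\sum_(u <- A) \sum_(v <- A) green w xi n u * (H ^+ (size s - 3) *
    (green w xi n (v - u) * green w xi n (- (v - u)) * green w xi n (v - u))))).
  case: c bnd {ss} => bnd.
    by apply: ler_sum => u _; apply: ler_sum => v _; apply: bnd.
  rewrite exchange_big/=.
  by apply: ler_sum => u _; apply: ler_sum => v _; apply: bnd.
apply: (@le_trans _ _ (\sum_(u <- A) green w xi n u * (H ^+ (size s - 3) * T3))).
  apply: ler_sum => u _; rewrite -mulr_sumr -mulr_sumr.
  apply: ler_wpM2l; first exact: green_ge0.
  apply: ler_wpM2l; first exact: exprn_ge0.
  rewrite -(big_map (fun v => v - u) xpredT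
     (fun x => green w xi n x * green w xi n (- x) * green w xi n x)).
  by apply: green3_le; rewrite map_inj_uniq//; apply: addIr.
rewrite -mulr_suml ler_wpM2r ?sum_green_le//.
by rewrite mulr_ge0 ?exprn_ge0.
Qed.

End Words.

(** * Pairs of tuples of times and the words they read *)

Lemma sorted_subset_subseq n (s1 s2 : seq 'I_n) :
  sorted (fun i j : 'I_n => (i < j)%N) s1 -> sorted (fun i j : 'I_n => (i < j)%N) s2 ->
  {subset s1 <= s2} -> subseq s1 s2.
Proof.
have tr : transitive (fun i j : 'I_n => (i < j)%N) by move=> i j k; apply: ltn_trans.
have ir : irreflexive (fun i j : 'I_n => (i < j)%N) by move=> i; apply: ltnn.
move=> o1 o2 s12.
suff -> : s1 = [seq i <- s2 | i \in s1] by apply: filter_subseq.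
apply: (irr_sorted_eq tr ir) => //; first exact: sorted_filter.
by move=> i; rewrite mem_filter andb_idr// => /s12.
Qed.

Section Tuples.
Variables (n : nat) (J : finType) (j0 : J).
Local Notation tup := {ffun J -> 'I_n}.
Implicit Types i j : tup.

Definition lo (i : tup) : 'I_n := i [arg min_(l < j0) i l]%N.
Definition hi (i : tup) : 'I_n := i [arg max_(l > j0) i l]%N.

Lemma lo_le i l : (lo i <= i l)%N.
Proof. by rewrite /lo; case: arg_minnP => // l' _; apply. Qed.

Lemma hi_ge i l : (i l <= hi i)%N.
Proof. by rewrite /hi; case: arg_maxnP => // l' _; apply. Qed.

Definition times (z : tup * tup) : {set 'I_n} :=
  [set z.1 l | l in J] :|: [set z.2 l | l in J].

Lemma card_times z : (#|times z| <= 2 * #|J|)%N.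
Proof.
apply: leq_trans (leq_card_setU _ _) _; rewrite mul2n -addnn.
by apply: leq_add; apply: leq_imset_card.
Qed.

(** A pair with time set [U] consists of two maps into [U], which has at most [2 * #|J|] elements.
    The multiplicity does not grow with [n]. *)
Lemma card_times_fiber (U : {set 'I_n}) :
  (#|[pred z | times z == U]| <= (2 * #|J|) ^ (2 * #|J|))%N.
Proof.
case: (pickP [pred z | times z == U]) => [z0 /= /eqP U0|U0]; last first.
  by rewrite eq_card0.
apply: (@leq_trans (#|[predX [pred i : tup | i \in ffun_on U] & [pred i : tup | i \in ffun_on U]]|)).
  apply/subset_leq_card/subsetP => z /eqP e; rewrite !inE.
  by apply/andP; split; apply/ffun_onP => l; rewrite -e !inE imset_f// orbT.
rewrite cardX !card_ffun_on -expnD addnn -mul2n leq_exp2r.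
  by rewrite -U0 card_times.
by rewrite muln_gt0; apply/card_gt0P; exists j0.
Qed.

(** Up to a bounded fibre a pair is its set of times, and a set of times is an occurrence of the
    word read along it. *)
Lemma count_pairs (V K : eqType) (f : 'I_n -> V) (P : pred (tup * tup)) (r : seq K)
    (y : K -> seq V) :
  (forall z, P z -> exists2 k, k \in r &
     [seq f t | t <- enum 'I_n & t \in times z] = y k) ->
  (\sum_z (P z : nat) <=
   (2 * #|J|) ^ (2 * #|J|) * \sum_(k <- r) occ (y k) [seq f t | t <- enum 'I_n])%N.
Proof.
move=> hP; pose g (U : {set 'I_n}) := [seq f t | t <- enum 'I_n & t \in U].
apply: (@leq_trans (\sum_z \sum_(k <- r) (g (times z) == y k))%N).
  apply: leq_sum => z _; case: (boolP (P z)) => //= Pz.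
  have [k kr e] := hP z Pz.
  by rewrite (big_rem k)//= /g e eqxx.
rewrite exchange_big big_distrr/=; apply: leq_sum => k _.
rewrite -sum_subset_occ ?enum_uniq// (partition_big times xpredT)//= big_distrr /=.
rewrite [leqRHS](eq_bigl xpredT); last first.
  by move=> U; apply/subsetP => i _; rewrite inE mem_enum.
apply: leq_sum => U _.
rewrite (eq_bigr (fun=> (g U == y k) : nat)); last by move=> z /eqP ->.
by rewrite sum_nat_const leq_mul2r card_times_fiber orbT.
Qed.

Variables (V : eqType) (f : 'I_n -> V).

Definition constb (i : tup) : bool := [forall l, f (i l) == f (lo i)].

Lemma constbP i l : constb i -> f (i l) = f (lo i).
Proof. by move=> /forallP/(_ l)/eqP. Qed.

Definition same_site (z : tup * tup) : bool :=
  [&& constb z.1, constb z.2 & f (lo z.1) == f (lo z.2)].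

(** The forbidden interval is half open because it indexes exactly the increments between the first
    and the last time of [j]. *)
Definition good (i j : tup) : bool :=
  (lo i < lo j)%N && [forall l, ~~ (lo j < i l <= hi j)%N].

Definition bad (z : tup * tup) : bool :=
  [&& constb z.1, constb z.2, f (lo z.1) != f (lo z.2), (lo z.1 < lo z.2)%N &
   [exists l, (lo z.2 < z.1 l < hi z.2)%N]].

(** For two different sites, order the tuples by their first times: either the earlier one has no
    time in the span of the later one, or it has one strictly inside, which gives the interlacing.
    The good terms keep their indicators because they have to cancel exactly later. *)
Lemma constb_mul_le i j :
  (constb i * constb j <= same_site (i, j) + good i j * (constb i * constb j) +
     good j i * (constb j * constb i) + bad (i, j) + bad (j, i))%N.
Proof.
rewrite /same_site /bad /=.
case: (boolP (constb i)) => // ci; case: (boolP (constb j)) => // cj /=.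
case: eqP => //= /eqP ne; rewrite [_ == f (lo i)]eq_sym (negbTE ne) /=.
have main i' j' : constb i' -> constb j' -> f (lo i') != f (lo j') -> (lo i' < lo j')%N ->
    good i' j' || [exists l, (lo j' < i' l < hi j')%N].
  move=> ci' cj' ne' lij; rewrite /good lij /=.
  case: (boolP [forall l, _]) => //= /forallPn[l]; rewrite negbK => /andP[l1 l2].
  apply/existsP; exists l; rewrite l1 ltn_neqAle l2 andbT.
  (* Tuples at different sites share no time, so [i' l] cannot equal [hi j']. *)
  apply: contraNneq ne' => e.
  by rewrite -(constbP l ci') -(constbP [arg max_(l > j0) j' l]%N cj') (val_inj e).
have nlo : (lo i != lo j :> nat) by apply: contraNneq ne => /val_inj ->.
case: (ltngtP (lo i) (lo j)) nlo => // l _ /=.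
  by have /orP[->|->] := main _ _ ci cj ne l; lia.
rewrite eq_sym in ne.
by have /orP[->|->] := main _ _ cj ci ne l; lia.
Qed.

Lemma sorted_times (U : {set 'I_n}) :
  sorted (fun i j : 'I_n => (i < j)%N) [seq t <- enum 'I_n | t \in U].
Proof.
apply: sorted_filter; first by move=> i j k; apply: ltn_trans.
by have := iota_ltn_sorted 0 n; rewrite -val_enum_ord sorted_map.
Qed.

Lemma size_times z : (size [seq t <- enum 'I_n | t \in times z] <= 2 * #|J|)%N.
Proof.
apply: leq_trans (card_times z).
rewrite -(card_uniqP (filter_uniq _ (enum_uniq _))).
by apply/subset_leq_card/subsetP => t; rewrite mem_filter => /andP[].
Qed.

Lemma same_site_word z : same_site z -> exists r : nat,
  (r < 2 * #|J|)%N /\ [seq f t | t <- enum 'I_n & t \in times z] = nseq r.+1 (f (lo z.1)).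
Proof.
move=> /and3P[c1 c2 /eqP e]; set s := [seq t <- enum 'I_n | _].
have sz : (0 < size s)%N.
  have : lo z.1 \in s by rewrite mem_filter mem_enum andbT !inE /lo imset_f.
  by case: (s).
exists (size s).-1; rewrite prednK//; split; first exact: size_times.
rewrite -(size_map f s); apply/all_pred1P/allP => _ /mapP[t + ->] /=.
rewrite mem_filter !inE => /andP[/orP[]/imsetP[l _ ->] _].
  by rewrite (constbP l c1).
by rewrite (constbP l c2) e.
Qed.

(** The times [lo z.1 < lo z.2 < z.1 l < hi z.2] carry u, v, u, v. The letter [true] marks the site
    of [z.1]. *)
Lemma bad_word z : bad z -> exists s : seq bool,
  [/\ (size s <= 2 * #|J|)%N, subseq [:: true; false; true; false] s &
   [seq f t | t <- enum 'I_n & t \in times z] = map (site (f (lo z.1)) (f (lo z.2))) s].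
Proof.
move=> /and5P[c1 c2 ne l12 /existsP[l /andP[l2 lh]]].
set s := [seq t <- enum 'I_n | _].
exists [seq f t == f (lo z.1) | t <- s]; split.
- by rewrite size_map size_times.
- have fhi : f (hi z.2) = f (lo z.2) by apply: constbP.
  suff : subseq [:: lo z.1; lo z.2; z.1 l; hi z.2] s.
    move=> /(map_subseq (fun t => f t == f (lo z.1))) /=.
    by rewrite eqxx (constbP l c1) eqxx fhi eq_sym (negbTE ne).
  apply: sorted_subset_subseq; first by rewrite /= l12 l2 lh.
    exact: sorted_times.
  move=> t; rewrite mem_filter mem_enum andbT !inE => /or4P[]/eqP ->.
  + by rewrite /lo imset_f.
  + by rewrite /lo imset_f ?orbT.
  + by rewrite imset_f.
  + by rewrite /hi imset_f ?orbT.
- rewrite -map_comp; apply/eq_in_map => t.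
  rewrite mem_filter mem_enum andbT !inE => /orP[]/imsetP[l' _ ->] /=.
    by rewrite (constbP l' c1) eqxx.
  by rewrite (constbP l' c2) eq_sym (negbTE ne).
Qed.

End Tuples.

Definition words m : seq (seq bool) :=
  flatten [seq [seq val t | t <- enum {: r.-tuple bool}] | r <- iota 0 m.+1].

Lemma mem_words m s : (s \in words m) = (size s <= m)%N.
Proof.
apply/flatten_mapP/idP => [[r]|sm].
  by rewrite mem_iota => /andP[_ rm] /mapP[t _ ->]; rewrite size_tuple.
exists (size s); first by rewrite mem_iota.
by apply/mapP; exists (in_tuple s); rewrite ?mem_enum.
Qed.

Lemma sumr_const_seq (M : nmodType) (K : Type) (s : seq K) (c : M) :
  \sum_(i <- s) c = c *+ size s.
Proof. by rewrite big_const_seq count_predT iter_addr_0. Qed.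

(** * Cutting a loop out of the path *)

Section LoopRemoval.
Variables (n : nat) (l h : 'I_n).

(* Moves the time interval [(l, h]] to the end of [[0, n)]: a loop made during it
   is thereby cut out of the path. *)
Definition loop_shift_fun (t : 'I_n) : 'I_n :=
  insubd t (if (t <= l)%N then t : nat else if (t <= h)%N then (t + (n - h.+1))%N
            else (t - (h - l))%N).

Lemma val_loop_shift_fun t : loop_shift_fun t =
  (if (t <= l)%N then t : nat else if (t <= h)%N then (t + (n - h.+1))%N
            else (t - (h - l))%N) :> nat.
Proof.
rewrite val_insubd ifT//; have := ltn_ord t; have := ltn_ord h.
by case: (leqP t l) => // ?; case: (leqP t h) => ?; lia.
Qed.

Lemma loop_shift_inj : injective loop_shift_fun.
Proof.
move=> s t /(congr1 (@nat_of_ord n)); rewrite !val_loop_shift_fun => e.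
apply: val_inj => /=; move: e; have := ltn_ord t; have := ltn_ord s; have := ltn_ord h.
case: (leqP s l) => ?; case: (leqP t l) => ?; rewrite /=;
  try case: (leqP s h) => ?; try case: (leqP t h) => ?; rewrite /=; try lia.
Qed.

Definition loop_shift := perm loop_shift_inj.

Lemma val_loop_shift t : loop_shift t =
  (if (t <= l)%N then t : nat else if (t <= h)%N then (t + (n - h.+1))%N
            else (t - (h - l))%N) :> nat.
Proof. by rewrite permE val_loop_shift_fun. Qed.

End LoopRemoval.

(** * The variance bounded by Green functions *)

Section Variance.
Variables (R : realFieldType) (T : finType) (w : T -> R) (V : zmodType) (xi : T -> V).
Variables (n : nat) (J : finType) (j0 : J).
Local Notation tup := {ffun J -> 'I_n}.
Local Notation path := {ffun 'I_n -> T}.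
Implicit Types (i j : tup) (x y : path).

(** The index [t : 'I_n] stands for time t + 1, in accordance with a local time that starts counting
    at time 1. *)
Definition coincide x i : bool := constb j0 (fun t : 'I_n => walk xi x t.+1) i.

Lemma coincideP x i :
  reflect (forall l l', walk xi x (i l).+1 = walk xi x (i l').+1) (coincide x i).
Proof.
apply: (iffP idP) => [c l l'|c]; first by rewrite (constbP l c) -(constbP l' c).
by apply/forallP => l; apply/eqP/c.
Qed.

Lemma walkB x s t : (s <= t)%N ->
  walk xi x t.+1 = walk xi x s.+1 + \sum_(u < n | (s < u <= t)%N) xi (x u).
Proof.
move=> st; rewrite /walk (bigID (fun u : 'I_n => (u < s.+1)%N)) /=; congr (_ + _).
  by apply: eq_bigl => u; rewrite !ltnS andb_idl// => /leq_trans; apply.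
by apply: eq_bigl => u; rewrite !ltnS -ltnNge andbC.
Qed.

Lemma coincide_depends j :
  depends_on [set s : 'I_n | (lo j0 j < s <= hi j0 j)%N] (coincide^~ j).
Proof.
move=> x y e; apply: eq_forallb => l.
rewrite (walkB x (lo_le j0 j l)) (walkB y (lo_le j0 j l)).
rewrite -subr_eq0 addrAC subrr add0r -[in RHS]subr_eq0 [in RHS]addrAC subrr add0r.
congr (_ == 0); apply: eq_bigr => s /andP[s1 s2]; rewrite e// inE s1.
exact: leq_trans s2 (hi_ge _ _ _).
Qed.

Definition remove_loop j i : tup := [ffun l => loop_shift (lo j0 j) (hi j0 j) (i l)].

(** If [j] coincides, the increments over its span sum to zero, so deleting them changes the
    position at no time outside the span; the times of [i] are all outside. *)
Lemma remove_loopE x y i j : y = [ffun s => x (loop_shift (lo j0 j) (hi j0 j) s)] ->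
  good j0 i j -> coincide y j -> coincide y i = coincide x (remove_loop j i).
Proof.
move=> ey /andP[_ /forallP gij] /coincideP mj.
pose l := lo j0 j; pose h := hi j0 j.
have lh : (l <= h)%N by apply: lo_le.
have loop0 : \sum_(u < n | (l < u <= h)%N) xi (y u) = 0.
  by apply: (@addrI _ (walk xi y l.+1)); rewrite -walkB// addr0; apply: mj.
have key (t : 'I_n) : ~~ (l < t <= h)%N ->
    walk xi y t.+1 = walk xi x (loop_shift l h t).+1.
  move=> tlh; rewrite [RHS]/walk (reindex_inj (@perm_inj _ (loop_shift l h))) /=.
  rewrite /walk (bigID (fun s : 'I_n => (l < s <= h)%N)) /=.
  under [RHS]eq_bigl do rewrite !val_loop_shift.
  have e (s : 'I_n) : xi (x (loop_shift l h s)) = xi (y s) by rewrite ey ffunE.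
  under [RHS]eq_bigr do rewrite e.
  have hn := ltn_ord h; have tn := ltn_ord t.
  case: (leqP t l) tlh => [tl _|tl]; last first.
    rewrite -ltnNge => ht; rewrite ifN -?ltnNge//.
    rewrite (eq_bigl (fun s : 'I_n => (l < s <= h)%N)) ?loop0 ?add0r => [|s].
      apply: eq_bigl => s; have sn := ltn_ord s.
      by case: (leqP s l) => ?; [|case: (leqP s h) => ?]; lia.
    by have sn := ltn_ord s; lia.
  rewrite big_pred0 ?add0r => [|s]; last by have sn := ltn_ord s; lia.
  apply: eq_bigl => s; have sn := ltn_ord s.
  by case: (leqP s l) => ?; [|case: (leqP s h) => ?]; lia.
apply/coincideP/coincideP => H a b.
  by rewrite !ffunE -!key//.
by rewrite !key//; have := H a b; rewrite !ffunE.
Qed.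

(** After the shift the times of [i] lie before position n - (hi - lo), where the moved loop
    begins. *)
Lemma remove_loop_depends i j : good j0 i j ->
  depends_on (~: [set s : 'I_n | (n - (hi j0 j - lo j0 j) <= s)%N])
    (coincide^~ (remove_loop j i)).
Proof.
move=> /andP[_ /forallP gij] x y e.
have key a : walk xi x (remove_loop j i a).+1 = walk xi y (remove_loop j i a).+1.
  apply: eq_bigr => s; rewrite ffunE val_loop_shift => sa; rewrite e// inE inE -ltnNge.
  have := gij a; have lh : (lo j0 j <= hi j0 j)%N := lo_le _ _ _.
  have hn := ltn_ord (hi j0 j); have an := ltn_ord (i a).
  by move: sa; case: (leqP (i a) (lo j0 j)) => ?; [|case: (leqP (i a) (hi j0 j)) => ?]; lia.
by apply/coincideP/coincideP => H a b; [rewrite -!key|rewrite !key].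
Qed.

Definition probm i : R := pE w (fun x => (coincide x i)%:R).

Hypothesis w_ge0 : forall t, 0 <= w t.
Hypothesis w_sum1 : \sum_t w t = 1.

Lemma probm_ge0 i : 0 <= probm i.
Proof. by apply: pE_ge0 => // x; apply: ler0n. Qed.

(** After the permutation the event for [j] reads only the final hi - lo increments, and the event
    for the shifted [i] only the earlier ones. *)
Lemma pE_good i j : good j0 i j ->
  pE w (fun x => (coincide x i)%:R * (coincide x j)%:R) = probm (remove_loop j i) * probm j.
Proof.
move=> g; rewrite -(pE_reindex w (loop_shift (lo j0 j) (hi j0 j))).
rewrite (@eq_pE _ _ _ _ _ (fun x => (coincide [ffun s => x (loop_shift (lo j0 j) (hi j0 j) s)] j)%:R
   * (coincide x (remove_loop j i))%:R)); last first.
  move=> x; case: (boolP (coincide _ j)) => [mj|]; last by rewrite mulr0 mul0r.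
  by rewrite (remove_loopE erefl g mj) mulrC.
rewrite (pE_indep w_sum1 (A := [set s : 'I_n | (n - (hi j0 j - lo j0 j) <= s)%N])); first last.
- by move=> x y e; rewrite (remove_loop_depends g e).
- move=> x y e; congr (_%:R); congr (nat_of_bool _); apply: coincide_depends => s.
  rewrite inE => /andP[s1 s2]; rewrite !ffunE; apply: e; rewrite inE val_loop_shift.
  have hn := ltn_ord (hi j0 j).
  by have -> : (s <= lo j0 j)%N = false by [rewrite leqNgt s1]; rewrite s2; lia.
by rewrite mulrC; congr (_ * _); rewrite [LHS](pE_reindex w _ (fun x => (coincide x j)%:R)).
Qed.

(** [remove_loop j] permutes the tuples, so the sum over [i] becomes a sum over images without
    multiplicity. *)
Lemma sum_good_le j :
  \sum_(i | good j0 i j) probm (remove_loop j i) <= \sum_(i | (lo j0 i < lo j0 j)%N) probm i.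
Proof.
pose s := loop_shift (lo j0 j) (hi j0 j).
rewrite [leRHS](reindex (remove_loop j)) /=; last first.
  exists (fun i => [ffun l => (s^-1)%g (i l)]) => i _; apply/ffunP => l;
    by rewrite !ffunE ?permK ?permKV.
rewrite big_mkcond [leRHS]big_mkcond; apply: ler_sum => i _.
case: ifP => [/andP[lij _]|_]; last by case: ifP => // _; apply: probm_ge0.
(* The first time of [i] precedes [lo j] and is therefore fixed by the shift, so the image also
   starts before [j]. *)
rewrite ifT//; set k := [arg min_(l < j0) i l]%N.
apply: leq_ltn_trans (lo_le _ _ k) _.
by rewrite ffunE val_loop_shift -/(lo j0 i) ifT// ltnW.
Qed.

Definition num_coincide x : R := \sum_i (coincide x i)%:R.

Definition pVar (F : path -> R) : R := pE w (fun x => F x ^+ 2) - pE w F ^+ 2.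

(** The ordered pairs with [lo i < lo j] and their mirror images are disjoint, so twice the good sum
    fits into the full double sum of [probm i * probm j]. *)
Lemma sum_good2_le :
  (\sum_i \sum_(j | good j0 i j) pE w (fun x => (coincide x i)%:R * (coincide x j)%:R)) *+ 2
  <= pE w num_coincide ^+ 2.
Proof.
have -> : pE w num_coincide = \sum_i probm i by rewrite /num_coincide pE_sum.
apply: (@le_trans _ _ ((\sum_j \sum_(i | (lo j0 i < lo j0 j)%N) probm i * probm j) *+ 2)).
  rewrite lerMn2r/= (exchange_big_dep xpredT) //=; apply: ler_sum => j _.
  rewrite -mulr_suml.
  apply: le_trans (ler_wpM2r (probm_ge0 j) (sum_good_le j)).
  rewrite mulr_suml; apply: ler_sum => i g; by rewrite pE_good.
rewrite expr2 big_distrlr /= mulr2n.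
rewrite [X in X + _](eq_bigr (fun j => \sum_i (lo j0 i < lo j0 j)%N%:R * (probm i * probm j))); last first.
  by move=> j _; rewrite big_mkcond; apply: eq_bigr => i _; case: ifP; rewrite ?mul1r ?mul0r.
rewrite (exchange_big_dep xpredT) //= -[leLHS]big_split/=; apply: ler_sum => i _.
rewrite [X in _ + X]big_mkcond -[leLHS]big_split/=; apply: ler_sum => j _.
rewrite [probm j * _]mulrC; case: ifP => [ji|_].
  by rewrite ltnNge ltnW// mul0r add0r.
by rewrite addr0 ler_piMl ?mulr_ge0 ?probm_ge0// lern1 leq_b1.
Qed.

Variable H : R.
Hypothesis H_ge1 : 1 <= H.
Hypothesis green_le : forall v, green w xi n v <= H.
Variable T3 : R.
Hypothesis green3_le : forall A : seq V, uniq A ->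
  \sum_(v <- A) green w xi n v * green w xi n (- v) * green w xi n v <= T3.

Definition all_sites : seq V :=
  undup [seq walk xi x t.+1 | x <- enum {: path}, t : 'I_n <- enum 'I_n].

Lemma mem_all_sites x (t : 'I_n) : walk xi x t.+1 \in all_sites.
Proof. by rewrite mem_undup; apply/allpairsP; exists (x, t); rewrite !mem_enum. Qed.

Let C := ((2 * #|J|) ^ (2 * #|J|))%N.

Lemma pE_same_le :
  pE w (fun x => (\sum_z same_site j0 (fun t : 'I_n => walk xi x t.+1) z)%:R) <=
  (C * (2 * #|J|))%:R * (n%:R * H ^+ (2 * #|J| - 1)).
Proof.
have H0 : 0 <= H by apply: le_trans H_ge1.
pose r := [seq (k, u) | k <- iota 0 (2 * #|J|), u <- all_sites].
apply: (@le_trans _ _ (pE w (fun x => C%:R * \sum_(ku <- r) (occ (nseq ku.1.+1 ku.2) (sites xi 0 x))%:R))).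
  apply: le_pE => // x; rewrite -natr_sum -natrM ler_nat.
  have -> : sites xi 0 x = [seq walk xi x t.+1 | t : 'I_n <- enum 'I_n].
    by apply: eq_map => t; rewrite add0r.
  apply: (count_pairs j0 (y := fun ku : nat * V => nseq ku.1.+1 ku.2)) => z /same_site_word[k [kJ ->]].
  exists (k, walk xi x (lo j0 z.1).+1) => //; apply/allpairsP.
  by exists (k, walk xi x (lo j0 z.1).+1); rewrite mem_iota kJ mem_all_sites.
rewrite pEZ pE_sum natrM -mulrA ler_wpM2l// big_allpairs_dep /=.
rewrite [leRHS]mulr_natl -[X in _ *+ X](size_iota 0) -(sumr_const_seq (iota _ _)) big_seq [leRHS]big_seq.
apply: ler_sum => k; rewrite mem_iota /= add0n => kJ.
apply: le_trans (sum_Eocc_nseq w_ge0 w_sum1 H0 green_le k (undup_uniq _)) _.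
(* Shorter words are dominated by the longest one because [1 <= H]. *)
rewrite ler_wpM2l// ler_weXn2l//; lia.
Qed.

Lemma pE_bad_le :
  pE w (fun x => (\sum_z bad j0 (fun t : 'I_n => walk xi x t.+1) z)%:R) <=
  (C * size (words (2 * #|J|)))%:R * (n%:R * (H ^+ (2 * #|J| - 4) * T3)).
Proof.
have H0 : 0 <= H by apply: le_trans H_ge1.
have T0 : 0 <= T3 by apply: le_trans (green3_le (isT : uniq [::])); rewrite big_nil.
pose W := [seq s <- words (2 * #|J|) | subseq [:: true; false; true; false] s].
pose r := [seq (su, v) | su <- [seq (s, u) | s <- W, u <- all_sites], v <- all_sites].
apply: (@le_trans _ _ (pE w (fun x => C%:R *
    \sum_(k <- r) (occ (map (site k.1.2 k.2) k.1.1) (sites xi 0 x))%:R))).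
  apply: le_pE => // x; rewrite -natr_sum -natrM ler_nat.
  have -> : sites xi 0 x = [seq walk xi x t.+1 | t : 'I_n <- enum 'I_n].
    by apply: eq_map => t; rewrite add0r.
  apply: (count_pairs j0 (y := fun k : seq bool * V * V => map (site k.1.2 k.2) k.1.1)).
  move=> z /bad_word[s [sz sub ->]].
  exists (s, walk xi x (lo j0 z.1).+1, walk xi x (lo j0 z.2).+1) => //.
  apply/allpairsP; exists (s, walk xi x (lo j0 z.1).+1, walk xi x (lo j0 z.2).+1).
  split=> //=; last exact: mem_all_sites.
  apply/allpairsP; exists (s, walk xi x (lo j0 z.1).+1).
  by rewrite mem_all_sites mem_filter sub mem_words.
rewrite pEZ pE_sum natrM -mulrA ler_wpM2l// !big_allpairs_dep /=.
apply: (@le_trans _ _ (\sum_(s <- W) (n%:R * (H ^+ (2 * #|J| - 4) * T3)))).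
  rewrite /W !big_filter big_seq_cond [leRHS]big_seq_cond.
  apply: ler_sum => s /andP[]; rewrite mem_words => sz sub.
  apply: le_trans (sum_Eocc_word w_ge0 w_sum1 H0 green_le green3_le (undup_uniq _) sub) _.
  rewrite ler_wpM2l// ler_wpM2r// ler_weXn2l// leq_sub2r//.
rewrite [leLHS](sumr_const_seq W) -[leLHS]mulr_natl ler_wpM2r ?mulr_ge0 ?exprn_ge0//.
by rewrite ler_nat size_filter count_size.
Qed.

Theorem pVar_num_coincide_le :
  pVar num_coincide <= (C * (2 * #|J|))%:R * (n%:R * H ^+ (2 * #|J| - 1))
    + ((C * size (words (2 * #|J|)))%:R * (n%:R * (H ^+ (2 * #|J| - 4) * T3))) *+ 2.
Proof.
pose f x (t : 'I_n) := walk xi x t.+1.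
pose S x i j : R := (same_site j0 (f x) (i, j))%:R.
pose B x i j : R := (bad j0 (f x) (i, j))%:R.
pose G x i j : R := (good j0 i j)%:R * ((coincide x i)%:R * (coincide x j)%:R).
have le2 x : num_coincide x ^+ 2 <= (\sum_i \sum_j S x i j)
    + (\sum_i \sum_j B x i j) *+ 2 + (\sum_i \sum_j G x i j) *+ 2.
  have dbl F : (\sum_i \sum_j F i j) *+ 2 = \sum_i \sum_j (F i j + F j i) :> R.
    rewrite mulr2n [X in _ + X]exchange_big -big_split /=.
    by apply: eq_bigr => i _; rewrite -big_split.
  rewrite expr2 big_distrlr /= !dbl.
  rewrite -!big_split; apply: ler_sum => i _; rewrite -!big_split; apply: ler_sum => j _.
  rewrite /= /S /B /G -!natrM -!natrD ler_nat.
  move: (constb_mul_le j0 (f x) i j : (coincide x i * coincide x j <= _ +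
    good j0 i j * (coincide x i * coincide x j) + good j0 j i * (coincide x j * coincide x i) + _ + _)%N).
  by lia.
have pS : pE w (fun x => \sum_i \sum_j S x i j) <= (C * (2 * #|J|))%:R * (n%:R * H ^+ (2 * #|J| - 1)).
  apply: le_trans pE_same_le; rewrite le_eqVlt; apply/orP; left; apply/eqP; apply: eq_pE => x.
  by rewrite natr_sum (pair_bigA _ (S x)); apply: eq_bigr => -[].
have pB : pE w (fun x => \sum_i \sum_j B x i j) <=
    (C * size (words (2 * #|J|)))%:R * (n%:R * (H ^+ (2 * #|J| - 4) * T3)).
  apply: le_trans pE_bad_le; rewrite le_eqVlt; apply/orP; left; apply/eqP; apply: eq_pE => x.
  by rewrite natr_sum (pair_bigA _ (B x)); apply: eq_bigr => -[].
have pG : pE w (fun x => \sum_i \sum_j G x i j) =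
    \sum_i \sum_(j | good j0 i j) pE w (fun x => (coincide x i)%:R * (coincide x j)%:R).
  rewrite pE_sum; apply: eq_bigr => i _; rewrite pE_sum [RHS]big_mkcond.
  by apply: eq_bigr => j _; rewrite pEZ; case: good; rewrite ?mul1r ?mul0r.
rewrite lerBlDr; apply: le_trans (le_pE w_ge0 le2) _.
rewrite !pED -!mulr2n pG.
by apply: lerD; [apply: lerD => //; rewrite lerMn2r|apply: sum_good2_le].
Qed.

End Variance.

(** * Binomial coefficients against 4^n *)

Lemma bin_leS n m : (m.*2.+1 <= n)%N -> ('C(n, m) <= 'C(n, m.+1))%N.
Proof.
move=> mn; rewrite -(leq_pmul2l (ltn0Sn m)) mul_bin_left leq_mul2r; apply/orP; right; lia.
Qed.

Lemma bin_le_half n m : ('C(n, m) <= 'C(n, n./2))%N.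
Proof.
have low k : (k <= n./2)%N -> ('C(n, n./2 - k) <= 'C(n, n./2))%N.
  elim: k => [|k IHk] kn; first by rewrite subn0.
  apply: leq_trans (IHk (ltnW kn)).
  have -> : (n./2 - k)%N = (n./2 - k.+1).+1 by lia.
  by apply: bin_leS; lia.
have [mn|nm] := leqP m n; last by rewrite bin_small.
have [mh|hm] := leqP m n./2.
  by have := low (n./2 - m)%N (leq_subr _ _); rewrite subKn.
rewrite -bin_sub//.
by have := low (n./2 - (n - m))%N (leq_subr _ _); rewrite subKn//; lia.
Qed.

Lemma bin_centralS m : (m.+1 * 'C(m.+1.*2, m.+1) = 2 * (m.*2.+1) * 'C(m.*2, m))%N.
Proof.
have e1 := mul_bin_diag m.*2.+2 m; have e2 := mul_bin_diag m.*2.+1 m.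
have e3 : 'C(m.*2.+1, m.+1) = 'C(m.*2.+1, m).
  by rewrite -[RHS]bin_sub; [congr 'C(_, _)|]; lia.
by rewrite e3 /= in e1 e2; rewrite doubleS -e1 -mulnA e2 mulnA; congr (_ * _)%N; lia.
Qed.

Lemma bin_central_sqr m : ('C(m.*2, m) ^ 2 * m.*2.+1 <= 4 ^ m.*2)%N.
Proof.
elim: m => // m IHm.
rewrite -(leq_pmul2l (_ : 0 < m.+1 ^ 2)%N)// mulnA -expnMn bin_centralS.
rewrite doubleS !expnS; move: IHm.
set c := 'C(_, _); set p := (4 ^ _)%N => IHm.
nia.
Qed.

(** The bound 1/sqrt(n + 1) on binomial probabilities, squared so as to stay in the naturals. Odd n
    reduces to even n since C(2k+2, k+1) is twice C(2k+1, k). *)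
Lemma bin_sqr n m : ('C(n, m) ^ 2 * n.+1 <= 4 ^ n)%N.
Proof.
apply: (@leq_trans ('C(n, n./2) ^ 2 * n.+1)); first by rewrite leq_mul2r leq_exp2r ?bin_le_half ?orbT.
move: (odd_double_half n); move: (odd n) (n./2) => b k <-.
case: b; rewrite ?add0n ?bin_central_sqr// add1n.
have := bin_central_sqr k.+1; rewrite doubleS binS.
have -> : 'C(k.*2.+1, k.+1) = 'C(k.*2.+1, k).
  by rewrite -[RHS]bin_sub; [congr 'C(_, _)|]; lia.
by rewrite !expnS; set c := 'C(_, _); set p := (4 ^ _)%N; nia.
Qed.

(** * Anti-concentration of the transition probabilities *)

Section Concentration.
Variables (R : rcfType) (T : finType) (w : T -> R) (V : zmodType) (xi : T -> V).

(** One step of the walk acting on functions. The weights [u] may have total mass below 1, as [rest]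
    below has. *)
Definition cv (u : T -> R) (f : V -> R) (x : V) : R := \sum_t u t * f (x - xi t).

Lemma kern_iter m : kern w xi m = iter m (cv w) (fun x => (x == 0)%:R).
Proof. by elim: m => //= m <-. Qed.

Lemma cv_ge0 u f : (forall t, 0 <= u t) -> (forall x, 0 <= f x) -> forall x, 0 <= cv u f x.
Proof. by move=> u0 f0 x; apply: sumr_ge0 => t _; rewrite mulr_ge0. Qed.

Lemma iter_cvD u l f g c x :
  iter l (cv u) (fun y => f y + c * g y) x = iter l (cv u) f x + c * iter l (cv u) g x.
Proof.
elim: l x => //= l IHl x; rewrite /cv mulr_sumr -big_split/=.
by apply: eq_bigr => t _; rewrite IHl mulrDr mulrCA.
Qed.

Section OneDirection.
Variables (p q : T) (delta : R).
Hypothesis w_ge0 : forall t, 0 <= w t.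
Hypothesis w_sum1 : \sum_t w t = 1.
Hypothesis pq : p != q.
Hypothesis delta_gt0 : 0 < delta.
Hypothesis wp : delta <= w p.
Hypothesis wq : delta <= w q.

Let e := xi p - xi q.
(** The step law is split into [rest] and, with weight 2 delta, a fair choice between [p] and
    [q]. *)
Let rest t := w t - delta * (t == p)%:R - delta * (t == q)%:R.

Lemma rest_ge0 t : 0 <= rest t.
Proof.
rewrite /rest; case: eqP => [->|_]; first by rewrite (negbTE pq) mulr1 mulr0 subr0 subr_ge0.
by rewrite mulr0 subr0; case: eqP => [->|_]; rewrite ?mulr1 ?mulr0 ?subr0// subr_ge0.
Qed.

Lemma sum_pick (f : T -> R) (s : T) c : \sum_t c * (t == s)%:R * f t = c * f s.
Proof.
rewrite (bigD1 s)//= eqxx mulr1 big1 ?addr0// => t /negbTE ->.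
by rewrite mulr0 mul0r.
Qed.

Lemma sum_rest : \sum_t rest t = 1 - delta *+ 2.
Proof.
rewrite !sumrB w_sum1; have s1 (s : T) : \sum_t delta * (t == s)%:R = delta.
  by rewrite -[RHS]mulr1 -(sum_pick (fun=> 1) s); apply: eq_bigr => t _; rewrite mulr1.
by rewrite !s1 mulr2n opprD addrA.
Qed.

Lemma delta2_le1 : delta *+ 2 <= 1.
Proof. by rewrite -subr_ge0 -sum_rest sumr_ge0// => t _; apply: rest_ge0. Qed.

Definition hf (f : V -> R) (x : V) : R := (f (x - xi p) + f (x - xi q)) / 2.

Lemma cv_split f x : cv w f x = cv rest f x + delta *+ 2 * hf f x.
Proof.
have -> : delta *+ 2 * hf f x = delta * f (x - xi p) + delta * f (x - xi q).
  by rewrite /hf; field.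
rewrite -(sum_pick (fun t => f (x - xi t)) p) -(sum_pick (fun t => f (x - xi t)) q).
by rewrite /cv -!big_split; apply: eq_bigr => t _; rewrite /rest /=; ring.
Qed.

Lemma iter_hf_cv j f x : cv rest (iter j hf f) x = iter j hf (cv rest f) x.
Proof.
elim: j x => //= j IHj x; rewrite /hf -!IHj /cv -big_split mulr_suml.
by apply: eq_bigr => t _ /=; rewrite !(addrAC _ (- xi t)); ring.
Qed.

Lemma iter_hfE j g x B : (j < B)%N ->
  iter j hf g x = \sum_(b < B) 'C(j, b)%:R / 2 ^+ j * g (x - xi p *+ j + e *+ b).
Proof.
elim: j x B => [|j IHj] x [|B] // jB.
  rewrite big_ord_recl big1 => [|b _]; last by rewrite bin0n /= mul0r mul0r.
  by rewrite /= bin0 mulr0n subr0 addr0 expr0 divr1 mul1r addr0.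
rewrite iterS /hf (IHj _ B.+1 (ltnW jB)) (IHj _ B jB).
rewrite big_ord_recl [RHS]big_ord_recl !bin0 !mulr0n !addr0.
have -> : x - xi p - xi p *+ j = x - xi p *+ j.+1 by rewrite mulrS opprD addrA.
rewrite -addrA mulrDl; congr (_ + _).
  by rewrite exprS; field; rewrite expf_neq0// pnatr_eq0.
rewrite -big_split mulr_suml; apply: eq_bigr => b _ /=.
have -> : x - xi q - xi p *+ j + e *+ b = x - xi p *+ j.+1 + e *+ bump 0 b.
  rewrite /bump add1n mulrS; have -> : e *+ b.+1 = xi p - xi q + e *+ b by rewrite mulrS.
  by rewrite opprD !addrA [x - _ - _ + xi p]addrAC subrK [x - _ - xi q]addrAC.
rewrite /bump add1n binS natrD exprS; field.
by rewrite expf_neq0// pnatr_eq0.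
Qed.

(** After [j] fair choices the position on the line of direction [e] is binomial; each of its
    weights is at most 1/sqrt(j + 1), and [g] has mass at most [G] on the line. *)
Lemma iter_hf_le j g G B x : (j < B)%N -> (forall y, 0 <= g y) ->
  (forall y, \sum_(b < B) g (y + e *+ b) <= G) ->
  iter j hf g x <= G / Num.sqrt j.+1%:R.
Proof.
move=> jB g0 gG; rewrite (iter_hfE _ _ jB).
apply: le_trans (ler_wpM2r _ (gG (x - xi p *+ j))); last by rewrite invr_ge0 sqrtr_ge0.
rewrite mulr_suml; apply: ler_sum => b _; rewrite mulrC ler_wpM2l//.
rewrite ler_pdivrMr ?exprn_gt0// ler_pdivlMl ?sqrtr_gt0//.
rewrite -(@ler_pXn2r _ 2)// ?nnegrE ?mulr_ge0 ?sqrtr_ge0// exprMn sqr_sqrtr//.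
rewrite -exprM muln2 -natrX -natrM mulnC -natrX ler_nat.
by apply: leq_trans (bin_sqr _ _) _; rewrite -muln2 mulnC expnM.
Qed.

(** The mean of the second argument is y + 2 delta, but 1/sqrt is convex, so by Jensen its average
    is no smaller than the value there. Moving [y] by half of this, delta, leaves the room
    needed. *)
Lemma sqrt_step (y : R) : 1 <= y ->
  (1 - delta *+ 2) / Num.sqrt y + delta *+ 2 / Num.sqrt (y + 1) <= (Num.sqrt (y + delta))^-1.
Proof.
move=> y1; have y0 : 0 < y by apply: lt_le_trans y1.
have d2 := delta2_le1; have d0 := delta_gt0.
set a := Num.sqrt y; set b := Num.sqrt (y + 1); set c := Num.sqrt (y + delta).
have a0 : 0 < a by rewrite sqrtr_gt0.
have b0 : 0 < b by rewrite sqrtr_gt0 addr_gt0.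
have c0 : 0 < c by rewrite sqrtr_gt0 addr_gt0.
have a2 : a ^+ 2 = y by rewrite sqr_sqrtr// ltW.
have b2 : b ^+ 2 = a ^+ 2 + 1 by rewrite a2 sqr_sqrtr// ltW// addr_gt0.
have c2 : c ^+ 2 = a ^+ 2 + delta by rewrite a2 sqr_sqrtr// ltW// addr_gt0.
have ab : a <= b by rewrite ler_wsqrtr// lerDl.
have ac : a <= c by rewrite ler_wsqrtr// lerDl ltW.
have hba : (b - a) * (b + a) = 1 by rewrite -subr_sqr b2 addrAC subrr add0r.
have hca : (c - a) * (c + a) = delta by rewrite -subr_sqr c2 addrAC subrr add0r.
have key : b * (b + a) <= 2 * (c * (c + a)) by nra.
have main : b * (c - a) <= delta *+ 2 * (c * (b - a)).
  have -> : b * (c - a) = (b * (b + a)) * (delta / ((b + a) * (c + a))).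
    by rewrite -hca; field; rewrite !gt_eqF// addr_gt0.
  have -> : delta *+ 2 * (c * (b - a)) = 2 * (c * (c + a)) * (delta / ((b + a) * (c + a))).
    have -> : b - a = (b + a)^-1 by rewrite -[RHS]mul1r -hba mulfK// gt_eqF// addr_gt0.
    by field; rewrite !gt_eqF// addr_gt0.
  by rewrite ler_wpM2r// divr_ge0 ?mulr_ge0 ?addr_ge0// ltW.
rewrite -subr_ge0; have -> : c^-1 - ((1 - delta *+ 2) / a + delta *+ 2 / b) =
   (delta *+ 2 * (c * (b - a)) - b * (c - a)) / (a * b * c).
  by field; rewrite !gt_eqF.
by rewrite divr_ge0 ?subr_ge0// !mulr_ge0// ltW.
Qed.

(** Each step is a fair choice, raising [j], or a step of [rest], which scales the line mass [G] by
    1 - 2 delta. Carrying [j], [g] and [G] through the induction avoids the law of the number of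
    fair choices; [B] only has to exceed the largest possible number. *)
Lemma iter_cv_le l j g G B x : (j + l < B)%N -> 0 <= G -> (forall y, 0 <= g y) ->
  (forall y, \sum_(b < B) g (y + e *+ b) <= G) ->
  iter l (cv w) (iter j hf g) x <= G / Num.sqrt (j.+1%:R + delta * l%:R).
Proof.
elim: l j g G x => [|l IHl] j g G x jB G0 g0 gG.
  by rewrite mulr0 addr0 (iter_hf_le _ _ g0 gG)//; rewrite addn0 in jB.
rewrite iterSr.
have -> : cv w (iter j hf g) = fun y => iter j hf (cv rest g) y + delta *+ 2 * iter j.+1 hf g y.
  by apply/funext => y; rewrite cv_split iter_hf_cv.
rewrite iter_cvD.
have G'0 : 0 <= (1 - delta *+ 2) * G by rewrite mulr_ge0// subr_ge0 delta2_le1.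
have g'0 y : 0 <= cv rest g y by apply: cv_ge0 => //; apply: rest_ge0.
have g'G y : \sum_(b < B) cv rest g (y + e *+ b) <= (1 - delta *+ 2) * G.
  rewrite /cv exchange_big /= -sum_rest mulr_suml; apply: ler_sum => t _.
  rewrite -mulr_sumr ler_wpM2l ?rest_ge0//.
  under eq_bigr do rewrite addrAC.
  exact: gG.
have b1 := IHl j _ _ x (ltn_trans (ltnSn _) (_ : (j + l).+1 < B)%N) G'0 g'0 g'G.
have b2 := IHl j.+1 _ _ x (_ : (j.+1 + l < B)%N) G0 g0 gG.
rewrite addnS in jB.
apply: le_trans (lerD (b1 jB) (ler_wpM2l _ (b2 jB))) _.
  by rewrite mulrn_wge0// ltW.
have y1 : 1 <= j.+1%:R + delta * l%:R.
  have : 0 <= delta * l%:R by rewrite mulr_ge0 ?ler0n// ltW.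
  by have := ler0n R j; rewrite -natr1; lra.
have := ler_wpM2l G0 (sqrt_step y1).
have -> : j.+2%:R + delta * l%:R = j.+1%:R + delta * l%:R + 1 by rewrite -[j.+2%:R]natr1 addrAC.
have -> : j.+1%:R + delta * l.+1%:R = j.+1%:R + delta * l%:R + delta.
  by rewrite -[l.+1%:R]natr1 mulrDr mulr1 addrA.
by apply: le_trans; rewrite le_eqVlt; apply/orP; left; apply/eqP; ring.
Qed.

End OneDirection.

Variables (d : nat) (p q : 'I_d -> T) (delta : R).
Hypothesis w_ge0 : forall t, 0 <= w t.
Hypothesis w_sum1 : \sum_t w t = 1.
Hypothesis delta_gt0 : 0 < delta.
Hypothesis pq : forall i, p i != q i.
Hypothesis wp : forall i, delta <= w (p i).
Hypothesis wq : forall i, delta <= w (q i).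

Let e i := xi (p i) - xi (q i).
Hypothesis e_free : forall c : 'I_d -> int, \sum_i e i *~ c i = 0 -> forall i, c i = 0.

(** Interpolates between the kernel itself, for no direction, and the mass of a full box, which
    freeness controls. *)
Fixpoint box_sum (B : nat) (s : seq 'I_d) (f : V -> R) (x : V) : R :=
  if s is i :: s' then \sum_(b < B) box_sum B s' f (x + e i *+ b) else f x.

Lemma box_sum_ge0 B s f : (forall x, 0 <= f x) -> forall x, 0 <= box_sum B s f x.
Proof. by move=> f0; elim: s => //= i s IHs x; apply: sumr_ge0. Qed.

Lemma box_sum_iter B s l f : box_sum B s (iter l (cv w) f) = iter l (cv w) (box_sum B s f).
Proof.
elim: s => // i s IHs; apply/funext => x /=; rewrite IHs.
elim: l x {IHs} => // l IHl x.
rewrite iterS [RHS]/= /cv exchange_big /=; apply: eq_bigr => t _.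
by rewrite -IHl mulr_sumr; apply: eq_bigr => b _; rewrite addrAC.
Qed.

Let dirac0 (x : V) : R := (x == 0)%:R.

Lemma box_sum_support B s y : uniq s -> box_sum B s dirac0 y != 0 ->
  exists c : 'I_d -> int, (forall i, i \notin s -> c i = 0) /\ y = \sum_i e i *~ c i.
Proof.
elim: s y => [|i s IHs] y /=.
  rewrite /dirac0 pnatr_eq0 eqb0 negbK => _ /eqP ->.
  by exists (fun=> 0); split=> //; rewrite big1// => i _; rewrite mulr0z.
move=> /andP[si us]; rewrite psumr_neq0; last by move=> b _; apply: box_sum_ge0 => x; apply: ler0n.
move=> /hasP[b _ /= bn]; have [|c [cs yc]] := IHs (y + e i *+ b) us; first by rewrite gt_eqF.
exists (fun j => c j - (j == i)%:R * b%:Z); split.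
  move=> j; rewrite inE negb_or => /andP[/negbTE -> js].
  by rewrite cs// mul0r subr0.
under eq_bigr do rewrite mulrzBr.
rewrite sumrB -yc (bigD1 i)//= eqxx mul1r big1 ?addr0 ?addrK// => j /negbTE ->.
by rewrite mul0r mulr0z.
Qed.

(** By freeness no point is represented twice in the box. *)
Lemma box_sum_dirac_le1 B s y : uniq s -> box_sum B s dirac0 y <= 1.
Proof.
elim: s y => [|i s IHs] y /=; first by rewrite /dirac0 lern1 leq_b1.
move=> /andP[si us].
case: (pickP (fun b : 'I_B => box_sum B s dirac0 (y + e i *+ b) != 0)) => [b0 hb0|none]; last first.
  by rewrite big1 ?ler01// => b _; apply/eqP; rewrite -[_ == _]negbK none.
rewrite (bigD1 b0)//= big1 ?addr0; first exact: IHs.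
move=> b bb0; apply/eqP; apply: contraNT bb0 => hb.
have [c0 [c0s y0]] := box_sum_support us hb0.
have [c [cs yc]] := box_sum_support us hb.
have := e_free (c := fun j => c j - c0 j - (j == i)%:R * (b%:Z - b0%:Z)).
move=> /(_ _ i); rewrite eqxx cs// c0s// subr0 mul1r sub0r => h.
have/eqP : - (b%:Z - b0%:Z) = 0.
  apply: h; under eq_bigr do rewrite !mulrzBr.
  rewrite !sumrB -yc -y0 (bigD1 i)//= eqxx mul1r big1 ?addr0; last first.
    by move=> j /negbTE ->; rewrite mul0r mulr0z.
  by rewrite opprD !addrA [y + _ - y]addrAC subrr add0r mulrzBr subrr.
by rewrite oppr_eq0 subr_eq0 => /eqP[bb]; apply/eqP/val_inj.
Qed.

(** Directions are traded for decay one at a time: [l] further steps remove direction [i] from the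
    box and gain one factor. The bound for the box enlarged by [i] is the line-mass hypothesis of
    [iter_cv_le]. *)
Lemma box_sum_kern_le l s t y : uniq (t ++ s) ->
  box_sum l.+1 s (kern w xi (l * size t)) y <= (Num.sqrt (1 + delta * l%:R))^-1 ^+ size t.
Proof.
elim: t s y => [|i t IHt] s y us.
  by rewrite muln0 expr0; apply: box_sum_dirac_le1.
rewrite /= mulnS kern_iter iterD -kern_iter box_sum_iter exprSr.
apply: (@iter_cv_le (p i) (q i) delta w_ge0 w_sum1 (pq i) delta_gt0 (wp i) (wq i) l 0 _ _ l.+1) => //.
- by apply: box_sum_ge0 => x; apply: kern_ge0.
- by move=> x; apply: (IHt (i :: s)); rewrite (perm_uniq (_ : perm_eq _ (i :: t ++ s)))//
    perm_catC /= perm_cons perm_catC.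
Qed.

Lemma kern_addl_le m k K : (forall x, kern w xi m x <= K) -> forall x, kern w xi (k + m) x <= K.
Proof.
move=> hK; elim: k => // k IHk x; rewrite addSn /= -[K]mul1r -w_sum1 mulr_suml.
by apply: ler_sum => t _; apply: ler_wpM2l.
Qed.

Theorem kern_le m x : (0 < d)%N -> (0 < m)%N ->
  kern w xi m x <= (Num.sqrt (d%:R / delta) / Num.sqrt m%:R) ^+ d.
Proof.
move=> d0 m0; set l := (m %/ d)%N.
have d1 : delta <= 1.
  by have := delta2_le1 w_ge0 w_sum1 (pq (Ordinal d0)) (wp _) (wq _); move: delta_gt0; lra.
have base y : kern w xi (l * d) y <= (Num.sqrt (1 + delta * l%:R))^-1 ^+ d.
  have := @box_sum_kern_le l [::] (enum 'I_d) y; rewrite cats0 enum_uniq size_enum_ord /=.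
  exact.
(* Each of the d directions uses m / d steps; the remaining m mod d steps cannot raise the
   supremum. *)
rewrite (divn_eq m d) -/l addnC; apply: le_trans (kern_addl_le _ base x) _.
rewrite addnC -divn_eq lerXn2r ?nnegrE ?invr_ge0 ?sqrtr_ge0 ?divr_ge0 ?sqrtr_ge0//.
have sm : 0 < m%:R :> R by rewrite ltr0n.
have sd : 0 < d%:R :> R by rewrite ltr0n.
have l0 : 0 <= l%:R :> R by [].
have dl0 : 0 <= delta * l%:R by rewrite mulr_ge0 ?ler0n// ltW.
have -> : Num.sqrt (d%:R / delta) / Num.sqrt m%:R = Num.sqrt (d%:R / delta / m%:R).
  by rewrite [RHS]sqrtrM ?divr_ge0 ?ltW// sqrtrV// ltW.
rewrite -sqrtrV ?addr_ge0// ler_wsqrtr// -[leRHS]invrK lef_pV2 ?posrE ?invr_gt0; last 2 first.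
- by rewrite ltr_pwDl.
- by rewrite !divr_gt0.
rewrite !invf_div mulrA ler_pdivrMr//.
have : m%:R <= d%:R * (l%:R + 1) :> R.
  by rewrite natr1 -natrM ler_nat mulnC ltnW// ltn_ceil.
rewrite -(ler_pM2r delta_gt0); move: d1 delta_gt0 l0; set D : R := d%:R.
move=> d1 g0 l0 h; apply: le_trans h _.
rewrite -mulrA mulrC ler_pM2r//; nra.
Qed.

End Concentration.

(** * Elementary sums and logarithms *)

Section Sums.
Variable R : realType.

Lemma sum_invsqrt_le n : \sum_(m < n) (Num.sqrt m.+1%:R)^-1 <= 2 * Num.sqrt n%:R :> R.
Proof.
elim: n => [|n IHn]; first by rewrite big_ord0 sqrtr0 mulr0.
rewrite big_ord_recr /=; apply: le_trans (lerD IHn (lexx _)) _.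
set a := Num.sqrt n%:R; set b := Num.sqrt _.
have b0 : 0 < b by rewrite sqrtr_gt0 ltr0n.
have a0 : 0 <= a by apply: sqrtr_ge0.
have ab : b ^+ 2 = a ^+ 2 + 1 by rewrite !sqr_sqrtr ?natr1// ler0n.
rewrite -subr_ge0; have -> : 2 * b - (2 * a + b^-1) = (2 * b ^+ 2 - 2 * a * b - 1) / b.
  by field; rewrite gt_eqF.
by rewrite divr_ge0 ?ltW//; nra.
Qed.

Lemma invsqrt3_step (a b : R) : 0 < a -> 0 < b -> b ^+ 2 = a ^+ 2 + 1 ->
  b^-1 ^+ 3 <= 2 * a^-1 - 2 * b^-1.
Proof.
move=> a0 b0 ab; rewrite -subr_ge0.
have -> : 2 * a^-1 - 2 * b^-1 - b^-1 ^+ 3 = (2 * b ^+ 2 * (b - a) - a) / (a * b ^+ 3).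
  by field; rewrite !gt_eqF.
rewrite divr_ge0 ?subr_ge0//; last by rewrite mulr_ge0 ?exprn_ge0// ltW.
have lab : a <= b by rewrite -ler_sqr ?nnegrE ?(ltW a0) ?(ltW b0)// ab lerDl.
have h : (b - a) * (b + a) = 1 by rewrite -subr_sqr ab addrAC subrr add0r.
have ba : 0 < b + a by rewrite addr_gt0.
rewrite -(ler_pM2r ba) -(mulrA _ (b - a)) h mulr1; nra.
Qed.

Lemma sum_invsqrt3_le n : \sum_(m < n) (Num.sqrt m.+1%:R)^-1 ^+ 3 <= 3 :> R.
Proof.
case: n => [|n]; first by rewrite big_ord0.
apply: (@le_trans _ _ (3 - 2 * (Num.sqrt n.+1%:R)^-1)); last first.
  by rewrite gerBl mulr_ge0// invr_ge0 sqrtr_ge0.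
elim: n => [|n IHn]; first by rewrite big_ord1 sqrtr1 invr1 expr1n; lra.
rewrite big_ord_recr /=; apply: le_trans (lerD IHn (invsqrt3_step (a := Num.sqrt n.+1%:R) _ _ _)) _.
- by rewrite sqrtr_gt0 ltr0n.
- by rewrite sqrtr_gt0 ltr0n.
- by rewrite !sqr_sqrtr ?ler0n// natr1.
- lra.
Qed.

Lemma ln_succ_bounds n : (0 < n)%N ->
  n.+1%:R^-1 <= ln n.+1%:R - ln n%:R :> R /\ ln n.+1%:R - ln n%:R <= n%:R^-1 :> R.
Proof.
move=> n0; have pn : 0 < n%:R :> R by rewrite ltr0n.
have pn1 : 0 < n.+1%:R :> R by rewrite ltr0n.
split.
  rewrite -lerN2 opprB -ln_div ?posrE//.
  have -> : n%:R / n.+1%:R = 1 + - (n.+1%:R)^-1 :> R.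
    by rewrite -[X in X / _](addrK 1) natr1 mulrBl divff ?gt_eqF// mul1r.
  by apply: le_ln1Dx; rewrite ltrN2 invf_lt1// ltr1n.
rewrite -ln_div ?posrE//.
have -> : n.+1%:R / n%:R = 1 + n%:R^-1 :> R.
  by rewrite -natr1 mulrDl divff ?gt_eqF// mul1r.
by apply: le_ln1Dx; apply: lt_trans (_ : 0 < _); rewrite ?invr_gt0//; lra.
Qed.

Lemma sum_inv_le n : (0 < n)%N -> \sum_(m < n) m.+1%:R^-1 <= 1 + ln n%:R :> R.
Proof.
case: n => // n _; elim: n => [|n IHn]; first by rewrite big_ord1 invr1 ln1 addr0.
rewrite big_ord_recr /=; apply: le_trans (lerD IHn (lexx _)) _.
by have [+ _] := ln_succ_bounds (ltn0Sn n); rewrite -addrA lerD2l lerBrDl.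
Qed.

Lemma sum_inv_ge n : ln n.+1%:R <= \sum_(m < n) m.+1%:R^-1 :> R.
Proof.
elim: n => [|n IHn]; first by rewrite big_ord0 ln1.
rewrite big_ord_recr /=; apply: le_trans (lerD IHn (lexx _)).
by have [_] := ln_succ_bounds (ltn0Sn n); rewrite lerBlDl.
Qed.

Lemma ln_ge_half n : (2 <= n)%N -> 2^-1 <= ln n%:R :> R.
Proof.
move=> n2; apply: le_trans (_ : ln 2 <= _); last by rewrite ler_ln ?posrE ?ltr0n ?ler_nat// ltnW.
have := @le_ln1Dx R (- 2^-1).
have -> : 1 + - 2^-1 = 2^-1 :> R by lra.
rewrite lnV ?posrE// => /(_ _); lra.
Qed.

(** With t = ln n, n = (e^(t/3))^3 >= (t/3)^3, hence 27. In dimension two this absorbs the three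
    surplus logarithms of n H^(2a-1). *)
Lemma ln_cube_le n : (0 < n)%N -> ln n%:R ^+ 3 <= 27 * n%:R :> R.
Proof.
move=> n0; set t := ln _.
have t0 : 0 <= t by apply: ln_ge0; rewrite ler1n.
have -> : n%:R = expR t by rewrite lnK// posrE ltr0n.
have -> : t = 3%:R * (t / 3) by field.
rewrite expRM_natl exprMn -[27]/(27%:R) (_ : 27%:R = 3 ^+ 3) ?ler_pM2l ?exprn_gt0//; last by ring.
rewrite lerXn2r ?nnegrE ?divr_ge0 ?expR_ge0//.
by apply: le_trans (expR_ge1Dx _); rewrite lerDr.
Qed.

End Sums.

(** * The triple sum of Green functions *)

Section KernelSums.
Variables (R : realType) (T : finType) (w : T -> R) (V : zmodType) (xi : T -> V).
Hypothesis w_ge0 : forall t, 0 <= w t.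
Hypothesis w_sum1 : \sum_t w t = 1.
Variables (K : R) (k : nat -> R).
Hypothesis K_ge0 : 0 <= K.
Hypothesis k_ge0 : forall m, 0 <= k m.
Hypothesis kern_le : forall m x, kern w xi m.+1 x <= K * k m.

Lemma green_le_sum n x : green w xi n x <= K * \sum_(m < n) k m.
Proof. by rewrite mulr_sumr; apply: ler_sum => m _; apply: kern_le. Qed.

Lemma sum_kern2_le (A : seq V) (g h : nat) (f : V -> V) (F : V -> R) c :
  uniq A -> injective f -> (forall x, 0 <= F x) -> 0 <= c -> (forall x, F x <= c) ->
  \sum_(x <- A) F x * kern w xi g (f x) <= c.
Proof.
move=> uA fi F0 c0 Fc; apply: (@le_trans _ _ (\sum_(x <- A) c * kern w xi g (f x))).
  by apply: ler_sum => x _; rewrite ler_wpM2r ?kern_ge0.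
rewrite -mulr_sumr ler_piMr// -(big_map f xpredT (kern w xi g)).
by apply: sum_kern_le1 => //; rewrite map_inj_uniq.
Qed.

(** Expand into three kernels and sort their times as c <= b <= a. The kernel with the smallest time
    is summed over [x], with mass at most 1, and the other two are bounded pointwise; the choices of
    c give the factor b + 1, and the orderings give 6. *)
Lemma green3_le_sum n (A : seq V) : uniq A ->
  \sum_(x <- A) green w xi n x * green w xi n (- x) * green w xi n x <=
  6 * K ^+ 2 * \sum_(a < n) k a * \sum_(b < a.+1) b.+1%:R * k b.
Proof.
move=> uA.
pose t3 (a b c : nat) := \sum_(x <- A) kern w xi a.+1 x * kern w xi b.+1 (- x) * kern w xi c.+1 x.
have kk a b : 0 <= K * k a * (K * k b) by rewrite !mulr_ge0.
have k0 m x : 0 <= kern w xi m x by apply: kern_ge0.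
have t_ab a b c : t3 a b c <= K * k a * (K * k b).
  apply: (@sum_kern2_le A _ 0 id) => // x; first by rewrite mulr_ge0.
  by rewrite ler_pM.
have t_ac a b c : t3 a b c <= K * k a * (K * k c).
  rewrite /t3; under eq_bigr do rewrite mulrAC.
  apply: (@sum_kern2_le A _ 0 (fun x => - x)) => // x; first by rewrite mulr_ge0.
  by rewrite ler_pM.
have t_bc a b c : t3 a b c <= K * k b * (K * k c).
  rewrite /t3; under eq_bigr do rewrite -mulrA mulrC.
  apply: (@sum_kern2_le A _ 0 id) => // x; first by rewrite mulr_ge0.
  by rewrite ler_pM.
pose g (a b c : nat) := ((c <= b) && (b <= a))%N%:R * (K * k a * (K * k b)).
have g0 a b c : 0 <= g a b c by rewrite mulr_ge0.
have dom a b c : t3 a b c <= g a b c + g b a c + g a c b + g b c a + g c a b + g c b a.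
  have -> : g a b c + g b a c + g a c b + g b c a + g c a b + g c b a =
    \sum_(u <- [:: g a b c; g b a c; g a c b; g b c a; g c a b; g c b a]) u.
    by rewrite !big_cons big_nil addr0 !addrA.
  have [u us tu] : exists2 u, u \in [:: g a b c; g b a c; g a c b; g b c a; g c a b; g c b a] & t3 a b c <= u.
    have : [|| (c <= b) && (b <= a), (c <= a) && (a <= b), (b <= c) && (c <= a),
      (a <= c) && (c <= b), (b <= a) && (a <= c) | (a <= b) && (b <= c)]%N by lia.
    have gE x y z : (z <= y)%N && (y <= x)%N -> g x y z = K * k x * (K * k y).
      by rewrite /g => ->; rewrite mul1r.
    case/or4P => [h|h|h|/or3P[h|h|h]].
    - by exists (g a b c); rewrite ?inE ?eqxx ?orbT// gE.
    - by exists (g b a c); rewrite ?inE ?eqxx ?orbT// gE// mulrC.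
    - by exists (g a c b); rewrite ?inE ?eqxx ?orbT// gE.
    - by exists (g b c a); rewrite ?inE ?eqxx ?orbT// gE.
    - by exists (g c a b); rewrite ?inE ?eqxx ?orbT// gE// mulrC.
    - by exists (g c b a); rewrite ?inE ?eqxx ?orbT// gE// mulrC.
  apply: le_trans tu _; rewrite (big_rem u us) lerDl big_seq sumr_ge0// => v /mem_rem.
  by rewrite !inE => /or4P[/eqP->|/eqP->|/eqP->|/or3P[]/eqP->].
have sum_g : \sum_(a < n) \sum_(b < n) \sum_(c < n) g a b c =
    K ^+ 2 * \sum_(a < n) k a * \sum_(b < a.+1) b.+1%:R * k b.
  rewrite mulr_sumr; apply: eq_bigr => a _.
  rewrite (big_ord_widen n (fun b => b.+1%:R * k b))// [X in _ * (_ * X)]big_mkcond !mulr_sumr.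
  apply: eq_bigr => b _; rewrite ltnS; have [ba|ab] := leqP b a; last first.
    by rewrite big1 ?mulr0// => c _; rewrite /g [(b <= a)%N]leqNgt ab andbF mul0r.
  have -> : b.+1%:R = \sum_(c < n) (c <= b)%N%:R :> R.
    rewrite -[in LHS](card_ord b.+1) -sum1_card natr_sum (big_ord_widen n (fun=> 1%:R))//.
    by rewrite [LHS]big_mkcond; apply: eq_bigr => c _; rewrite ltnS; case: ifP.
  rewrite mulr_suml !mulr_sumr; apply: eq_bigr => c _.
  by rewrite /g ba andbT; ring.
have sw12 F : \sum_(a < n) \sum_(b < n) \sum_(c < n) F b a c =
    \sum_(a < n) \sum_(b < n) \sum_(c < n) F a b c :> R by rewrite exchange_big.
have sw23 F : \sum_(a < n) \sum_(b < n) \sum_(c < n) F a c b =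
    \sum_(a < n) \sum_(b < n) \sum_(c < n) F a b c :> R.
  by apply: eq_bigr => a _; rewrite exchange_big.
apply: (@le_trans _ _ (\sum_(a < n) \sum_(b < n) \sum_(c < n) t3 a b c)).
  have ex x : green w xi n x * green w xi n (- x) * green w xi n x = \sum_(a < n) \sum_(b < n)
      \sum_(c < n) kern w xi a.+1 x * kern w xi b.+1 (- x) * kern w xi c.+1 x.
    rewrite {1 2}/green big_distrlr mulr_suml; apply: eq_bigr => a _.
    by rewrite mulr_suml; apply: eq_bigr => b _; rewrite mulr_sumr.
  under eq_bigr do rewrite ex.
  rewrite exchange_big; apply: ler_sum => a _; rewrite exchange_big; apply: ler_sum => b _.
  by rewrite exchange_big.
apply: (@le_trans _ _ (\sum_(a < n) \sum_(b < n) \sum_(c < n)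
  (g a b c + g b a c + g a c b + g b c a + g c a b + g c b a))).
  do 3![apply: ler_sum => ? _]; exact: dom.
under eq_bigr do under eq_bigr do rewrite !big_split.
under eq_bigr do rewrite !big_split.
rewrite !big_split /= (sw12 g) (sw23 g) (sw23 (fun a b c => g b a c)) (sw12 g).
rewrite (sw23 (fun a b c => g c b a)) (sw12 (fun a b c => g c a b)).
rewrite (sw23 (fun a b c => g b a c)) (sw12 g) sum_g.
by rewrite le_eqVlt; apply/orP; left; apply/eqP; ring.
Qed.

End KernelSums.

(** * From kernel decay to the rate in each dimension *)

Section Rates.
Variable R : realType.

(** The order (m+1)^(-d/2) of the kernel of m + 1 steps; the square root keeps the exponent a
    natural number. *)
Definition decay (d m : nat) : R := (Num.sqrt m.+1%:R)^-1 ^+ d.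

Lemma decay_ge0 d m : 0 <= decay d m.
Proof. by rewrite exprn_ge0// invr_ge0 sqrtr_ge0. Qed.

Lemma invsqrt_le1 m : (Num.sqrt m.+1%:R)^-1 <= 1 :> R.
Proof. by rewrite invf_le1 ?sqrtr_gt0 ?ltr0n// -[leLHS]sqrtr1 ler_wsqrtr// ler1n. Qed.

Lemma decay_mono d e m : (d <= e)%N -> decay e m <= decay d m.
Proof. by move=> de; apply: ler_wiXn2l de; rewrite ?invr_ge0 ?sqrtr_ge0 ?invsqrt_le1. Qed.

Lemma decay2 m : decay 2 m = m.+1%:R^-1.
Proof. by rewrite /decay exprVn sqr_sqrtr// ler0n. Qed.

Lemma sqrt_decay1 m : Num.sqrt m.+1%:R * decay 1 m = 1.
Proof. by rewrite /decay expr1 divff// gt_eqF// sqrtr_gt0 ltr0n. Qed.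

Lemma decay1D d m : decay d.+1 m = decay 1 m * decay d m.
Proof. by rewrite /decay expr1 exprS. Qed.

Lemma mul_decay2 m : m.+1%:R * decay 2 m = 1.
Proof. by rewrite decay2 divff// pnatr_eq0. Qed.

Definition decay_sum (d n : nat) : R :=
  \sum_(a < n) decay d a * \sum_(b < a.+1) b.+1%:R * decay d b.

Lemma decay_sum1_le n : decay_sum 1 n <= n%:R ^+ 2.
Proof.
have h (a : 'I_n) : decay 1 a * \sum_(b < a.+1) b.+1%:R * decay 1 b <= n%:R.
  apply: (@le_trans _ _ (decay 1 a * (a.+1%:R * Num.sqrt a.+1%:R))).
    rewrite ler_wpM2l ?decay_ge0// mulr_natl -[X in _ *+ X]card_ord -sumr_const.
    apply: ler_sum => b _.
    have -> : b.+1%:R = Num.sqrt b.+1%:R * Num.sqrt b.+1%:R :> R.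
      by rewrite -expr2 sqr_sqrtr// ler0n.
    by rewrite -mulrA sqrt_decay1 mulr1 ler_wsqrtr// ler_nat ltn_ord.
  by rewrite mulrCA [decay 1 a * _]mulrC sqrt_decay1 mulr1 ler_nat.
apply: le_trans (ler_sum _ (fun a _ => h a)) _.
by rewrite sumr_const card_ord expr2 mulr_natr.
Qed.

Lemma decay_sum2_le n : decay_sum 2 n <= n%:R.
Proof.
rewrite -[n in leRHS]card_ord -sumr_const; apply: ler_sum => a _.
under eq_bigr do rewrite mul_decay2.
by rewrite sumr_const card_ord mulrC mul_decay2.
Qed.

Lemma decay_sum3_le n : (0 < n)%N -> decay_sum 3 n <= 2 * (1 + ln n%:R).
Proof.
move=> n0; apply: le_trans (_ : 2 * \sum_(a < n) a.+1%:R^-1 <= _); last by rewrite ler_pM2l// sum_inv_le.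
rewrite mulr_sumr; apply: ler_sum => a _.
apply: (@le_trans _ _ (decay 3 a * (2 * Num.sqrt a.+1%:R))).
  rewrite ler_wpM2l ?decay_ge0//; apply: le_trans (sum_invsqrt_le R a.+1).
  apply: ler_sum => b _; rewrite decay1D mulrCA mul_decay2 mulr1.
  by rewrite /decay expr1.
by rewrite mulrCA decay1D mulrAC [decay 1 a * _]mulrC sqrt_decay1 mul1r decay2.
Qed.

Lemma decay_sum4_le n : decay_sum 4 n <= 6.
Proof.
apply: le_trans (_ : 2 * \sum_(a < n) decay 3 a <= _).
  rewrite mulr_sumr; apply: ler_sum => a _.
  apply: (@le_trans _ _ (decay 4 a * (2 * Num.sqrt a.+1%:R))).
    rewrite ler_wpM2l ?decay_ge0//; apply: le_trans (sum_invsqrt_le R a.+1).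
    apply: ler_sum => b _; rewrite (_ : decay 4 b = decay 2 b * decay 2 b).
      rewrite mulrA mul_decay2 mul1r; apply: le_trans (decay_mono b (_ : 1 <= 2)%N) _ => //.
    by rewrite /decay -exprD.
  by rewrite mulrCA decay1D mulrAC [decay 1 a * _]mulrC sqrt_decay1 mul1r.
by have := sum_invsqrt3_le R n; rewrite -/(decay 3 _); lra.
Qed.

Section Upper.
Variables (d a : nat) (K : R).
Hypothesis a_ge2 : (2 <= a)%N.
Hypothesis K_ge1 : 1 <= K.

Let c0 : R := ((2 * a) ^ (2 * a) * (2 * a + 2 * size (words (2 * a))))%:R.

Lemma pVar_le_sums (T : finType) (w : T -> R) (V : zmodType) (xi : T -> V) n (j0 : 'I_a) e (H U : R) :
  (forall t, 0 <= w t) -> \sum_t w t = 1 ->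
  (forall m x, kern w xi m.+1 x <= K * decay e m) ->
  1 <= H -> K * \sum_(m < n) decay e m <= H -> decay_sum e n <= U ->
  pVar w (num_coincide R xi (n := n) j0) <=
  c0 * (n%:R * H ^+ (2 * a - 1) + n%:R * (H ^+ (2 * a - 4) * (6 * K ^+ 2 * U))).
Proof.
move=> w0 w1 hk H1 hH hU.
have K0 : 0 <= K by apply: le_trans K_ge1.
have H0 : 0 <= H by apply: le_trans H1.
have U0 : 0 <= U.
  apply: le_trans hU; apply: sumr_ge0 => m _; rewrite mulr_ge0 ?decay_ge0//.
  by apply: sumr_ge0 => b _; rewrite mulr_ge0 ?decay_ge0.
have hg x : green w xi n x <= H by apply: le_trans hH; apply: green_le_sum.
have h3 (A : seq V) : uniq A ->
    \sum_(v <- A) green w xi n v * green w xi n (- v) * green w xi n v <= 6 * K ^+ 2 * U.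
  move=> uA; apply: le_trans (green3_le_sum w0 w1 K0 (decay_ge0 e) hk n uA) _.
  by rewrite ler_wpM2l// mulr_ge0// exprn_ge0.
apply: le_trans (pVar_num_coincide_le j0 w0 w1 H1 hg h3) _; rewrite card_ord.
have X0 : 0 <= n%:R * H ^+ (2 * a - 1) by rewrite mulr_ge0 ?exprn_ge0.
have Y0 : 0 <= n%:R * (H ^+ (2 * a - 4) * (6 * K ^+ 2 * U)).
  by rewrite !mulr_ge0 ?exprn_ge0.
rewrite -[X in _ + X]mulr_natl [X in _ + X]mulrA -natrM mulrDr.
by apply: lerD; rewrite ler_wpM2r// ler_nat; nia.
Qed.

Lemma c0_ge0 : 0 <= c0. Proof. exact: ler0n. Qed.

(** One constant serves all finite alphabets, since the walk enters only through [K]; the truncation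
    argument depends on this uniformity. *)
Theorem pVar_le_vrate : (0 < d)%N -> exists C : R,
  forall (T : finType) (w : T -> R) (V : zmodType) (xi : T -> V) n (j0 : 'I_a),
  (forall t, 0 <= w t) -> \sum_t w t = 1 ->
  (forall m x, kern w xi m.+1 x <= K * decay d m) -> (3 <= n)%N ->
  pVar w (num_coincide R xi (n := n) j0) <= C * vrate R d a n.
Proof.
have K0 : 0 <= K by apply: le_trans K_ge1.
have a1 : (2 * a - 1 = (2 * a - 4) + 3)%N by lia.
move: (c0_ge0) pVar_le_sums; set c := c0 => c_ge0 main.
have lnn n : (3 <= n)%N -> 1 <= 2 * ln n%:R :> R.
  by move=> n3; have := ln_ge_half R (ltnW n3); lra.
have K3 : 1 <= 3 * K by move: K_ge1; lra.
have K2 : 1 <= 2 * K by move: K_ge1; lra.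
move: main; case: d => [//|[|[|[|d']]]] main _.
(* d = 1: H is of order sqrt n and T of order n^2, so the second term has order n^(1+a) and the
   first only n^(a+1/2). *)
- exists (c * ((2 * K) ^+ (2 * a - 1) + (2 * K) ^+ (2 * a - 4) * (6 * K ^+ 2))).
  move=> T w V xi n j0 w0 w1 hk n3; set s := Num.sqrt (n%:R : R).
  have s1 : 1 <= s by rewrite -[leLHS]sqrtr1 ler_wsqrtr// ler1n (leq_trans _ n3).
  have s0 : 0 <= s by apply: le_trans s1.
  have ns : n%:R = s ^+ 2 by rewrite sqr_sqrtr.
  have H1 : 1 <= 2 * K * s by rewrite mulr_ege1.
  have hS : K * \sum_(m < n) decay 1 m <= 2 * K * s.
    rewrite [2 * K]mulrC -mulrA ler_wpM2l//; apply: le_trans (sum_invsqrt_le R n).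
    by under eq_bigr do rewrite /decay expr1.
  apply: le_trans (main _ _ _ xi n j0 _ _ _ w0 w1 hk H1 hS (decay_sum1_le n)) _.
  rewrite /vrate -[leRHS]mulrA ler_wpM2l// ns -!exprM !(exprMn _ (2 * K)) [leRHS]mulrDl; apply: lerD.
    rewrite [leLHS]mulrCA ler_wpM2l ?exprn_ge0 ?mulr_ge0// -exprD ler_weXn2l//; lia.
  have -> : (2 * (1 + a) = 2 + (2 * a - 4) + 2 * 2)%N by lia.
  rewrite !exprD le_eqVlt; apply/orP; left; apply/eqP.
  set x := s ^+ (2 * a - 4); ring.
(* d = 2: H is of order ln n and T of order n. The first term, n (ln n)^(2a-1), fits under the rate
   through (ln n)^3 <= 27 n. *)
- exists (c * (27 * (3 * K) ^+ (2 * a - 1) + (3 * K) ^+ (2 * a - 4) * (6 * K ^+ 2))).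
  move=> T w V xi n j0 w0 w1 hk n3; have n0 : (0 < n)%N by apply: leq_trans n3.
  have := lnn n n3; have L3 := ln_cube_le R n0.
  (* As [a >= 2] the integer exponent is nonnegative and the rate is an ordinary power. *)
  rewrite /vrate; have -> : ((2 * a)%N%:Z - 4 = (2 * a - 4)%N)%R by lia.
  have sS := sum_inv_le R n0.
  move: sS L3; set L := ln (n%:R : R) => sS L3 L1; have L0 : 0 <= L by lra.
  have H1 : 1 <= 3 * K * L by rewrite -mulrA mulrCA mulr_ege1//; lra.
  have hS : K * \sum_(m < n) decay 2 m <= 3 * K * L.
    rewrite [3 * K]mulrC -mulrA ler_wpM2l//; under eq_bigr do rewrite decay2.
    by apply: le_trans sS _; lra.
  apply: le_trans (main _ _ _ xi n j0 _ _ _ w0 w1 hk H1 hS (decay_sum2_le n)) _.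
  rewrite -exprnP -[leRHS]mulrA ler_wpM2l// [leRHS]mulrDl; apply: lerD; last first.
    rewrite (exprMn _ (3 * K)) le_eqVlt; apply/orP; left; apply/eqP; ring.
  have eL : L ^+ (2 * a - 1) = L ^+ (2 * a - 4) * L ^+ 3 by rewrite a1 exprD.
  rewrite (exprMn _ (3 * K)) eL.
  have -> : n%:R * ((3 * K) ^+ (2 * a - 1) * (L ^+ (2 * a - 4) * L ^+ 3)) =
    ((3 * K) ^+ (2 * a - 1) * n%:R * L ^+ (2 * a - 4)) * L ^+ 3 by ring.
  have -> : 27 * (3 * K) ^+ (2 * a - 1) * (n%:R ^+ 2 * L ^+ (2 * a - 4)) =
    ((3 * K) ^+ (2 * a - 1) * n%:R * L ^+ (2 * a - 4)) * (27 * n%:R) by ring.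
  by rewrite ler_wpM2l// !mulr_ge0 ?exprn_ge0 ?mulr_ge0.
(* d = 3: H is bounded and T is of order ln n. *)
- exists (c * (2 * (3 * K) ^+ (2 * a - 1) + (3 * K) ^+ (2 * a - 4) * (6 * K ^+ 2 * 6))).
  move=> T w V xi n j0 w0 w1 hk n3; have n0 : (0 < n)%N by apply: leq_trans n3.
  have hS : K * \sum_(m < n) decay 3 m <= 3 * K.
    by rewrite mulrC ler_wpM2r// sum_invsqrt3_le.
  apply: le_trans (main _ _ _ xi n j0 _ _ _ w0 w1 hk K3 hS (decay_sum3_le n0)) _.
  rewrite /vrate; move: (lnn n n3); set L := ln (n%:R : R) => L1.
  rewrite -[leRHS]mulrA ler_wpM2l// [leRHS]mulrDl; apply: lerD.
    have -> : 2 * (3 * K) ^+ (2 * a - 1) * (n%:R * L) = n%:R * (3 * K) ^+ (2 * a - 1) * (2 * L) by ring.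
    by rewrite ler_peMr// mulr_ge0 ?exprn_ge0 ?mulr_ge0.
  have -> : n%:R * ((3 * K) ^+ (2 * a - 4) * (6 * K ^+ 2 * (2 * (1 + L)))) =
    (n%:R * (3 * K) ^+ (2 * a - 4) * (6 * K ^+ 2)) * (2 * (1 + L)) by ring.
  have -> : (3 * K) ^+ (2 * a - 4) * (6 * K ^+ 2 * 6) * (n%:R * L) =
    (n%:R * (3 * K) ^+ (2 * a - 4) * (6 * K ^+ 2)) * (6 * L) by ring.
  by rewrite ler_wpM2l ?mulr_ge0 ?exprn_ge0 ?mulr_ge0//; lra.
(* d >= 4: the decay of dimension 4 already makes H and T bounded. *)
- exists (c * ((3 * K) ^+ (2 * a - 1) + (3 * K) ^+ (2 * a - 4) * (6 * K ^+ 2 * 6))).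
  move=> T w V xi n j0 w0 w1 hk n3; have n0 : (0 < n)%N by apply: leq_trans n3.
  have hk4 m x : kern w xi m.+1 x <= K * decay 4 m.
    by apply: le_trans (hk m x) _; rewrite ler_wpM2l// decay_mono.
  have hS : K * \sum_(m < n) decay 4 m <= 3 * K.
    rewrite mulrC ler_wpM2r//; apply: le_trans (sum_invsqrt3_le R n).
    by apply: ler_sum => m _; apply: (@decay_mono 3 4).
  apply: le_trans (main _ _ _ xi n j0 _ _ _ w0 w1 hk4 K3 hS (decay_sum4_le n)) _.
  rewrite /vrate -[leRHS]mulrA ler_wpM2l// le_eqVlt; apply/orP; left; apply/eqP; ring.
Qed.

End Upper.
End Rates.

(** * Infinite sums and expectations over lattice paths *)

Lemma sum_uniq_subset_le (R : numDomainType) (X : eqType) (a : X -> R) (s1 s2 : seq X) :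
  uniq s1 -> uniq s2 -> {subset s1 <= s2} -> (forall x, 0 <= a x) ->
  \sum_(x <- s1) a x <= \sum_(x <- s2) a x.
Proof.
move=> u1 u2 s12 a0; rewrite [leRHS](bigID (mem s1)) /=.
have -> : \sum_(x <- s2 | x \in s1) a x = \sum_(x <- s1) a x.
  rewrite -big_filter; apply/perm_big/uniq_perm; rewrite ?filter_uniq// => x.
  by rewrite mem_filter andb_idr// => /s12.
by rewrite lerDl sumr_ge0.
Qed.

Section Esum.
Variables (R : realType) (X : choiceType).
Implicit Types (a : X -> R) (s : seq X).

Lemma sum_le_esum a s : uniq s -> (forall x, 0 <= a x) ->
  ((\sum_(x <- s) a x)%:E <= \esum_(x in [set: X]) (a x)%:E)%E.
Proof.
move=> us a0; apply: esum_ge; exists [set` s]%classic => //.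
by rewrite -fsbig_seq// sumEFin.
Qed.

Lemma esum_le_bound a (c : R) : (forall s, uniq s -> \sum_(x <- s) a x <= c) ->
  (\esum_(x in [set: X]) (a x)%:E <= c%:E)%E.
Proof.
move=> ac; apply: ge_ereal_sup => _ [A [/finite_seqP[s ->] _] <-].
have -> : [set` s]%classic = [set` undup s]%classic.
  by apply/seteqP; split=> x /=; rewrite mem_undup.
by rewrite -fsbig_seq ?undup_uniq// sumEFin lee_fin ac ?undup_uniq.
Qed.

Lemma esum_supported a s : uniq s -> (forall x, 0 <= a x) -> (forall x, x \notin s -> a x = 0) ->
  (\esum_(x in [set: X]) (a x)%:E = (\sum_(x <- s) a x)%:E)%E.
Proof.
move=> us a0 az; apply/le_anti/andP; split; last exact: sum_le_esum.
apply: esum_le_bound => r ur.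
rewrite (bigID (mem s)) /= [X in _ + X]big1 ?addr0; last by move=> x; apply: az.
rewrite -big_filter; apply: sum_uniq_subset_le => //; first exact: filter_uniq.
by move=> x; rewrite mem_filter => /andP[].
Qed.

Lemma esum_approx a (c e : R) : (\esum_(x in [set: X]) (a x)%:E = c%:E)%E -> 0 < e ->
  exists2 s, uniq s & c - e < \sum_(x <- s) a x.
Proof.
move=> ec e0; apply: contrapT => no.
have : (\esum_(x in [set: X]) (a x)%:E <= (c - e)%:E)%E.
  apply: esum_le_bound => s us; rewrite leNgt; apply/negP => lt.
  by apply: no; exists s.
by rewrite ec lee_fin; lra.
Qed.

End Esum.

Section PathExpectation.
Variables (R : realType) (d n : nat) (mu : 'rV[int]_d -> R).
Hypothesis mu_law : is_law mu.
Local Notation path := {ffun 'I_n -> 'rV[int]_d}.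

Lemma mu_ge0 z : 0 <= mu z. Proof. by case: mu_law. Qed.

Lemma sum_mu_le1 s : uniq s -> \sum_(z <- s) mu z <= 1.
Proof.
by move=> us; rewrite -lee_fin; case: mu_law => m0 <-; apply: sum_le_esum.
Qed.

Lemma path_weight_ge0 (x : path) : 0 <= path_weight mu x.
Proof. by apply: prodr_ge0 => i _; apply: mu_ge0. Qed.

Definition lift_path (T : finType) (xi : T -> 'rV[int]_d) (x : {ffun 'I_n -> T}) : path :=
  [ffun i => xi (x i)].

Lemma lift_path_inj (T : finType) (xi : T -> 'rV[int]_d) : injective xi -> injective (lift_path xi).
Proof.
by move=> xiI x y /ffunP e; apply/ffunP => i; apply: xiI; have := e i; rewrite !ffunE.
Qed.

Definition lifted_paths (T : finType) (xi : T -> 'rV[int]_d) : seq path :=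
  [seq lift_path xi x | x : {ffun 'I_n -> T} <- enum {: {ffun 'I_n -> T}}].

Lemma lifted_paths_uniq (T : finType) (xi : T -> 'rV[int]_d) : injective xi -> uniq (lifted_paths xi).
Proof. by move=> xiI; rewrite map_inj_uniq ?enum_uniq//; apply: lift_path_inj. Qed.

Lemma sum_lifted_paths (T : finType) (xi : T -> 'rV[int]_d) (g : path -> R) :
  \sum_(x <- lifted_paths xi) path_weight mu x * g x =
  pE (fun t => mu (xi t)) (fun x => g (lift_path xi x)).
Proof.
rewrite big_map big_enum /=; apply: eq_bigr => x _; congr (_ * _).
by apply: eq_bigr => i _; rewrite ffunE.
Qed.

Variables (g : path -> R) (B : R).
Hypothesis g_ge0 : forall x, 0 <= g x.
Hypothesis g_le : forall x, g x <= B.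

Lemma sum_seq_mu (s : seq 'rV[int]_d) :
  \sum_(k < size s) mu (nth 0 s k) = \sum_(z <- s) mu z.
Proof. by rewrite (big_nth 0) big_mkord. Qed.

Lemma nth_ord_inj (s : seq 'rV[int]_d) : uniq s -> injective (fun k : 'I_(size s) => nth 0 s k).
Proof. by move=> us k l /eqP; rewrite nth_uniq// => /eqP /val_inj. Qed.

(* Any finite set of paths lives on finitely many steps. *)
Lemma sum_paths_le (P : seq path) (s : seq 'rV[int]_d) : uniq P -> uniq s ->
  (forall x i, x \in P -> x i \in s) ->
  \sum_(x <- P) path_weight mu x * g x <=
  pE (fun k : 'I_(size s) => mu (nth 0 s k)) (fun x => g (lift_path (fun k : 'I_(size s) => nth 0 s k) x)).
Proof.
move=> uP us Ps; rewrite -sum_lifted_paths.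
set Q := lifted_paths _.
have PQ x : x \in P -> x \in Q.
  move=> xP; apply/mapP.
  have ss i : (index (x i) s < size s)%N by rewrite index_mem Ps.
  exists [ffun i => Ordinal (ss i)]; first by rewrite mem_enum.
  by apply/ffunP => i; rewrite !ffunE /= nth_index// Ps.
apply: sum_uniq_subset_le => //; first by apply/lifted_paths_uniq/nth_ord_inj.
by move=> x; rewrite mulr_ge0 ?path_weight_ge0.
Qed.

Lemma pE_seq_le (s : seq 'rV[int]_d) : uniq s ->
  pE (fun k : 'I_(size s) => mu (nth 0 s k))
     (fun x => g (lift_path (fun k : 'I_(size s) => nth 0 s k) x)) <= B.
Proof.
move=> us; have B0 : 0 <= B by apply: le_trans (g_le [ffun=> 0]).
apply: (@le_trans _ _ (pE (fun k : 'I_(size s) => mu (nth 0 s k)) (fun _ : {ffun 'I_n -> _} => B))).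
  by apply: le_pE => // k; apply: mu_ge0.
rewrite pE_cst sum_seq_mu ler_piMl// exprn_ile1 ?sum_mu_le1//.
by apply: sumr_ge0 => z _; apply: mu_ge0.
Qed.

(** The [fine] in [expect] loses nothing, because the sum is bounded by [B]. *)
Lemma esum_paths_fin :
  (\esum_(x in [set: path]) (path_weight mu x * g x)%:E = (expect mu g)%:E)%E.
Proof.
rewrite /expect fineK// fin_real//; apply/andP; split.
  apply: lt_le_trans (ltNyr 0) (esum_ge0 _) => x _.
  by rewrite lee_fin mulr_ge0 ?path_weight_ge0.
apply: le_lt_trans (ltry B); apply: esum_le_bound => P uP.
pose s := undup (flatten [seq [seq x i | i <- enum 'I_n] | x : path <- P]).
apply: le_trans (sum_paths_le (s := s) uP (undup_uniq _) _) (pE_seq_le (undup_uniq _)).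
move=> x i xP; rewrite mem_undup; apply/flatten_mapP; exists x => //.
by apply/mapP; exists i; rewrite ?mem_enum.
Qed.

Lemma pE_le_expect (s : seq 'rV[int]_d) : uniq s ->
  pE (fun k : 'I_(size s) => mu (nth 0 s k))
     (fun x => g (lift_path (fun k : 'I_(size s) => nth 0 s k) x)) <= expect mu g.
Proof.
move=> us; rewrite -sum_lifted_paths -lee_fin -esum_paths_fin.
apply: sum_le_esum; first by apply/lifted_paths_uniq/nth_ord_inj.
by move=> x; rewrite mulr_ge0 ?path_weight_ge0.
Qed.

(** A finite set of paths that nearly exhausts the sum uses finitely many letters; further letters
    only add nonnegative terms. *)
Lemma expect_approx e : 0 < e -> exists s : seq 'rV[int]_d, forall s', uniq s' -> {subset s <= s'} ->
  expect mu g - e <= pE (fun k : 'I_(size s') => mu (nth 0 s' k))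
     (fun x => g (lift_path (fun k : 'I_(size s') => nth 0 s' k) x)).
Proof.
move=> e0; have [P uP lt] := esum_approx esum_paths_fin e0.
exists (flatten [seq [seq x i | i <- enum 'I_n] | x : path <- P]) => s' us' ss'.
apply: le_trans (ltW lt) _; apply: sum_paths_le => // x i xP; apply: ss'.
by apply/flatten_mapP; exists x => //; apply/mapP; exists i; rewrite ?mem_enum.
Qed.

Lemma expect_finite (T : finType) (xi : T -> 'rV[int]_d) : injective xi ->
  (forall z, z \notin codom xi -> mu z = 0) ->
  expect mu g = pE (fun t => mu (xi t)) (fun x => g (lift_path xi x)).
Proof.
move=> xiI muz; rewrite -sum_lifted_paths /expect (esum_supported (lifted_paths_uniq xiI))//.
  by move=> x; rewrite mulr_ge0 ?path_weight_ge0.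
move=> x xn; suff [i xi_i] : exists i, x i \notin codom xi.
  by rewrite /path_weight (bigD1 i)//= muz// !mul0r.
apply/existsP; apply: contraNT xn; rewrite negb_exists => /forallP all_c.
have cod i : x i \in codom xi by have := all_c i; rewrite negbK.
apply/mapP; exists [ffun i => iinv (cod i)]; first by rewrite mem_enum.
by apply/ffunP => i; rewrite !ffunE f_iinv.
Qed.

End PathExpectation.

(** * The self-intersection local time as a number of coincidences *)

Section Silt.
Variables (R : realType) (T : finType) (d n a : nat) (xi : T -> 'rV[int]_d) (j0 : 'I_a).

Lemma partial_sum_lift (x : {ffun 'I_n -> T}) j :
  partial_sum (lift_path xi x) j = walk xi x j.
Proof. by apply: eq_bigr => i _; rewrite ffunE. Qed.

(** Expanding each power of a local time gives the tuples sitting at that site; a coinciding tuple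
    is counted at one visited site only, that of its first time. *)
Lemma SILT_num_coincide (x : {ffun 'I_n -> T}) :
  (SILT a (lift_path xi x))%:R = num_coincide R xi j0 x.
Proof.
rewrite /num_coincide -natr_sum; congr (_%:R); rewrite /SILT.
set S := fun j : 'I_n => walk xi x j.+1.
have vis : visited (lift_path xi x) = undup [seq S j | j <- enum 'I_n].
  by congr undup; apply: eq_map => j; rewrite partial_sum_lift.
transitivity (\sum_(y <- visited (lift_path xi x))
    \sum_(i : {ffun 'I_a -> 'I_n}) \prod_l (S (i l) == y : nat))%N.
  apply: eq_bigr => y _; rewrite -[RHS](bigA_distr_bigA (fun (_ : 'I_a) j => (S j == y : nat))).
  rewrite prod_nat_const card_ord; congr (_ ^ _)%N.
  by apply: eq_bigr => j _; rewrite partial_sum_lift.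
rewrite exchange_big; apply: eq_bigr => i _ /=.
have Svis : S (lo j0 i) \in visited (lift_path xi x).
  by rewrite vis mem_undup; apply/mapP; exists (lo j0 i); rewrite ?mem_enum.
rewrite (bigD1_seq _ Svis) ?undup_uniq//= [X in (_ + X)%N]big1_seq ?addn0; last first.
  move=> y /andP[yS _]; rewrite (bigD1 [arg min_(l < j0) i l]%N)//=.
  by rewrite -/(lo j0 i) eq_sym (negbTE yS).
rewrite /coincide /constb -/S.
case: (boolP [forall l, S (i l) == S (lo j0 i)]) => [/forallP c|/forallPn[l /negbTE nl]].
  by rewrite big1// => l _; rewrite c.
by rewrite (bigD1 l)//= nl.
Qed.

End Silt.

(** * Independent differences of atoms *)

Section Spanning.
Variables (R : realType) (d : nat) (mu : 'rV[int]_d -> R).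

(** A spanning family contains a basis. Independence over the integers is all that the box argument
    asks for, and it follows from real independence. *)
Lemma genuinely_d_dim_free : genuinely_d_dim mu ->
  exists p q : 'I_d -> 'rV[int]_d, (forall i, 0 < mu (p i) /\ 0 < mu (q i)) /\
    forall c : 'I_d -> int, \sum_i (p i - q i) *~ c i = 0 -> forall i, c i = 0.
Proof.
move=> gen.
have gen' (r : 'I_d) : exists z : {m : nat & (('I_m -> 'rV[int]_d) * ('I_m -> 'rV[int]_d) * ('I_m -> R))%type},
    (forall i, 0 < mu ((tagged z).1.1 i) /\ 0 < mu ((tagged z).1.2 i)) /\
    delta_mx 0 r = \sum_i (tagged z).2 i *: map_mx (fun z : int => z%:~R) ((tagged z).1.1 i - (tagged z).1.2 i).
  have [m [p [q [c [pos e]]]]] := gen (delta_mx 0 r).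
  by exists (existT _ m (p, q, c)).
have [z hz] := choice gen'.
pose J := {r : 'I_d & 'I_(tag (z r))}.
pose P (k : J) := (tagged (z (tag k))).1.1 (tagged k).
pose Q (k : J) := (tagged (z (tag k))).1.2 (tagged k).
(* The differences that produce the d unit vectors are stacked into one matrix; it has full rank,
   and [fullrankfun] selects d independent rows. *)
pose A : 'M[R]_(#|{: J}|, d) := \matrix_(k < #|{: J}|)
  map_mx (fun z : int => z%:~R) (P (enum_val k) - Q (enum_val k)).
have fullA : row_full A.
  rewrite -sub1mx; apply/row_subP => r; rewrite row1 (hz r).2.
  apply: summx_sub => i _; apply: scalemx_sub.
  have := row_sub (enum_rank (Tagged (fun r => 'I_(tag (z r))) i : J)) A.
  by rewrite rowK enum_rankK.
exists (fun i => P (enum_val (fullrankfun fullA i))), (fun i => Q (enum_val (fullrankfun fullA i))).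
split=> [i|c]; first by split; [case: ((hz _).1 (tagged (enum_val (fullrankfun fullA i))))|
  case: ((hz _).1 (tagged (enum_val (fullrankfun fullA i))))].
move=> c0 i; pose v : 'rV[R]_d := \row_i (c i)%:~R.
suff /rowP/(_ i) : v = 0 by rewrite !mxE => /eqP; rewrite intr_eq0 => /eqP.
suff : v *m rowsub (fullrankfun fullA) A = 0.
  by move=> /(congr1 (mulmx^~ (invmx (rowsub (fullrankfun fullA) A)))); rewrite mul0mx mulmxK ?fullrowsub_unit.
apply/rowP => k; rewrite !mxE.
have := congr1 (fun u : 'rV[int]_d => (u 0 k)%:~R : R) c0.
rewrite summxE mxE rmorph_sum /= => e; rewrite -[RHS]e; apply: eq_bigr => l _.
have mulz (u : 'rV[int]_d) (b : int) : (u *~ b) 0 k = b * u 0 k.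
  by rewrite -(@scaler_int int) mxE intz.
by rewrite mulz rmorphM !mxE.
Qed.

End Spanning.

(** * Truncation and the upper bound for general laws *)

Section VarianceUpper.
Variables (R : realType) (T : finType).

Lemma pE_scale (I : finType) (u : T -> R) c (F : {ffun I -> T} -> R) :
  pE (fun t => c * u t) F = c ^+ #|I| * pE u F.
Proof.
rewrite /pE mulr_sumr; apply: eq_bigr => x _.
by rewrite big_split /= prodr_const mulrA.
Qed.

Lemma pVar_ge0 (I : finType) (w : T -> R) (F : {ffun I -> T} -> R) :
  (forall t, 0 <= w t) -> \sum_t w t = 1 ->
  0 <= pE w (fun x => F x ^+ 2) - pE w F ^+ 2.
Proof.
move=> w0 w1; set m := pE w F.
have -> : pE w (fun x => F x ^+ 2) - m ^+ 2 = pE w (fun x => (F x - m) ^+ 2).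
  rewrite (@eq_pE _ _ _ _ (fun x => (F x - m) ^+ 2) (fun x => F x ^+ 2 + ((- 2 * m) * F x + m ^+ 2))).
    by rewrite !pED pEZ pE1// -/m; ring.
  by move=> x; ring.
by apply: pE_ge0 => // x; apply: sqr_ge0.
Qed.

Lemma one_sub_exp_le n (x : R) : 0 <= x <= 1 -> 1 - x ^+ n <= n%:R * (1 - x).
Proof.
move=> /andP[x0 x1]; elim: n => [|n IHn]; first by rewrite expr0 subrr mul0r.
have xn1 : x ^+ n <= 1 by apply: exprn_ile1.
have xn0 : 0 <= x ^+ n by apply: exprn_ge0.
by rewrite exprS -natr1; nra.
Qed.

End VarianceUpper.

Section Transfer.
Variables (R : realType) (d a : nat) (mu : 'rV[int]_d -> R).
Hypothesis mu_law : is_law mu.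

Lemma SILT_le n (x : {ffun 'I_n -> 'rV[int]_d}) : (0 < a)%N ->
  ((SILT a x)%:R <= (n ^ a)%:R :> R).
Proof.
move=> a0.
pose s := undup [seq x i | i <- enum 'I_n].
have ss i : (index (x i) s < size s)%N by rewrite index_mem mem_undup map_f ?mem_enum.
have -> : x = lift_path (fun k : 'I_(size s) => nth 0 s k) [ffun i => Ordinal (ss i)].
  by apply/ffunP => i; rewrite !ffunE /= nth_index// -index_mem.
rewrite (SILT_num_coincide _ _ (Ordinal a0)).
apply: (@le_trans _ _ (\sum_(i : {ffun 'I_a -> 'I_n}) 1)).
  by apply: ler_sum => i _; rewrite lern1 leq_b1.
by rewrite sumr_const card_ffun !card_ord.
Qed.

(* A law is a limit of its restrictions to finite sets, renormalised. *)
Lemma var_SILT_le_finite n (pts : seq 'rV[int]_d) (v : R) : (0 < a)%N ->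
  (forall s : seq 'rV[int]_d, uniq s -> {subset pts <= s} -> 0 < \sum_(z <- s) mu z ->
     forall j0 : 'I_a,
     pVar (fun k : 'I_(size s) => (\sum_(z <- s) mu z)^-1 * mu (nth 0 s k))
       (num_coincide R (fun k : 'I_(size s) => nth 0 s k) (n := n) j0) <= v) ->
  var_SILT mu n a <= v.
Proof.
move=> a0 hv; pose j0 : 'I_a := Ordinal a0.
apply/ler_addgt0Pr => e e0.
pose B : R := (n ^ a)%:R; have B0 : 0 <= B by apply: ler0n.
pose g (x : {ffun 'I_n -> 'rV[int]_d}) : R := (SILT a x)%:R.
have g0 x : 0 <= g x by apply: ler0n.
have gB x : g x <= B by apply: SILT_le.
have g20 x : 0 <= g x ^+ 2 by apply: sqr_ge0.
have g2B x : g x ^+ 2 <= B ^+ 2 by rewrite lerXn2r ?nnegrE.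
(* The final error is n e' B^2 from the lost mass plus e' from the second moment, that is e' D. The
   minimum with 1/2 keeps the truncated mass positive. *)
pose D : R := n%:R * B ^+ 2 + 1.
have D0 : 0 < D by rewrite ltr_wpDl// mulr_ge0 ?exprn_ge0.
pose e' := Num.min (e / D) 2^-1.
have e'0 : 0 < e' by rewrite lt_min divr_gt0//=.
have [s1 h1] := expect_approx mu_law g20 g2B e'0.
have [s2 us2 h2] := esum_approx mu_law.2 e'0.
pose s := undup (pts ++ s1 ++ s2).
have us : uniq s := undup_uniq _.
pose sg := \sum_(z <- s) mu z.
have sg1 : sg <= 1 by apply: (sum_mu_le1 mu_law).
have sg_ge : 1 - e' <= sg.
  apply: le_trans (ltW h2) _; apply: sum_uniq_subset_le => //; last exact: mu_ge0.
  by move=> z zs; rewrite mem_undup !mem_cat zs !orbT.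
have e'2 : e' <= 2^-1 by rewrite ge_min lexx orbT.
have sg0 : 0 < sg by lra.
have ps : {subset pts <= s} by move=> z zs; rewrite mem_undup !mem_cat zs.
have := hv s us ps sg0 j0; rewrite -/sg.
have ss1 : {subset s1 <= s} by move=> z zs; rewrite mem_undup !mem_cat zs orbT.
have := h1 s us ss1; have := pE_le_expect mu_law g0 gB us.
set xi := (fun k : 'I_(size s) => nth 0 s k); set u := (fun k : 'I_(size s) => mu (nth 0 s k)).
set w := (fun k => sg^-1 * _) => E1 E2 V.
have w0 k : 0 <= w k by rewrite mulr_ge0 ?invr_ge0 ?(ltW sg0) ?(mu_ge0 mu_law).
have w1 : \sum_k w k = 1 by rewrite -mulr_sumr sum_seq_mu mulVf// gt_eqF.
(* [u] is the truncated law without renormalisation, the form in which sums over paths converge from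
   below; [n] steps lose the factor [sg ^+ n]. *)
have uw (F : {ffun 'I_n -> 'I_(size s)} -> R) : pE u F = sg ^+ n * pE w F.
  rewrite -[in sg ^+ n](card_ord n) -pE_scale; apply: eq_bigr => x _; congr (_ * _).
  by apply: eq_bigr => k _; rewrite /w mulrA divff ?gt_eqF// mul1r.
set F := num_coincide _ _ _ in V.
have gF x : g (lift_path xi x) = F x by apply: SILT_num_coincide.
have gF2 x : g (lift_path xi x) ^+ 2 = F x ^+ 2 by rewrite gF.
move: E1 E2; rewrite !uw.
rewrite (_ : pE w (fun x => g (lift_path xi x)) = pE w F); last exact: eq_pE.
rewrite (_ : pE w (fun x => g (lift_path xi x) ^+ 2) = pE w (fun x => F x ^+ 2)); last exact: eq_pE.
have m0 : 0 <= pE w F by apply: pE_ge0 => // x; rewrite -gF.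
have mB : pE w F <= B.
  by rewrite -[leRHS](pE1 'I_n w1 B); apply: le_pE => // x; rewrite -gF.
have th1 : sg ^+ n <= 1 by apply: exprn_ile1 => //; apply: ltW.
have th0 : 0 < sg ^+ n by apply: exprn_gt0.
have thn : 1 - sg ^+ n <= n%:R * e'.
  apply: le_trans (one_sub_exp_le n (x := sg) _) _; first by rewrite ltW.
  by rewrite ler_wpM2l//; lra.
have := pVar_ge0 F w0 w1; move: V; rewrite /pVar /var_SILT /Defs.variance -/g.
set m := pE w F in m0 mB *; set q := pE w _; set th := sg ^+ n in th0 th1 thn *.
set Eg := expect mu g; set Eg2 := expect mu _ => V v0 E1 E2.
have Eg_sq : (th * m) ^+ 2 <= Eg ^+ 2.
  have thm0 : 0 <= th * m by rewrite mulr_ge0// ltW.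
  by rewrite lerXn2r ?nnegrE// (le_trans thm0).
have b1 : th * (q - m ^+ 2) <= v by apply: le_trans V; rewrite ler_piMl.
have m2B : m ^+ 2 <= B ^+ 2 by rewrite lerXn2r ?nnegrE.
have m20 : 0 <= m ^+ 2 by apply: sqr_ge0.
have b2 : th * (1 - th) * m ^+ 2 <= n%:R * e' * B ^+ 2.
  apply: ler_pM => //; first by rewrite mulr_ge0 ?subr_ge0// ltW.
  by apply: le_trans thn; rewrite ler_piMl// subr_ge0.
have b3 : e' * D <= e by rewrite -ler_pdivlMr// ge_min lexx.
have eD : e' * D = n%:R * e' * B ^+ 2 + e' by rewrite /D; ring.
(* The left side replaces the two moments by truncated ones: the second moment up to e', the mean
   from below, as its square is subtracted. *)
have eq1 : th * q - (th * m) ^+ 2 = th * (q - m ^+ 2) + th * (1 - th) * m ^+ 2 by ring.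
by lra.
Qed.

End Transfer.

Theorem var_SILT_le (R : realType) (d a : nat) (mu : 'rV[int]_d -> R) :
  (1 <= d)%N -> (2 <= a)%N -> is_law mu -> genuinely_d_dim mu ->
  exists C : R, forall n : nat, (3 <= n)%N -> var_SILT mu n a <= C * @vrate R d a n.
Proof.
move=> d1 a2 law gen; have [p [q [pq_pos pq_free]]] := genuinely_d_dim_free gen.
pose delta : R := \big[Num.min/1]_i Num.min (mu (p i)) (mu (q i)).
have delta0 : 0 < delta.
  by rewrite lt_bigmin// => i _; rewrite lt_min !(pq_pos i).1 (pq_pos i).2.
have delta_le i : delta <= Num.min (mu (p i)) (mu (q i)) by apply: bigmin_le_cond.
(* The constant of [kern_le], raised by 1 to secure [1 <= K]. *)
pose K : R := Num.sqrt (d%:R / delta) ^+ d + 1.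
have K1 : 1 <= K by rewrite lerDr exprn_ge0// sqrtr_ge0.
have [C hC] := pVar_le_vrate a2 K1 d1.
exists C => n n3.
(* Only truncations that contain the chosen atoms are used, so [delta] and the d directions survive
   in each of them. *)
apply: (var_SILT_le_finite law (pts := codom p ++ codom q)); first exact: ltnW.
move=> s us sub sg0 j0; set sg := \sum_(z <- s) mu z in sg0 *.
have sg1 : sg <= 1 by apply: (sum_mu_le1 law).
have p_s i : p i \in s by apply: sub; rewrite mem_cat codom_f.
have q_s i : q i \in s by apply: sub; rewrite mem_cat codom_f orbT.
have ltp i : (index (p i) s < size s)%N by rewrite index_mem.
have ltq i : (index (q i) s < size s)%N by rewrite index_mem.
have w0 (k : 'I_(size s)) : 0 <= sg^-1 * mu (nth 0 s k).
  by rewrite mulr_ge0 ?invr_ge0 ?(ltW sg0) ?(mu_ge0 law).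
have w1 : \sum_(k < size s) sg^-1 * mu (nth 0 s k) = 1.
  by rewrite -mulr_sumr sum_seq_mu mulVf// gt_eqF.
apply: hC => // m x.
(* Renormalising divides by a mass at most 1 and can only enlarge an atom. *)
have wge z : delta <= mu z -> delta <= sg^-1 * mu z.
  move=> dz; apply: le_trans dz _; rewrite ler_peMl ?(mu_ge0 law)//.
  by rewrite invf_ge1.
have pq i : p i != q i.
  apply/eqP => e; have := pq_free (fun j => (j == i)%:R) _ i; rewrite eqxx.
  move=> /(_ _)/eqP; rewrite oner_eq0 => h; suff : false by [].
  apply: h; rewrite (bigD1 i)//= e subrr mul0rz add0r big1// => j /negbTE ->.
  by rewrite mulr0z.
have := @kern_le R _ _ _ (fun k : 'I_(size s) => nth 0 s k) d
  (fun i => Ordinal (ltp i)) (fun i => Ordinal (ltq i)) delta w0 w1 delta0.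
move=> /(_ _ _ _ _ m.+1 x d1 isT) h.
apply: le_trans (h _ _ _ _) _.
- move=> i; apply/eqP => /(congr1 (fun k : 'I_(size s) => nth 0 s k)) /=.
  by rewrite !nth_index// => /eqP; rewrite (negbTE (pq i)).
- by move=> i; rewrite /= nth_index//; apply: wge; apply: le_trans (delta_le i) _; rewrite ge_min lexx.
- by move=> i; rewrite /= nth_index//; apply: wge; apply: le_trans (delta_le i) _; rewrite ge_min lexx orbT.
- move=> c c0; apply: pq_free; rewrite -[RHS]c0; apply: eq_bigr => i _.
  by rewrite /= !nth_index.
- rewrite exprMn -/(decay R d m) ler_wpM2r ?decay_ge0//.
  by rewrite lerDl.
Qed.

(** * The sign of a central coefficient *)

Section CentralCoefficient.
Variable R : realFieldType.

(** The quotient (2r)! / r!, equal to 2^r times the product of the first r odd numbers. *)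
Fixpoint dbl_rising (r : nat) : R := if r is r'.+1 then 2 * (2 * r'%:R + 1) * dbl_rising r' else 1.

Lemma dbl_rising_gt0 r : 0 < dbl_rising r.
Proof. by elim: r => //= r IHr; rewrite !mulr_gt0// ltr_wpDl// mulr_ge0. Qed.

Lemma dbl_rising_fact r : dbl_rising r * r`!%:R = (2 * r)`!%:R.
Proof.
elim: r => [|r IHr]; first by rewrite mul1r.
have -> : (2 * r.+1 = (2 * r).+2)%N by lia.
rewrite 3!factS 3!natrM -IHr /=.
have -> : (2 * r).+2%:R = 2 * (r%:R + 1) :> R by rewrite -[_.+2]addn2 natrD natrM; ring.
have -> : (2 * r).+1%:R = 2 * r%:R + 1 :> R by rewrite -natr1 natrM.
by rewrite -natr1; ring.
Qed.

(** Up to sign, a middle value of a Krawtchouk polynomial. Divided by 2^(2h) it is the Walsh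
    coefficient, on 2r points, of the event that 2h signs balance. *)
Definition central_coef (h r : nat) : R :=
  (('X + 1) ^+ (2 * (h - r)) * ('X - 1) ^+ (2 * r) : {poly R})`_h.

(** From (X - 1)^2 = (X + 1)^2 - 4 X. *)
Lemma central_coefS h r : (r < h)%N ->
  central_coef h r.+1 = central_coef h r - 4 * central_coef h.-1 r.
Proof.
case: h => // h rh; rewrite /central_coef /= !subSS.
set P : {poly R} := ('X + 1) ^+ (2 * (h - r)) * ('X - 1) ^+ (2 * r).
have -> : ('X + 1) ^+ (2 * (h - r)) * ('X - 1) ^+ (2 * r.+1) =
  ('X + 1) ^+ (2 * (h.+1 - r)) * ('X - 1) ^+ (2 * r) - 4%:P * ('X * P) :> {poly R}.
  have -> : (2 * r.+1 = 2 * r + 2)%N by lia.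
  have -> : (2 * (h.+1 - r) = 2 * (h - r) + 2)%N by lia.
  rewrite /P !exprD (_ : 4%:P = 4); first by ring.
  by rewrite -[in LHS]/(4%:R) polyC_natr.
by rewrite coefB coefCM coefXM.
Qed.

(* Closed form: [C(2h,h) C(h,r) / C(2h,2r)] with sign [(-1)^r]. *)
Lemma central_coefE h r : (r <= h)%N ->
  central_coef h r * h`!%:R = (-1) ^+ r * dbl_rising r * dbl_rising (h - r).
Proof.
elim: r h => [|r IHr] h rh.
  rewrite /central_coef subn0 muln0 !expr0 mulr1 exprD1n coef_sum !mul1r.
  have hh : (h < (2 * h).+1)%N by lia.
  rewrite (bigD1 (Ordinal hh))//= coefMn coefXn eqxx big1 ?addr0; last first.
    move=> k kh; rewrite coefMn coefXn; case: eqP => [e|_]; last by rewrite mul0rn.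
    by case/eqP: kh; apply: val_inj.
  have f0 : h`!%:R != 0 :> R by rewrite pnatr_eq0 -lt0n fact_gt0.
  apply: (mulIf f0); rewrite dbl_rising_fact -mulrA -!natrM; congr (_%:R).
  have := @bin_fact (2 * h) h; have -> : (2 * h - h = h)%N by lia.
  by apply; lia.
rewrite central_coefS// mulrBl IHr ?(ltnW rh)//.
have [k ->] : exists k, h = (r + k).+1 by exists (h - r.+1)%N; lia.
have := IHr (r + k)%N (leq_addr _ _); rewrite factS natrM /=.
have -> : (r + k - r = k)%N by lia.
have -> : ((r + k).+1 - r = k.+1)%N by lia.
have -> : ((r + k).+1 - r.+1 = k)%N by lia.
rewrite -[(r + k).+1%:R]natr1 natrD => e; have -> x : 4 * central_coef (r + k) r * ((r%:R + k%:R + 1) * x) =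
   4 * (r%:R + k%:R + 1) * (central_coef (r + k) r * x) by ring.
by rewrite e /= exprS; ring.
Qed.

Lemma central_coef_sign h r : (r <= h)%N -> 0 <= (-1) ^+ r * central_coef h r.
Proof.
move=> rh; have f0 : 0 < h`!%:R :> R by rewrite ltr0n fact_gt0.
rewrite -(pmulr_lge0 _ f0) -mulrA central_coefE// !mulrA -exprMn mulrNN mulr1 expr1n mul1r.
by rewrite mulr_ge0// ltW// dbl_rising_gt0.
Qed.

End CentralCoefficient.

(** * Walsh coefficients and positive correlation *)

Section Walsh.
Variables (R : realFieldType) (I : finType).
Local Notation cube := {ffun I -> bool}.
Implicit Types (F G : cube -> R) (A B : {set I}) (e : cube).

Definition coin (_ : bool) : R := 2^-1.

Lemma sum_coin : \sum_b coin b = 1.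
Proof. by rewrite big_bool /= /coin; field. Qed.

Definition bsign (b : bool) : R := if b then 1 else -1.

Definition chi B e : R := \prod_(s in B) bsign (e s).

Definition walsh F B : R := pE coin (fun e => F e * chi B e).

Lemma chi_depends B : depends_on B (chi B).
Proof. by move=> e e' h; apply: eq_bigr => s sB; rewrite h. Qed.

Lemma chiI A B e : chi B e = chi (B :&: A) e * chi (B :\: A) e.
Proof. by rewrite /chi -big_setID. Qed.

Lemma walsh0 F : walsh F set0 = pE coin F.
Proof. by apply: eq_pE => e; rewrite /chi big_set0 mulr1. Qed.

Lemma parseval F G : pE coin (fun e => F e * G e) = \sum_(B : {set I}) walsh F B * walsh G B.
Proof.
(* Orthogonality over the sets [B]: the sum is a product over coordinates, and a coordinate where
   the two points differ contributes 0. *)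
have orth e e' : \sum_(B : {set I}) chi B e * chi B e' = (2 ^ #|I|)%:R * (e == e')%:R.
  transitivity (\prod_s (bsign (e s) * bsign (e' s) + 1)).
    rewrite bigA_distr /=; apply: eq_big => // B _.
    by rewrite /chi -big_split /= big_mkcond.
  have [<-|ne] := eqVneq e e'.
    rewrite mulr1 natrX -prodr_const; apply: eq_bigr => s _.
    by rewrite /bsign; case: (e s); ring.
  rewrite mulr0; have /existsP[s hs] : [exists s, e s != e' s].
    rewrite -negb_forall; apply: contra ne => /forallP h; apply/eqP/ffunP => s.
    by apply/eqP/h.
  rewrite (bigD1 s)//=; move: hs; rewrite /bsign.
  by case: (e s); case: (e' s) => //= _; rewrite ?mulN1r ?mulrN1 addNr mul0r.
have c2 : (2 ^ #|I|)%:R != 0 :> R by rewrite pnatr_eq0 expn_eq0.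
have wt (e : cube) : \prod_i coin (e i) = (2 ^ #|I|)%:R^-1.
  by rewrite prodr_const natrX exprVn.
transitivity (\sum_(B : {set I}) \sum_(e : cube) \sum_(e' : cube)
    (2 ^ #|I|)%:R^-1 ^+ 2 * (F e * G e') * (chi B e * chi B e')).
  rewrite exchange_big /=; apply: eq_bigr => e _; rewrite wt exchange_big /=.
  rewrite (bigD1 e)//= [X in _ + X]big1 ?addr0.
    by rewrite -mulr_sumr orth eqxx mulr1; move: c2; set c := _%:R => c2; field.
  by move=> e' /negbTE ne; rewrite -mulr_sumr orth eq_sym ne !mulr0.
apply: eq_bigr => B _; rewrite /walsh /pE mulr_suml; apply: eq_bigr => e _.
rewrite mulr_sumr; apply: eq_bigr => e' _; rewrite !wt; ring.
Qed.

(* The sign pattern [(-1)^(|B|/2)] of the Walsh coefficients, common to all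
   functions of interest, makes them positively correlated. *)
Definition walsh_pos F := forall B,
  if odd #|B| then walsh F B = 0 else 0 <= (-1) ^+ #|B|./2 * walsh F B.

(** By Parseval the covariance is the sum over nonempty [B] of products of coefficients, in which
    the common signs cancel. *)
Lemma walsh_pos_cov F G : walsh_pos F -> walsh_pos G ->
  pE coin F * pE coin G <= pE coin (fun e => F e * G e).
Proof.
move=> pF pG; rewrite parseval (bigD1 set0)//= !walsh0 lerDl sumr_ge0// => B _.
have := pF B; have := pG B; case: ifP => _; first by move=> -> ->; rewrite mulr0.
move=> g0 f0; have := mulr_ge0 f0 g0.
by rewrite mulrACA -exprMn mulrNN mulr1 expr1n mul1r.
Qed.

Lemma pE_chi B : pE coin (chi B) = (B == set0)%:R.
Proof.
transitivity (\sum_(e : cube) \prod_s (coin (e s) * (if s \in B then bsign (e s) else 1))).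
  by apply: eq_bigr => e _; rewrite /chi [X in _ * X]big_mkcond -big_split.
transitivity (\prod_s \sum_b coin b * (if s \in B then bsign b else 1)).
  by rewrite bigA_distr_bigA.
have [->|[s sB]] := set_0Vmem B.
  rewrite eqxx big1// => s _; rewrite big_bool inE /= /coin !mulr1. by field.
rewrite (bigD1 s)//= big_bool sB /= /coin mulrN1 mulr1 subrr mul0r.
by case: eqP => // B0; rewrite B0 inE in sB.
Qed.

Lemma walsh_pos1 : walsh_pos (fun=> 1).
Proof.
move=> B; have -> : walsh (fun=> 1) B = (B == set0)%:R.
  by rewrite -pE_chi; apply: eq_pE => e; rewrite mul1r.
case: eqP => [->|_]; first by rewrite cards0 /= mulr1.
by case: ifP; rewrite ?mulr0.
Qed.

(** Characters split along [A], so coefficients multiply; when both parts of [B] are even their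
    halves add up and so do the exponents of the sign. *)
Lemma walsh_pos_mul A F G : depends_on A F -> depends_on (~: A) G ->
  walsh_pos F -> walsh_pos G -> walsh_pos (fun e => F e * G e).
Proof.
move=> dF dG pF pG B.
have -> : walsh (fun e => F e * G e) B = walsh F (B :&: A) * walsh G (B :\: A).
  rewrite /walsh -(pE_indep sum_coin (A := A)).
  - by apply: eq_pE => e; rewrite (chiI A) mulrACA.
  - move=> e e' h; rewrite (dF e e' h); congr (_ * _).
    exact: (depends_onW (subsetIr B A) (@chi_depends _) h).
  - move=> e e' h; rewrite (dG e e' h); congr (_ * _).
    exact: (depends_onW (subsetDr B A) (@chi_depends _) h).
have := pF (B :&: A); have := pG (B :\: A); rewrite -(cardsID A B) oddD.
case: (boolP (odd #|B :&: A|)) => o1; case: (boolP (odd #|B :\: A|)) => o2 /=.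
- by move=> -> _; rewrite !mulr0.
- by move=> _ ->; rewrite mul0r.
- by move=> -> _; rewrite mulr0.
- move=> g0 f0; have := mulr_ge0 f0 g0; rewrite mulrACA -exprD.
  by rewrite halfD (negbTE o1) (negbTE o2).
Qed.

Definition balanced A e : bool := #|A| == (2 * #|[set s in A | e s]|)%N.

Lemma balanced_depends A : depends_on A (balanced A).
Proof.
move=> e e' h; rewrite /balanced; congr (_ == (2 * #|pred_of_set _|)%N).
by apply/setP => s; rewrite !inE; case: (boolP (s \in A)) => // sA; rewrite h.
Qed.

(** Generating function: a positive sign in [A] is marked by X, so a point of [B] contributes (X -
    1)/2 and another point of [A] (X + 1)/2. Balance selects the coefficient of X^h. *)
Lemma walsh_balanced A B h : #|A| = (2 * h)%N -> B \subset A ->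
  walsh (fun e => (balanced A e)%:R) B =
  2^-1 ^+ #|A| * (('X + 1) ^+ (#|A| - #|B|) * ('X - 1) ^+ #|B| : {poly R})`_h.
Proof.
move=> Ah BA.
pose P s (b : bool) : {poly R} := (coin b)%:P * ((if s \in B then (bsign b)%:P else 1) *
  (if (s \in A) && b then 'X else 1)).
have expand e : \prod_s P s (e s) =
    ((\prod_s coin (e s)) * chi B e)%:P * 'X^#|[set s in A | e s]|.
  rewrite !big_split /= -rmorph_prod rmorphM /= mulrA; congr (_ * _ * _).
    by rewrite /chi rmorph_prod -big_mkcond.
  by rewrite -prodr_const [RHS]big_mkcond; apply: eq_bigr => s _; rewrite inE.
transitivity (\sum_(e : cube) \prod_s P s (e s))`_h.
  rewrite coef_sum; apply: eq_bigr => e _.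
  rewrite expand coefCM coefXn /balanced Ah -mulrA; congr (_ * _).
  by rewrite mulrC eqn_pmul2l.
rewrite -(bigA_distr_bigA P) /=.
have -> : \prod_s \sum_b P s b = \prod_s ((if s \in B then (2^-1)%:P * ('X - 1) else 1) *
    (if s \in A :\: B then (2^-1)%:P * ('X + 1) else 1)).
  apply: eq_bigr => s _; rewrite big_bool /P /coin /bsign inE /=.
  case: (boolP (s \in B)) => sB /=.
    by rewrite (subsetP BA _ sB) polyCN polyC1 /=; ring.
  case: (boolP (s \in A)) => sA /=; first by ring.
  by rewrite !mul1r !mulr1 -polyCD -[RHS]polyC1; congr (_%:P); field.
rewrite big_split /= -2!big_mkcond /= !prodr_const !exprMn -!rmorphXn /=.
rewrite mulrACA -rmorphM -exprD /= coefCM cardsD (setIidPr BA) subnKC; last exact: subset_leq_card.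
by congr (_ * _`_h); rewrite mulrC.
Qed.

Lemma pE_flip F : pE coin (fun e => F [ffun s => ~~ e s]) = pE coin F.
Proof.
rewrite /pE [RHS](reindex (fun e : cube => [ffun s => ~~ e s])) /=.
  by apply: eq_bigr => e _; congr (_ * _); apply: eq_bigr => s _; rewrite ffunE.
by exists (fun e : cube => [ffun s => ~~ e s]) => e _; apply/ffunP => s; rewrite !ffunE negbK.
Qed.

Lemma balanced_flip A e : balanced A [ffun s => ~~ e s] = balanced A e.
Proof.
have := cardsID [set s | e s] A; rewrite /balanced.
have -> : A :&: [set s | e s] = [set s in A | e s] by apply/setP => s; rewrite !inE.
have -> : A :\: [set s | e s] = [set s in A | [ffun s => ~~ e s] s].
  by apply/setP => s; rewrite !inE ffunE andbC.
by move=> <-; apply/eqP/eqP; lia.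
Qed.

Lemma chi_flip B e : chi B [ffun s => ~~ e s] = (-1) ^+ #|B| * chi B e.
Proof.
rewrite /chi -prodr_const -big_split; apply: eq_bigr => s _ /=.
by rewrite ffunE /bsign; case: (e s); rewrite /= ?mulr1 ?mulN1r ?opprK.
Qed.

(** Flipping all signs preserves balance and negates odd characters; a point of [B] outside [A] is a
    free sign of mean 0; an odd [A] is never balanced. What remains is the sign of
    [central_coef]. *)
Lemma walsh_pos_balanced A : walsh_pos (fun e => (balanced A e)%:R).
Proof.
move=> B; case: ifP => [oddB|evB].
  have : walsh (fun e => (balanced A e)%:R) B = - walsh (fun e => (balanced A e)%:R) B.
    rewrite {1}/walsh -pE_flip -[RHS]mulN1r -pEZ; apply: eq_pE => e.
    by rewrite balanced_flip chi_flip -signr_odd oddB expr1 mulrCA.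
  by move=> h; lra.
have [BA|nBA] := boolP (B \subset A); last first.
  have -> : walsh (fun e => (balanced A e)%:R) B = 0.
    have -> : walsh (fun e => (balanced A e)%:R) B =
        pE coin (fun e => (balanced A e)%:R * chi (B :&: A) e) * pE coin (chi (B :\: A)).
      rewrite -(pE_indep sum_coin (A := A)).
      - by apply: eq_pE => e; rewrite (chiI A) mulrA.
      - move=> e e' h; rewrite (balanced_depends h); congr (_ * _).
        exact: (depends_onW (subsetIr B A) (@chi_depends _) h).
      - exact: (depends_onW (subsetDr B A) (@chi_depends _)).
    by rewrite pE_chi setD_eq0 (negbTE nBA) mulr0.
  by rewrite mulr0.
have [oddA|evA] := boolP (odd #|A|).
  have -> : walsh (fun e => (balanced A e)%:R) B = 0.
    rewrite /walsh (@eq_pE _ _ _ _ _ (fun=> 0)); first by rewrite pE1// sum_coin.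
    by move=> e; rewrite /balanced; case: eqP => [A2|_]; [rewrite A2 oddM in oddA|rewrite mul0r].
  by rewrite mulr0.
have A2 : #|A| = (2 * #|A|./2)%N by rewrite mul2n even_halfK.
have B2 : #|B| = (2 * #|B|./2)%N by rewrite mul2n even_halfK// evB.
rewrite (walsh_balanced A2 BA) mulrCA mulr_ge0 ?exprn_ge0 ?invr_ge0//.
have BAh : (#|B|./2 <= #|A|./2)%N by rewrite half_leq// subset_leq_card.
have := central_coef_sign R BAh; rewrite /central_coef.
by have -> : (#|A| - #|B| = 2 * (#|A|./2 - #|B|./2))%N by [lia]; rewrite -B2.
Qed.

(** The probability that [N] fair signs sum to zero. *)
Definition cbin (N : nat) : R := if odd N then 0 else 'C(N, N./2)%:R / 2 ^+ N.

Lemma pE_balanced A : pE coin (fun e => (balanced A e)%:R) = cbin #|A|.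
Proof.
rewrite /cbin; case: (boolP (odd #|A|)) => oA.
  rewrite (@eq_pE _ _ _ _ _ (fun=> 0)); first by rewrite pE1// sum_coin.
  by move=> e; rewrite /balanced; case: eqP => // A2; rewrite A2 oddM in oA.
have A2 : #|A| = (2 * #|A|./2)%N by rewrite mul2n even_halfK.
rewrite -walsh0 (walsh_balanced A2 (sub0set A)) cards0 subn0 expr0 mulr1 exprVn mulrC.
congr (_ / _); set h := #|A|./2; set N := #|A|; rewrite exprD1n coef_sum.
have hN : (h < N.+1)%N by rewrite /N A2; lia.
rewrite (bigD1 (Ordinal hN))//= coefMn coefXn eqxx big1 ?addr0// => k kh.
rewrite coefMn coefXn; case: eqP => [e|_]; last by rewrite mul0rn.
by case/eqP: kh; apply: val_inj.
Qed.

Definition all_balanced (r : seq {set I}) e : bool := all (fun A => balanced A e) r.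

Lemma all_balancedE r e : (all_balanced r e)%:R = \prod_(A <- r) (balanced A e)%:R :> R.
Proof.
elim: r => [|A r IHr]; first by rewrite big_nil.
by rewrite big_cons -IHr /= -natrM mulnb.
Qed.

Lemma pE_all_balanced r : pairwise (fun A B : {set I} => [disjoint A & B]) r ->
  pE coin (fun e => (all_balanced r e)%:R) = \prod_(A <- r) cbin #|A|.
Proof.
move=> pr; rewrite (eq_pE _ (all_balancedE r)).
rewrite (pE_indep_seq sum_coin pr (f := fun A e => (balanced A e)%:R)).
  by apply: eq_bigr => A _; apply: pE_balanced.
by move=> A _ e e' h; rewrite (balanced_depends h).
Qed.

Lemma walsh_pos_all_balanced r : pairwise (fun A B : {set I} => [disjoint A & B]) r ->
  walsh_pos (fun e => (all_balanced r e)%:R).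
Proof.
elim: r => [_|A r IHr] /=; first exact: walsh_pos1.
move=> /andP[/allP Ar pr] B.
have := @walsh_pos_mul A (fun e => (balanced A e)%:R) (fun e => (all_balanced r e)%:R) _ _
  (walsh_pos_balanced A) (IHr pr) B.
rewrite (_ : walsh _ B = walsh (fun e => (balanced A e && all_balanced r e)%:R) B); last first.
  by apply: eq_pE => e; rewrite -natrM mulnb.
apply.
- by move=> e e' h; rewrite (balanced_depends h).
- move=> e e' h; congr (nat_of_bool _)%:R; apply: eq_in_all => C Cr.
  apply: balanced_depends => s sC; apply: h; rewrite inE.
  by apply: contraTN sC => sA; rewrite (disjointFr (Ar _ Cr) sA).
Qed.

End Walsh.

(** * Conditioning on one component of the labels *)

Section PairLabels.
Variables (R : realFieldType) (T1 T2 : finType) (u : T1 -> R) (v : T2 -> R) (I : finType).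

Definition ffpair (k : {ffun I -> T1}) (e : {ffun I -> T2}) : {ffun I -> T1 * T2} :=
  [ffun i => (k i, e i)].

Lemma pE_pair (F : {ffun I -> T1 * T2} -> R) :
  pE (fun t => u t.1 * v t.2) F = pE u (fun k => pE v (fun e => F (ffpair k e))).
Proof.
transitivity (\sum_(k : {ffun I -> T1}) \sum_(e : {ffun I -> T2})
    (\prod_i u (k i)) * ((\prod_i v (e i)) * F (ffpair k e))); last first.
  by apply: eq_bigr => k _; rewrite mulr_sumr.
rewrite (pair_bigA _ (fun (k : {ffun I -> T1}) (e : {ffun I -> T2}) =>
  (\prod_i u (k i)) * ((\prod_i v (e i)) * F (ffpair k e)))) /=.
rewrite /pE (reindex (fun z : {ffun I -> T1} * {ffun I -> T2} => ffpair z.1 z.2)) /=.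
  apply: eq_bigr => -[k e] _ /=; rewrite mulrA -big_split /=; congr (_ * _).
  by apply: eq_bigr => i _; rewrite ffunE.
exists (fun x : {ffun I -> T1 * T2} => ([ffun i => (x i).1], [ffun i => (x i).2])).
- by move=> [k e] _ /=; congr pair; apply/ffunP => i; rewrite !ffunE.
- by move=> x _; apply/ffunP => i; rewrite !ffunE /=; case: (x i).
Qed.

End PairLabels.

(** * Blocks of increments between consecutive times *)

Section Intervals.
Variable n : nat.
Local Notation lt_ord := (fun i j : 'I_n => (i < j)%N).
Implicit Types (x y t : 'I_n) (ts : seq 'I_n).

Definition iv x y : {set 'I_n} := [set s : 'I_n | (x < s <= y)%N].

Fixpoint ivs x ts : seq {set 'I_n} := if ts is y :: ts' then iv x y :: ivs y ts' else [::].

Lemma ivs_cat x ts ts' : ivs x (ts ++ ts') = ivs x ts ++ ivs (last x ts) ts'.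
Proof. by elim: ts x => //= t ts IHts x; rewrite IHts. Qed.

Lemma card_iv x y : (x <= y)%N -> #|iv x y| = (y - x)%N.
Proof.
move=> xy; have yn := ltn_ord y.
have e : #|[set s : 'I_n | (s <= y)%N]| = (#|[set s : 'I_n | (s <= x)%N]| + #|iv x y|)%N.
  rewrite -cardsUI (_ : _ :&: _ = set0) ?cards0 ?addn0.
    by congr #|pred_of_set _|; apply/setP => s; rewrite !inE; lia.
  by apply/setP => s; rewrite !inE; lia.
have c (z : 'I_n) : #|[set s : 'I_n | (s <= z)%N]| = z.+1.
  rewrite -sum1dep_card -(card_ord z.+1) -sum1_card.
  by rewrite (big_ord_widen n (fun=> 1%N))//; apply: eq_bigl => s; rewrite ltnS.
by move: e; rewrite !c; lia.
Qed.

Lemma path_lt_last x ts : path lt_ord x ts -> (x <= last x ts)%N.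
Proof. by elim: ts x => //= t ts IHts x /andP[xt /IHts]; apply: leq_trans; apply: ltnW. Qed.

Lemma ivs_sub x ts A : path lt_ord x ts -> A \in ivs x ts -> A \subset iv x (last x ts).
Proof.
elim: ts x => //= t ts IHts x /andP[xt pt]; rewrite inE => /predU1P[->|/(IHts _ pt) At].
  apply/subsetP => s; rewrite !inE => /andP[-> st] /=.
  exact: leq_trans st (path_lt_last pt).
apply: subset_trans At _; apply/subsetP => s; rewrite !inE => /andP[ts' ->].
by rewrite (ltn_trans xt).
Qed.

Lemma ivs_disjoint x ts : path lt_ord x ts ->
  pairwise (fun A B : {set 'I_n} => [disjoint A & B]) (ivs x ts).
Proof.
elim: ts x => //= t ts IHts x /andP[xt pt]; rewrite IHts// andbT.
apply/allP => A /(ivs_sub pt) At; rewrite disjoint_subset.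
apply/subsetP => s; rewrite !inE => /andP[_ st].
by apply/negP => /(subsetP At); rewrite inE ltnNge st.
Qed.

Lemma sum_ivs (M : nmodType) (f : 'I_n -> M) x ts : path lt_ord x ts ->
  \sum_(s in iv x (last x ts)) f s = \sum_(A <- ivs x ts) \sum_(s in A) f s.
Proof.
elim: ts x => [|t ts IHts] x /=.
  by move=> _; rewrite big_nil big_pred0// => s; rewrite inE; lia.
move=> /andP[xt pt]; rewrite big_cons -IHts// (big_setID (iv x t)) /=; congr (_ + _).
  apply: eq_bigl => s; rewrite !inE; have := path_lt_last pt.
  by case: (ltnP x s) => //= xs l; apply/andP/idP => [[]//|st]; split=> //; apply: leq_trans l.
by apply: eq_bigl => s; rewrite !inE; lia.
Qed.

End Intervals.

(** * The simple walk given the directions of its steps *)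

Section Srw.
Variables (R : realType) (d : nat).

Definition srw_step (t : 'I_d * bool) : 'rV[int]_d :=
  if t.2 then delta_mx 0 t.1 else - delta_mx 0 t.1.

Section Colors.
Variables (n : nat) (k : {ffun 'I_n -> 'I_d}).
Implicit Types (A : {set 'I_n}) (e : {ffun 'I_n -> bool}).

Definition color A (c : 'I_d) : {set 'I_n} := A :&: [set s | k s == c].

Definition color_split (r : seq {set 'I_n}) : seq {set 'I_n} :=
  flatten [seq [seq color A c | c <- enum 'I_d] | A <- r].

Lemma color_split_disjoint r :
  pairwise (fun A B : {set 'I_n} => [disjoint A & B]) r ->
  pairwise (fun A B : {set 'I_n} => [disjoint A & B]) (color_split r).
Proof.
elim: r => //= A r IHr /andP[/allP Ar pr]; rewrite /color_split /= pairwise_cat IHr// andbT.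
apply/andP; split.
  apply/allrelP => B C /mapP[c _ ->] /flatten_mapP[A' A'r /mapP[c' _ ->]].
  apply: disjointWl (subsetIl _ _) _; apply: disjointWr (subsetIl _ _) _.
  exact: Ar.
rewrite pairwise_map; have := enum_uniq 'I_d; rewrite uniq_pairwise.
apply: sub_pairwise => c c' /= cc'; rewrite -setI_eq0; apply/eqP/setP => s.
rewrite !inE; apply/negP => /andP[/andP[_ /eqP kc] /andP[_ /eqP kc']].
by move: cc'; rewrite -kc -kc' eqxx.
Qed.

Definition block_zero e A : bool := \sum_(s in A) srw_step (k s, e s) == 0.

Lemma sum_bsign_int e A : \sum_(s in A) (if e s then 1 else -1 : int) =
  (2 * #|[set s in A | e s]|)%N%:Z - #|A|%:Z.
Proof.
have -> : \sum_(s in A) (if e s then 1 else -1 : int) =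
    \sum_(s in A) ((2 * (e s : nat))%N%:R - 1).
  by apply: eq_bigr => s _; case: (e s).
rewrite sumrB sumr_const -natr_sum -!natz; congr (_%:R - _); rewrite -big_distrr /=.
congr (_ * _)%N; rewrite -sum1_card [RHS]big_mkcond [LHS]big_mkcond; apply: eq_bigr => s _.
by rewrite inE; case: (s \in A); case: (e s).
Qed.

(** A block of steps sums to zero iff its signs balance separately in each coordinate direction. *)
Lemma block_zeroE e A : block_zero e A = all (fun B => balanced B e) [seq color A c | c <- enum 'I_d].
Proof.
have entry c : (\sum_(s in A) srw_step (k s, e s)) 0 c =
    \sum_(s in color A c) (if e s then 1 else -1 : int).
  rewrite summxE [RHS]big_mkcond [LHS]big_mkcond; apply: eq_bigr => s _; rewrite !inE.
  case: (s \in A) => //=; rewrite /srw_step /= eq_sym.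
  by case: (e s); rewrite !mxE /=; case: (c == k s).
apply/eqP/allP => [h B /mapP[c _ ->]|h].
  have := entry c; rewrite h mxE sum_bsign_int /balanced => /eqP.
  by rewrite eq_sym subr_eq0 eqz_nat eq_sym.
apply/rowP => c; rewrite entry mxE sum_bsign_int.
have /eqP -> : balanced (color A c) e by apply: h; apply: map_f; rewrite mem_enum.
by rewrite subrr.
Qed.

Lemma all_block_zero e r : all (block_zero e) r = all_balanced (color_split r) e.
Proof.
rewrite /all_balanced /color_split; elim: r => //= A r ->.
by rewrite all_cat block_zeroE.
Qed.

(** The probability, given the directions, that the block [A] sums to zero. *)
Definition beta A : R := \prod_(c : 'I_d) cbin R #|color A c|.

Lemma pE_all_block_zero r : pairwise (fun A B : {set 'I_n} => [disjoint A & B]) r ->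
  pE (coin R) (fun e => (all (block_zero e) r)%:R) = \prod_(A <- r) beta A.
Proof.
move=> pr; under eq_pE do rewrite all_block_zero.
rewrite pE_all_balanced ?color_split_disjoint// /color_split.
elim: r {pr} => [|A r IHr] /=; first by rewrite !big_nil.
by rewrite big_cat big_cons IHr big_map big_enum.
Qed.

Variables (J : finType) (j0 : J).
Implicit Types i j : {ffun J -> 'I_n}.

(** Once its times are sorted, a tuple coincides iff each block between consecutive times sums to
    zero. These blocks are disjoint, so the event is a product. *)
Lemma coincide_ivs i x ts e : codom i =i x :: ts -> path (fun s t : 'I_n => (s < t)%N) x ts ->
  coincide srw_step j0 (ffpair k e) i = all (block_zero e) (ivs x ts).
Proof.
move=> ci; set S := fun t : 'I_n => walk srw_step (ffpair k e) t.+1.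
have -> : coincide srw_step j0 (ffpair k e) i = all (fun t => S t == S x) ts.
  apply/coincideP/allP => [h t tts|h l l'].
    have /codomP[l tl] : t \in codom i by rewrite ci inE tts orbT.
    have /codomP[l' xl] : x \in codom i by rewrite ci mem_head.
    by rewrite /S tl xl; apply/eqP/h.
  have hS l0 : S (i l0) = S x.
    have : i l0 \in x :: ts by rewrite -ci codom_f.
    by rewrite inE => /predU1P[->//|/h /eqP].
  by have := hS l; rewrite -(hS l').
move=> {ci i}; elim: ts x => //= t ts IHts x /andP[xt pt]; rewrite -IHts//.
have -> : (S t == S x) = block_zero e (iv x t).
  rewrite /S (walkB _ _ (ltnW xt)) -subr_eq0 addrAC subrr add0r /block_zero; congr (_ == _).
  by apply: eq_big => s; rewrite ?inE// => _; rewrite ffunE.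
case: (boolP (block_zero e (iv x t))) => //= bz; apply: eq_all => s.
have : S t == S x; last by move=> /eqP ->.
rewrite /S (walkB _ _ (ltnW xt)) -subr_eq0 addrAC subrr add0r.
rewrite -[X in X == 0](_ : \sum_(s in iv x t) srw_step (k s, e s) = _)//.
by apply: eq_big => s'; rewrite ?inE// => _; rewrite ffunE.
Qed.

Lemma coincide_sorted i : exists x ts, codom i =i x :: ts /\ path (fun s t : 'I_n => (s < t)%N) x ts.
Proof.
have : i j0 \in [seq t <- enum 'I_n | t \in codom i] by rewrite mem_filter codom_f mem_enum.
have := sorted_times [set i l | l in J].
have -> : [seq t <- enum 'I_n | t \in [set i l | l in J]] = [seq t <- enum 'I_n | t \in codom i].
  by apply: eq_filter => t; apply/imsetP/codomP => [[l _ ->]|[l ->]]; exists l.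
case e : [seq t <- enum 'I_n | t \in codom i] => [|x ts] //= p _.
by exists x, ts; split=> // t; rewrite -e mem_filter mem_enum andbT.
Qed.

Definition condE i : R := pE (coin R) (fun e => (coincide srw_step j0 (ffpair k e) i)%:R).

Definition condE2 i j : R := pE (coin R) (fun e =>
  (coincide srw_step j0 (ffpair k e) i)%:R * (coincide srw_step j0 (ffpair k e) j)%:R).

Lemma walsh_pos_coincide i :
  walsh_pos (fun e => (coincide srw_step j0 (ffpair k e) i)%:R : R).
Proof.
have [x [ts [ci p]]] := coincide_sorted i => B.
have -> : walsh (fun e => (coincide srw_step j0 (ffpair k e) i)%:R : R) B =
    walsh (fun e => (all_balanced (color_split (ivs x ts)) e)%:R) B.
  by rewrite /walsh; apply: eq_pE => e; rewrite (coincide_ivs _ ci p) all_block_zero.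
exact: (walsh_pos_all_balanced R (color_split_disjoint (ivs_disjoint p))).
Qed.

Lemma cond_cov_ge0 i j : 0 <= condE2 i j - condE i * condE j.
Proof. by rewrite subr_ge0; apply: walsh_pos_cov; apply: walsh_pos_coincide. Qed.

End Colors.

End Srw.

(** * Monotonicity of the return probability *)

Section CentralBinomial.
Variable R : realType.
Local Notation cbin := (cbin R).

Lemma cbin_ge0 N : 0 <= cbin N.
Proof. by rewrite /cbin; case: ifP => // _; rewrite divr_ge0 ?exprn_ge0. Qed.

Lemma cbinSS N : cbin N.+2 * (N%:R + 2) = cbin N * (N%:R + 1).
Proof.
rewrite /cbin /= negbK; case: (boolP (odd N)) => oN; first by rewrite !mul0r.
have [h ->] : exists h, N = h.*2 by exists N./2; rewrite even_halfK.
rewrite doubleK; have := congr1 (fun m => m%:R : R) (bin_centralS h).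
rewrite doubleS !natrM -[h.+1%:R]natr1 -[h.*2.+1%:R]natr1 -mul2n natrM => e.
have -> : 2 * h%:R + 2 = 2 * (h%:R + 1) :> R by ring.
rewrite !exprS; set p := 2 ^+ (2 * h).
have p0 : p != 0 by rewrite expf_neq0.
have -> : 'C((2 * h).+2, h.+1)%:R / (2 * (2 * p)) * (2 * (h%:R + 1)) =
   ((h%:R + 1) * 'C((2 * h).+2, h.+1)%:R) / (2 * p) by field.
by rewrite e; field.
Qed.

Lemma cbin_sqr_ge N : ~~ odd N -> 1 <= cbin N ^+ 2 * (2 * N%:R + 1).
Proof.
move=> eN; have [h ->] : exists h, N = h.*2 by exists N./2; rewrite even_halfK.
elim: h => [|h IHh]; first by rewrite /cbin /= bin0 expr0 divr1 expr1n mulr0 add0r mulr1.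
apply: le_trans IHh _; rewrite doubleS; set N' := h.*2.
have N0 : 0 <= N'%:R :> R by [].
have e := cbinSS N'; have c0 := cbin_ge0 N'.
have D0 : 0 < N'%:R + 2 :> R by lra.
have -> : cbin N'.+2 = cbin N' * (N'%:R + 1) / (N'%:R + 2) by rewrite -e mulfK// gt_eqF.
have -> : (cbin N' * (N'%:R + 1) / (N'%:R + 2)) ^+ 2 * (2 * N'.+2%:R + 1) =
    cbin N' ^+ 2 * ((N'%:R + 1) ^+ 2 * (2 * N'%:R + 5) / (N'%:R + 2) ^+ 2).
  by rewrite -[N'.+2%:R]natr1 -[N'.+1%:R]natr1; field; rewrite gt_eqF.
rewrite ler_wpM2l ?sqr_ge0// ler_pdivlMr ?exprn_gt0//; nra.
Qed.

(** Each step of two is the inequality (N+1)(N+3) <= (N+2)^2. It measures how much the return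
    probability drops when M signs are added, the source of the covariance of nested pairs. *)
Lemma cbin_sqr_le N M : ~~ odd M ->
  cbin (N + M) ^+ 2 * ((N + M)%:R + 1) <= cbin N ^+ 2 * (N%:R + 1).
Proof.
move=> eM; have [h ->] : exists h, M = h.*2 by exists M./2; rewrite even_halfK.
elim: h => [|h IHh]; first by rewrite addn0.
apply: le_trans IHh; rewrite doubleS !addnS; set N' := (N + h.*2)%N.
have N0 : 0 <= N'%:R :> R by [].
have e := cbinSS N'; have c0 := cbin_ge0 N'.
have D0 : 0 < N'%:R + 2 :> R by lra.
have -> : cbin N'.+2 = cbin N' * (N'%:R + 1) / (N'%:R + 2) by rewrite -e mulfK// gt_eqF.
have -> : (cbin N' * (N'%:R + 1) / (N'%:R + 2)) ^+ 2 * (N'.+2%:R + 1) =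
    cbin N' ^+ 2 * ((N'%:R + 1) ^+ 2 * (N'%:R + 3) / (N'%:R + 2) ^+ 2).
  by rewrite -[N'.+2%:R]natr1 -[N'.+1%:R]natr1; field; rewrite gt_eqF.
rewrite ler_wpM2l ?sqr_ge0// ler_pdivrMr ?exprn_gt0//; nra.
Qed.

Lemma cbin_add_le N M : ~~ odd M -> cbin (N + M) <= cbin N.
Proof.
move=> /(cbin_sqr_le N) h; rewrite -ler_sqr ?nnegrE ?cbin_ge0//.
have N0 : 0 < N%:R + 1 :> R by rewrite ltr_wpDl.
rewrite -(ler_pM2r N0); apply: le_trans h; rewrite ler_wpM2l ?sqr_ge0//.
by rewrite natrD -addrA [M%:R + _]addrC addrA lerDl.
Qed.

End CentralBinomial.

(** * Averaging over the directions *)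

Section Beta.
Variables (R : realType) (d n : nat).
Hypothesis d_gt0 : (0 < d)%N.
Implicit Types (k : {ffun 'I_n -> 'I_d}) (A B : {set 'I_n}).

Lemma beta_ge0 k A : 0 <= beta R k A.
Proof. by apply: prodr_ge0 => c _; apply: cbin_ge0. Qed.

Lemma color_depends A c : depends_on A (fun k => color k A c).
Proof. by move=> k k' h; apply/setP => s; rewrite !inE; case: (boolP (s \in A)) => // /h ->. Qed.

Lemma beta_depends A : depends_on A (fun k => beta R k A).
Proof. by move=> k k' h; apply: eq_bigr => c _; rewrite (color_depends c h). Qed.

Lemma sum_card_color k A : (\sum_(c : 'I_d) #|color k A c| = #|A|)%N.
Proof.
rewrite -sum1_card (partition_big (fun s => k s) xpredT)//=; apply: eq_bigr => c _.
by rewrite -sum1_card; apply: eq_bigl => s; rewrite !inE.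
Qed.

Lemma card_colorU k A B c : [disjoint A & B] ->
  #|color k (A :|: B) c| = (#|color k A c| + #|color k B c|)%N.
Proof.
move=> dAB; rewrite -cardsUI (_ : color k A c :&: color k B c = set0) ?cards0 ?addn0.
  by rewrite /color setIUl.
apply/setP => s; rewrite !inE; apply/negP => /andP[/andP[sA _] /andP[sB _]].
by rewrite (disjointFr dAB sA) in sB.
Qed.

Definition unif (_ : 'I_d) : R := d%:R^-1.

Lemma unif_ge0 c : 0 <= unif c. Proof. by rewrite invr_ge0. Qed.

Lemma sum_unif : \sum_c unif c = 1.
Proof. by rewrite sumr_const card_ord -[LHS]mulr_natr mulVf// pnatr_eq0 -lt0n. Qed.

(** Lower bound for the mean of [beta] on an even block: 2^(-d) for the event that every direction
    occurs an even number of times, then (2N+1)^(-1/2) for each direction. *)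
Definition low (N : nat) : R := 2^-1 ^+ d * (Num.sqrt (2 * N%:R + 1))^-1 ^+ d.

Lemma low_ge0 N : 0 <= low N.
Proof. by rewrite mulr_ge0// exprn_ge0// invr_ge0// sqrtr_ge0. Qed.

(** Write each parity indicator as (1 + (-1)^count)/2 and expand over sets of directions. Each term
    averages to the power [#|A|] of a real number, nonnegative as [#|A|] is even, and the empty set
    gives 1. *)
Lemma prob_even_colors A : ~~ odd #|A| ->
  2^-1 ^+ d <= pE unif (fun k => \prod_(c : 'I_d) (~~ odd #|color k A c|)%:R).
Proof.
move=> eA.
pose sg (s : {set 'I_d}) (c : 'I_d) : R := if c \in s then -1 else 1.
have expand k : \prod_(c : 'I_d) (~~ odd #|color k A c|)%:R =
    2^-1 ^+ d * \sum_(s : {set 'I_d}) \prod_(t in A) sg s (k t).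
  transitivity (\prod_(c : 'I_d) (2^-1 * ((-1) ^+ #|color k A c| + 1) : R)).
    apply: eq_bigr => c _; rewrite -signr_odd; case: (odd _) => /=; first by rewrite expr1 addNr mulr0.
    by rewrite expr0; field.
  rewrite big_split /= prodr_const card_ord bigA_distr; congr (_ * _).
  apply: eq_big => // s _.
  rewrite [RHS](partition_big (fun t => k t) xpredT)//=; apply: eq_bigr => c _.
  rewrite (eq_bigr (fun=> sg s c)); last by move=> t /andP[_ /eqP ->].
  rewrite /sg; case: (c \in s); last by rewrite big1.
  by rewrite -prodr_const; apply: eq_bigl => t; rewrite !inE.
rewrite (eq_pE _ expand) pEZ pE_sum -[leLHS]mulr1 ler_wpM2l ?exprn_ge0//.
have val s : pE unif (fun k => \prod_(t in A) sg s (k t)) = (\sum_c unif c * sg s c) ^+ #|A|.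
  transitivity (\sum_(k : {ffun 'I_n -> 'I_d}) \prod_t (unif (k t) * (if t \in A then sg s (k t) else 1))).
    by apply: eq_bigr => k _; rewrite [X in _ * X]big_mkcond -big_split.
  rewrite -(bigA_distr_bigA (fun t c => unif c * (if t \in A then sg s c else 1))) /=.
  rewrite -prodr_const [RHS]big_mkcond; apply: eq_bigr => t _.
  by case: ifP => // _; under eq_bigr do rewrite mulr1; apply: sum_unif.
under eq_bigr do rewrite val.
rewrite (bigD1 set0)//= -[leLHS]addr0; apply: lerD.
  rewrite (_ : \sum_c _ = 1) ?expr1n// -[RHS]sum_unif.
  by apply: eq_bigr => c _; rewrite /sg inE mulr1.
apply: sumr_ge0 => s _.
by rewrite -[#|A|](even_halfK eA) -mul2n exprM exprn_ge0// sqr_ge0.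
Qed.

Lemma pE_beta_ge A : ~~ odd #|A| -> low #|A| <= pE unif (fun k => beta R k A).
Proof.
move=> eA; pose q : R := (Num.sqrt (2 * #|A|%:R + 1))^-1.
have q0 : 0 <= q by rewrite invr_ge0 sqrtr_ge0.
have h k : q ^+ d * \prod_(c : 'I_d) (~~ odd #|color k A c|)%:R <= beta R k A.
  rewrite -[in q ^+ d](card_ord d) -prodr_const -big_split /=; apply: ler_prod => c _.
  rewrite mulr_ge0//=; case: (boolP (odd _)) => oc; first by rewrite mulr0 cbin_ge0.
  rewrite mulr1 -ler_sqr ?nnegrE ?cbin_ge0//.
  have N0 : 0 < 2 * #|color k A c|%:R + 1 :> R by rewrite ltr_wpDl// mulr_ge0.
  have A0 : 0 < 2 * #|A|%:R + 1 :> R by rewrite ltr_wpDl// mulr_ge0.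
  apply: (@le_trans _ _ (2 * #|color k A c|%:R + 1)^-1).
    rewrite /q exprVn sqr_sqrtr ?(ltW A0)// lef_pV2 ?posrE// lerD2r ler_pM2l// ler_nat.
    by apply: subset_leq_card; apply: subsetIl.
  by rewrite -[leLHS]mul1r ler_pdivrMr// cbin_sqr_ge.
apply: le_trans (le_pE unif_ge0 h); rewrite pEZ /low mulrC -/q ler_wpM2l ?exprn_ge0//.
exact: prob_even_colors.
Qed.

Lemma pE_prod_beta_ge r : pairwise (fun A B : {set 'I_n} => [disjoint A & B]) r ->
  all (fun A : {set 'I_n} => ~~ odd #|A|) r ->
  \prod_(A <- r) low #|A| <= pE unif (fun k => \prod_(A <- r) beta R k A).
Proof.
move=> pr /allP er; rewrite (pE_indep_seq sum_unif pr); last by move=> A _; apply: beta_depends.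
rewrite big_seq [leRHS]big_seq; apply: ler_prod => A Ar.
by rewrite low_ge0 pE_beta_ge// er.
Qed.

End Beta.

(** * Covariance of a tuple placed inside the last gap of another *)

Section Nested.
Variables (R : realType) (d n : nat).
Hypothesis d_gt0 : (0 < d)%N.
Local Notation lt_ord := (fun i j : 'I_n => (i < j)%N).
Variables (x0 y0 z : 'I_n) (xs ys : seq 'I_n).
Hypothesis path_x : path lt_ord x0 xs.
Hypothesis path_y : path lt_ord y0 ys.
Hypothesis xy : (last x0 xs < y0)%N.
Hypothesis yz : (last y0 ys < z)%N.

Let x1 := last x0 xs.
Let y1 := last y0 ys.

(** Once the inner tuple coincides, its span contributes nothing, and closing the last gap of [i]
    depends on these increments alone. *)
Definition outer_gap : {set 'I_n} := iv x1 z :\: iv y0 y1.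

Definition nested_blocks : seq {set 'I_n} := outer_gap :: ivs x0 xs ++ ivs y0 ys.

Lemma le_y : (y0 <= y1)%N. Proof. exact: path_lt_last. Qed.

Lemma nested_blocks_disjoint : pairwise (fun A B : {set 'I_n} => [disjoint A & B]) nested_blocks.
Proof.
have ly := le_y.
have dis A B : (A \in ivs x0 xs) && (B \in outer_gap :: ivs y0 ys) ||
    (A == outer_gap) && (B \in ivs y0 ys) -> [disjoint A & B].
  case/orP => [/andP[/(ivs_sub path_x)/subsetP Ax]|/andP[/eqP -> /(ivs_sub path_y)/subsetP By]].
    rewrite inE => /predU1P[->|/(ivs_sub path_y)/subsetP By]; rewrite disjoint_subset;
      apply/subsetP => s /Ax; rewrite !inE -/x1 => sx; apply/negP.
      by move: sx xy; rewrite -/x1; lia.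
    by move=> /By; rewrite inE; move: sx xy; rewrite -/x1; lia.
  rewrite disjoint_subset; apply/subsetP => s sg; apply/negP => /By.
  by move: sg; rewrite /outer_gap !inE => /andP[/negbTE ->].
rewrite /nested_blocks /= pairwise_cat !ivs_disjoint// !andbT; apply/andP; split.
  apply/allP => A; rewrite mem_cat => /orP[Ax|Ay]; last by apply: dis; rewrite eqxx Ay orbT.
  by rewrite disjoint_sym; apply: dis; rewrite Ax mem_head.
by apply/allrelP => A B Ax By; apply: dis; rewrite Ax inE By orbT.
Qed.

Lemma iv_sub_gap : iv y0 y1 \subset iv x1 z.
Proof. by apply/subsetP => s; rewrite !inE; move: xy yz; rewrite -/x1 -/y1; lia. Qed.

Variables (J : finType) (j0 : J) (i j : {ffun J -> 'I_n}).
Hypothesis codom_i : codom i =i x0 :: rcons xs z.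
Hypothesis codom_j : codom j =i y0 :: ys.

Lemma path_xz : path lt_ord x0 (rcons xs z).
Proof.
rewrite rcons_path path_x /=; have := le_y.
by move: xy yz; rewrite -/x1 -/y1; lia.
Qed.

Section FixedColors.
Variable k : {ffun 'I_n -> 'I_d}.

Lemma nested_coincide e :
  (coincide (@srw_step d) j0 (ffpair k e) i && coincide (@srw_step d) j0 (ffpair k e) j) =
  all (block_zero k e) nested_blocks.
Proof.
rewrite (coincide_ivs _ _ _ codom_i path_xz) (coincide_ivs _ _ _ codom_j path_y).
rewrite -cats1 ivs_cat /nested_blocks /= !all_cat /= andbT -/x1.
case: (boolP (all (block_zero k e) (ivs y0 ys))) => [/allP ay|]; last by rewrite !andbF.
rewrite !andbT andbC; congr (_ && _).
rewrite /block_zero (big_setID (iv y0 y1)) /= (setIidPr iv_sub_gap) (sum_ivs _ path_y).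
by rewrite big_seq big1 ?add0r// => A /ay /eqP.
Qed.

Lemma condE2_nested : condE2 R k j0 i j = \prod_(A <- nested_blocks) beta R k A.
Proof.
rewrite -pE_all_block_zero ?nested_blocks_disjoint//; apply: eq_pE => e.
by rewrite -nested_coincide -natrM mulnb.
Qed.

Lemma condE_outer : condE R k j0 i = (\prod_(A <- ivs x0 xs) beta R k A) * beta R k (iv x1 z).
Proof.
have e1 : ivs x0 (rcons xs z) = ivs x0 xs ++ [:: iv x1 z] by rewrite -cats1 ivs_cat.
have := pE_all_block_zero R k (ivs_disjoint path_xz).
rewrite e1 big_cat big_seq1 => <-; apply: eq_pE => e.
by rewrite (coincide_ivs _ _ _ codom_i path_xz) e1.
Qed.

Lemma condE_inner : condE R k j0 j = \prod_(A <- ivs y0 ys) beta R k A.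
Proof.
rewrite -pE_all_block_zero ?ivs_disjoint//; apply: eq_pE => e.
by rewrite (coincide_ivs _ _ _ codom_j path_y).
Qed.

(** Compares closing the whole gap with closing it without the inner span. The span adds an even
    number of steps to each direction, which lowers every factor, and in one direction by a definite
    proportion. *)
Lemma beta_gap_le (h : nat) : (h <= #|iv y0 y1|)%N -> (h <= #|outer_gap|)%N -> (0 < #|outer_gap|)%N ->
  \prod_(A <- ivs y0 ys) beta R k A != 0 ->
  beta R k (iv x1 z) <= (1 - h%:R / (8 * d%:R * #|outer_gap|%:R)) * beta R k outer_gap.
Proof.
move=> hw hm m0 nz; set m := #|outer_gap| in hm m0 *; set w := #|iv y0 y1| in hw *.
(* A block with an odd number of steps in some direction has [beta] 0, which [nz] excludes. *)
have evM c : ~~ odd #|color k (iv y0 y1) c|.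
  have -> : #|color k (iv y0 y1) c| = (\sum_(A <- ivs y0 ys) #|color k A c|)%N.
    have cE A : #|color k A c| = (\sum_(s in A) (k s == c))%N.
      rewrite -sum1_card [LHS]big_mkcond [RHS]big_mkcond; apply: eq_bigr => s _.
      by rewrite !inE; case: (s \in A); case: (k s == c).
    by rewrite cE (sum_ivs _ path_y); apply: eq_bigr => A _; rewrite cE.
  move: nz; elim: (ivs y0 ys) => [|A r IHr]; first by rewrite !big_nil.
  rewrite !big_cons mulf_eq0 negb_or => /andP[bA /IHr]; rewrite oddD => /negbTE ->.
  rewrite addbF; apply: contraNN bA => oA; rewrite /beta (bigD1 c)//= /cbin oA mul0r//.
pose N c := #|color k outer_gap c|; pose M c := #|color k (iv y0 y1) c|.
have gapE c : #|color k (iv x1 z) c| = (N c + M c)%N.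
  rewrite /N /M -card_colorU.
    by rewrite setUC -[X in X :|: _](setIidPr iv_sub_gap) /outer_gap setID.
  by rewrite disjoint_subset; apply/subsetP => s; rewrite !inE => /andP[].
(* Pigeonhole: some direction takes at least the share 1/d of the inner span. *)
have [c0 hc0] : exists c, (w <= d * M c)%N.
  apply/existsP; apply/contraT => /existsPn none.
  have : (\sum_(c : 'I_d) (d * M c) < \sum_(c : 'I_d) w)%N.
    rewrite (bigD1 (Ordinal d_gt0)) // [X in (_ < X)%N](bigD1 (Ordinal d_gt0)) //= -addSn.
    by apply: leq_add; [rewrite ltnNge none|apply: leq_sum => c _; rewrite ltnW// ltnNge none].
  by rewrite -big_distrr /= sum_card_color sum_nat_const card_ord ltnn.
rewrite /beta (bigD1 c0)//= [in leRHS](bigD1 c0)//= mulrA.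
have m0' : 0 < m%:R :> R by rewrite ltr0n.
have d0' : 0 < d%:R :> R by rewrite ltr0n.
(* With N + 1 <= 2m the constant 8 yields 4 t (N + 1) <= M; as t <= 1/8 this gives N + 1 <= (1 -
   t)^2 (N + M + 1). *)
set t : R := h%:R / (8 * d%:R * m%:R).
have t0 : 0 <= t by rewrite divr_ge0 ?mulr_ge0.
have t8 : t <= 8^-1.
  rewrite /t ler_pdivrMr ?mulr_gt0//.
  have -> : 8^-1 * (8 * d%:R * m%:R) = d%:R * m%:R :> R by field.
  rewrite -natrM ler_nat; apply: leq_trans hm _; exact: leq_pmull.
apply: ler_pM.
- exact: cbin_ge0.
- by apply: prodr_ge0 => c _; apply: cbin_ge0.
- rewrite gapE -ler_sqr ?nnegrE ?cbin_ge0 ?mulr_ge0 ?cbin_ge0//; last by rewrite subr_ge0; lra.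
  have Nm : (N c0 <= m)%N by apply: subset_leq_card; apply: subsetIl.
  have hM : (h <= d * M c0)%N by apply: leq_trans hc0.
  have := cbin_sqr_le R (N c0) (evM c0); rewrite -/(M c0).
  set b2 := cbin R _ ^+ 2; set b := cbin R (N c0) => le2.
  have D0 : 0 < (N c0 + M c0)%:R + 1 :> R by rewrite ltr_wpDl.
  rewrite -(ler_pM2r D0); apply: le_trans le2 _; rewrite exprMn [leRHS]mulrAC [leRHS]mulrC ler_wpM2l ?sqr_ge0//.
  have tM : 8 * t * m%:R <= (M c0)%:R.
    rewrite /t; have -> : 8 * (h%:R / (8 * d%:R * m%:R)) * m%:R = h%:R / d%:R :> R by field; rewrite !gt_eqF.
    by rewrite ler_pdivrMr// -natrM ler_nat mulnC.
  rewrite natrD; move: tM Nm; rewrite -(ler_nat R).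
  have : 1 <= m%:R :> R by rewrite ler1n.
  have : 0 <= (N c0)%:R :> R by [].
  set a1 := (N c0)%:R; set a2 := (M c0)%:R; set a3 := m%:R => a10 a31 tM a13.
  have : 4 * t * (a1 + 1) <= a2 by nra.
  by nra.
- by apply: ler_prod => c _; rewrite cbin_ge0 gapE (cbin_add_le R (N c) (evM c)).
Qed.

(** The joint probability and the product of the two share the factors of all blocks but one: the
    gap without the inner span in the former, the whole gap in the latter. *)
Lemma cond_cov_nested (h : nat) : (h <= #|iv y0 y1|)%N -> (h <= #|outer_gap|)%N -> (0 < #|outer_gap|)%N ->
  h%:R / (8 * d%:R * #|outer_gap|%:R) * \prod_(A <- nested_blocks) beta R k A <=
  condE2 R k j0 i j - condE R k j0 i * condE R k j0 j.
Proof.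
move=> hw hm m0; rewrite condE2_nested condE_outer condE_inner /nested_blocks !big_cons !big_cat /=.
set X := \prod_(A <- ivs x0 xs) _; set Y := \prod_(A <- ivs y0 ys) _.
have X0 : 0 <= X by apply: prodr_ge0 => A _; apply: beta_ge0.
have Y0 : 0 <= Y by apply: prodr_ge0 => A _; apply: beta_ge0.
have [->|nz] := eqVneq Y 0; first by rewrite !mulr0 subrr.
have := ler_wpM2r (mulr_ge0 X0 Y0) (beta_gap_le hw hm m0 nz).
set b := beta _ _ outer_gap; set g := beta _ _ _; set t := _ / _ => le.
have -> : b * (X * Y) - X * g * Y = b * (X * Y) - g * (X * Y) by ring.
rewrite lerBrDr; apply: le_trans (lerD (lexx _) le) _.
by rewrite le_eqVlt; apply/orP; left; apply/eqP; ring.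
Qed.

End FixedColors.

Lemma pE_cov_nested (h : nat) : (h <= #|iv y0 y1|)%N -> (h <= #|outer_gap|)%N -> (0 < #|outer_gap|)%N ->
  all (fun A : {set 'I_n} => ~~ odd #|A|) nested_blocks ->
  h%:R / (8 * d%:R * #|outer_gap|%:R) * \prod_(A <- nested_blocks) low R d #|A| <=
  pE (unif R (d := d)) (fun k => condE2 R k j0 i j - condE R k j0 i * condE R k j0 j).
Proof.
move=> hw hm m0 ev.
apply: le_trans (le_pE (@unif_ge0 R d) (fun k => cond_cov_nested k hw hm m0)).
rewrite pEZ ler_wpM2l ?divr_ge0 ?mulr_ge0//.
by apply: pE_prod_beta_ge => //; apply: nested_blocks_disjoint.
Qed.

End Nested.

(** * The variance as a sum of conditional covariances *)

Section CovarianceSum.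
Variables (R : realType) (d n : nat) (J : finType) (j0 : J).
Hypothesis d_gt0 : (0 < d)%N.
Local Notation tup := {ffun J -> 'I_n}.

Definition srw_weight (t : 'I_d * bool) : R := unif R t.1 * coin R t.2.

Definition mean_cov (i j : tup) : R :=
  pE (unif R (d := d)) (fun k => condE2 R k j0 i j - condE R k j0 i * condE R k j0 j).

Lemma mean_cov_ge0 i j : 0 <= mean_cov i j.
Proof. by apply: pE_ge0 => [c|k]; [apply: unif_ge0|apply: cond_cov_ge0]. Qed.

(* Law of total variance: only the part conditional on the directions is kept. *)
Lemma sum_mean_cov_le :
  \sum_i \sum_j mean_cov i j <= pVar srw_weight (num_coincide R (@srw_step d) (n := n) j0).
Proof.
set L := num_coincide _ _ _; pose M k := pE (coin R) (fun e => L (ffpair k e)).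
have ME k : M k = \sum_i condE R k j0 i by rewrite /M /L /num_coincide pE_sum.
have M2E k : pE (coin R) (fun e => L (ffpair k e) ^+ 2) = \sum_i \sum_j condE2 R k j0 i j.
  rewrite (@eq_pE _ _ _ _ _ (fun e => \sum_i \sum_j
    (coincide (@srw_step d) j0 (ffpair k e) i)%:R * (coincide (@srw_step d) j0 (ffpair k e) j)%:R)).
    by rewrite pE_sum; apply: eq_bigr => i _; rewrite pE_sum.
  by move=> e; rewrite expr2 big_distrlr.
rewrite /pVar (pE_pair (unif R (d := d)) (coin R)) (pE_pair (unif R (d := d)) (coin R)) -/M.
have := pVar_ge0 M (@unif_ge0 R d) (sum_unif R d_gt0); rewrite subr_ge0 => le.
apply: (@le_trans _ _ (pE (unif R (d := d)) (fun k => pE (coin R) (fun e => L (ffpair k e) ^+ 2)) -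
  pE (unif R (d := d)) (fun k => M k ^+ 2))); last by rewrite lerD2l lerN2.
rewrite -pEB le_eqVlt; apply/orP; left; apply/eqP.
transitivity (pE (unif R (d := d)) (fun k : {ffun 'I_n -> 'I_d} =>
  \sum_(i : tup) \sum_(j : tup) (condE2 R k j0 i j - condE R k j0 i * condE R k j0 j))).
  by rewrite pE_sum; apply: eq_bigr => i _; rewrite pE_sum.
apply: eq_pE => k; rewrite M2E ME expr2 big_distrlr /= -sumrB.
by apply: eq_bigr => i _; rewrite sumrB.
Qed.

End CovarianceSum.

Lemma ler_sum_injective (R : numDomainType) (P Q : finType) (A : pred P) (f : P -> Q) (F : Q -> R) :
  {in A &, injective f} -> (forall q, 0 <= F q) -> \sum_(p | A p) F (f p) <= \sum_q F q.
Proof.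
move=> fI F0; rewrite -(big_imset (fun q => F q) fI) /=.
by rewrite [leRHS](bigID (mem [set f x | x in A])) /= lerDl sumr_ge0.
Qed.

(** * Increasing times from lists of gaps *)

Section Scan.
Variables (n : nat) (o : 'I_n).
Implicit Types (t : nat) (gs : seq nat).

Definition mk t : 'I_n := insubd o t.

Lemma val_mk t : (t < n)%N -> mk t = t :> nat.
Proof. by move=> tn; rewrite val_insubd tn. Qed.

Definition marks t gs : seq 'I_n := [seq mk s | s <- scanl addn t gs].

Lemma marks_last t gs : last (mk t) (marks t gs) = mk (t + sumn gs).
Proof.
elim: gs t => [|g gs IHgs] t /=; first by rewrite addn0.
by rewrite IHgs addnA.
Qed.

Lemma marks_path t gs : all (leq 1) gs -> (t + sumn gs < n)%N ->
  path (fun i j : 'I_n => (i < j)%N) (mk t) (marks t gs).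
Proof.
elim: gs t => //= g gs IHgs t /andP[g0 gs0] tn.
rewrite IHgs ?andbT -?addnA// !val_mk; lia.
Qed.

Lemma marks_card (R : comNzRingType) (f : nat -> R) t gs : all (leq 1) gs -> (t + sumn gs < n)%N ->
  \prod_(A <- ivs (mk t) (marks t gs)) f #|A| = \prod_(g <- gs) f g.
Proof.
elim: gs t => [|g gs IHgs] t /=; first by rewrite !big_nil.
move=> /andP[g0 gs0] tn; rewrite !big_cons IHgs -?addnA// card_iv !val_mk; by [lia|rewrite addKn].
Qed.

Lemma marks_even t gs : all (leq 1) gs -> (t + sumn gs < n)%N -> all (fun g => ~~ odd g) gs ->
  all (fun A : {set 'I_n} => ~~ odd #|A|) (ivs (mk t) (marks t gs)).
Proof.
elim: gs t => //= g gs IHgs t /andP[g0 gs0] tn /andP[eg egs].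
rewrite IHgs -?addnA// andbT card_iv !val_mk; by [lia|rewrite addKn].
Qed.

Lemma mk_inj s t : (s < n)%N -> (t < n)%N -> mk s = mk t -> s = t.
Proof. by move=> sn tn /(congr1 (@nat_of_ord n)); rewrite !val_mk. Qed.

Lemma marks_inj t gs gs' : (t + sumn gs < n)%N -> (t + sumn gs' < n)%N ->
  marks t gs = marks t gs' -> gs = gs'.
Proof.
elim: gs t gs' => [|g gs IHgs] t [|g' gs'] //= h h' [e].
have gg' : g = g' by have := mk_inj _ _ e; lia.
by rewrite -gg' => /IHgs ->//; lia.
Qed.

End Scan.

(** * An explicit family of nested pairs *)

Section NestedFamily.
Variables (R : realType) (d n a N : nat) (j0 : 'I_a.+2).
Hypothesis d_gt0 : (0 < d)%N.
Hypothesis nN : ((4 * a + 5) * N <= n)%N.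
Variable o : 'I_n.
Local Notation mk := (mk o).
Local Notation marks := (marks o).
Local Notation gaps := {ffun 'I_a -> 'I_N}.

Definition gap_seq (g : gaps) : seq nat := [seq 2 * (g l).+1 | l <- enum 'I_a]%N.

Lemma gap_seq_ge1 g : all (leq 1) (gap_seq g).
Proof. by apply/allP => _ /mapP[l _ ->]; lia. Qed.

Lemma gap_seq_even g : all (fun m => ~~ odd m) (gap_seq g).
Proof. by apply/allP => _ /mapP[l _ ->]; rewrite oddM. Qed.

Lemma sumn_gap_seq g : (sumn (gap_seq g) <= 2 * a * N)%N.
Proof using.
clear d_gt0 nN; rewrite sumnE big_map big_enum /=.
apply: (@leq_trans (\sum_(l < a) 2 * N)%N); last by rewrite sum_nat_const card_ord; lia.
by apply: leq_sum => l _; rewrite leq_mul2l /= ltn_ord.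
Qed.

Lemma gap_seq_inj : injective gap_seq.
Proof.
move=> g g' /eq_in_map e; apply/ffunP => l; apply: val_inj => /=.
by have /= := e l; rewrite mem_enum => /(_ isT); lia.
Qed.

(** Start of [i], its first gaps, the part of its last gap outside the span of [j], the offset of
    [j] in that gap, the first gap of [j] and its other gaps. Block lengths are doubled to be even;
    the tuples have [a.+2] entries. *)
Local Notation param := ('I_N * gaps * 'I_N * 'I_N * 'I_N * gaps)%type.

Definition list_tuple (s : seq 'I_n) : {ffun 'I_a.+2 -> 'I_n} := [ffun l : 'I_a.+2 => nth o s l].

Lemma codom_list_tuple s : size s = a.+2 -> codom (list_tuple s) =i s.
Proof.
move=> ss t; apply/codomP/idP => [[l ->]|ts].
  by rewrite ffunE mem_nth// ss.
have it : (index t s < a.+2)%N by rewrite -ss index_mem.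
by exists (Ordinal it); rewrite ffunE /= nth_index.
Qed.

Lemma list_tuple_inj s s' : size s = a.+2 -> size s' = a.+2 -> list_tuple s = list_tuple s' -> s = s'.
Proof.
move=> ss ss' /ffunP e; apply: (@eq_from_nth _ o) => [|l]; first by rewrite ss ss'.
by rewrite ss => la; have := e (Ordinal la); rewrite !ffunE.
Qed.

Section OneParam.
Variables (tau : 'I_N) (g : gaps) (mu u h : 'I_N) (eta : gaps).
Hypothesis u_mu : (u <= mu)%N.
Hypothesis h_mu : (h <= mu)%N.

Definition outer_last : nat := tau + sumn (gap_seq g).
Definition inner_gaps : seq nat := (2 * h.+1)%N :: gap_seq eta.
Definition inner_first : nat := outer_last + u.+1.
Definition outer_end : nat := outer_last + 2 * mu.+1 + sumn inner_gaps.

Definition outer_list := mk tau :: rcons (marks tau (gap_seq g)) (mk outer_end).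
Definition inner_list := mk inner_first :: marks inner_first inner_gaps.

(** The start takes less than N, each of the two gap lists at most 2aN, and [mu] and [h] at most 2N
    each; hence the factor 4a + 5. *)
Lemma outer_end_lt : (outer_end < n)%N.
Proof using nN.
clear u_mu h_mu d_gt0; apply: leq_trans nN; rewrite /outer_end /outer_last /=.
have := sumn_gap_seq g; have := sumn_gap_seq eta.
have := ltn_ord tau; have := ltn_ord mu; have := ltn_ord h; nia.
Qed.

Lemma inner_lt : (inner_first + sumn inner_gaps < outer_end)%N.
Proof using u_mu. by clear h_mu d_gt0 nN; rewrite /outer_end /inner_first; lia. Qed.

Lemma size_outer_list : size outer_list = a.+2.
Proof. by rewrite /outer_list /= size_rcons size_map size_scanl size_map -cardE card_ord. Qed.

Lemma size_inner_list : size inner_list = a.+2.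
Proof. by rewrite /inner_list /= size_map size_scanl size_map -cardE card_ord. Qed.

Let l (m : nat) : R := low R d (2 * m.+1).

(** [pE_cov_nested] is applied with [2 * h.+1], which is at most the inner span and, as [h <= mu],
    at most the remaining gap [2 * mu.+1]. *)
Lemma mean_cov_param :
  h.+1%:R / (8 * d%:R * mu.+1%:R) * (l mu * l h * \prod_k l (g k) * \prod_k l (eta k)) <=
  mean_cov R d j0 (list_tuple outer_list) (list_tuple inner_list).
Proof.
have endn := outer_end_lt; have inn := inner_lt.
have onl : (tau + sumn (gap_seq g) < n)%N by move: endn; rewrite /outer_end /outer_last; lia.
have ginn : all (leq 1) inner_gaps by rewrite /= gap_seq_ge1 ?andbT.
have einn : all (fun m => ~~ odd m) inner_gaps.
  by apply/andP; split; [rewrite oddM|apply: gap_seq_even].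
have inl : (inner_first + sumn inner_gaps < n)%N by apply: ltn_trans endn.
have px := marks_path o (gap_seq_ge1 g) onl; have py := marks_path o ginn inl.
have lx : last (mk tau) (marks tau (gap_seq g)) = mk outer_last by apply: marks_last.
have ly : last (mk inner_first) (marks inner_first inner_gaps) = mk (inner_first + sumn inner_gaps).
  exact: marks_last.
have v1 : mk outer_last = outer_last :> nat by apply: val_mk.
have v2 : mk inner_first = inner_first :> nat by apply: val_mk; lia.
have v3 : mk (inner_first + sumn inner_gaps) = (inner_first + sumn inner_gaps)%N :> nat by apply: val_mk.
have v4 : mk outer_end = outer_end :> nat by apply: val_mk.
have xy : (last (mk tau) (marks tau (gap_seq g)) < mk inner_first)%N.
  by rewrite lx v1 v2 /inner_first; lia.
have yz : (last (mk inner_first) (marks inner_first inner_gaps) < mk outer_end)%N.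
  by rewrite ly v3 v4.
have ci := codom_list_tuple size_outer_list; have cj := codom_list_tuple size_inner_list.
have cy : #|iv (mk inner_first) (mk (inner_first + sumn inner_gaps))| = sumn inner_gaps.
  by rewrite card_iv v2 v3; lia.
have co : #|outer_gap (mk tau) (mk inner_first) (mk outer_end) (marks tau (gap_seq g))
     (marks inner_first inner_gaps)| = (2 * mu.+1)%N.
  rewrite /outer_gap cardsD (setIidPr _); last exact: (iv_sub_gap d_gt0 px py xy yz).
  rewrite lx ly cy card_iv v1 v4 /outer_end; lia.
have := @pE_cov_nested R d n d_gt0 (mk tau) (mk inner_first) (mk outer_end)
  (marks tau (gap_seq g)) (marks inner_first inner_gaps) px py xy yz _ j0 _ _ ci cj (2 * h.+1)%N.
rewrite ly cy co => main; apply: le_trans (main _ _ _ _); last first.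
- rewrite /nested_blocks /= all_cat co oddM /= (marks_even o (gap_seq_ge1 g) onl (gap_seq_even g)).
  exact: (marks_even o ginn inl einn).
- by [].
- by rewrite leq_mul2l.
- by rewrite /= leq_addr.
have prodl eta' : \prod_(m <- gap_seq eta') low R d m = \prod_k l (eta' k).
  by rewrite /gap_seq big_map big_enum.
have -> : \prod_(A <- nested_blocks (mk tau) (mk inner_first) (mk outer_end)
    (marks tau (gap_seq g)) (marks inner_first inner_gaps)) low R d #|A| =
    l mu * (\prod_k l (g k) * (l h * \prod_k l (eta k))).
  rewrite /nested_blocks big_cons co; congr (_ * _); rewrite big_cat; congr (_ * _).
    by rewrite -prodl -(marks_card o (low R d) (gap_seq_ge1 g) onl).
  by rewrite [LHS](marks_card o (low R d) ginn inl) /inner_gaps big_cons prodl.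
rewrite !natrM le_eqVlt; apply/orP; left; apply/eqP.
have m0 : mu.+1%:R != 0 :> R by rewrite pnatr_eq0.
have dd : d%:R != 0 :> R by rewrite pnatr_eq0 -lt0n.
move: m0 dd; set M : R := mu.+1%:R; set D : R := d%:R; set G : R := h.+1%:R => m0 dd.
by field; apply/andP.
Qed.

End OneParam.

Definition param_pair (p : param) :=
  let: (tau, g, mu, u, h, eta) := p in
  (list_tuple (outer_list tau g mu h eta), list_tuple (inner_list tau g u h eta)).

Definition param_ok (p : param) : bool :=
  let: (tau, g, mu, u, h, eta) := p in (u <= mu)%N && (h <= mu)%N.

(** All parameters can be read off the times; [mu] comes last, from the end of [i] once the length
    of [j] is known. *)
Lemma param_pair_inj : {in param_ok &, injective param_pair}.
Proof.
move=> [[[[[t g] m] u] h] e] [[[[[t' g'] m'] u'] h'] e'].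
rewrite !unfold_in /= => /andP[um hm] /andP[um' hm'] [eo ei].
have o1 : (outer_end t g m h e < n)%N by apply: outer_end_lt.
have o2 : (outer_end t' g' m' h' e' < n)%N by apply: outer_end_lt.
have i1 : (inner_first t g u + sumn (inner_gaps h e) < outer_end t g m h e)%N by apply: inner_lt.
have i2 : (inner_first t' g' u' + sumn (inner_gaps h' e') < outer_end t' g' m' h' e')%N by apply: inner_lt.
move: eo => /(list_tuple_inj (size_outer_list _ _ _ _ _) (size_outer_list _ _ _ _ _)) [et].
move/rcons_inj => [eg ez].
have eL := list_tuple_inj (size_inner_list _ _ _ _ _) (size_inner_list _ _ _ _ _) ei.
have eu : mk (inner_first t g u) = mk (inner_first t' g' u') := congr1 (head o) eL.
have em : marks (inner_first t g u) (inner_gaps h e) =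
  marks (inner_first t' g' u') (inner_gaps h' e') := congr1 behead eL.
move: eu em i1 i2 o1 o2; rewrite /outer_end /inner_first /outer_last => eu em i1 i2 o1 o2.
have tt' : t = t' by apply: val_inj; apply: (mk_inj _ _ et); lia.
subst t'; have gg : gap_seq g = gap_seq g' by apply: (marks_inj _ _ eg); lia.
have gg' := gap_seq_inj gg; subst g'.
have uu : u = u' by apply: val_inj => /=; have := mk_inj _ _ eu; lia.
subst u'; have ee : inner_gaps h e = inner_gaps h' e'.
  by apply: (marks_inj _ _ em); lia.
move: (ee) => [hh /gap_seq_inj eta_e]; subst e'.
have hh' : h = h' by apply: val_inj => /=; lia.
subst h'; have mm : m = m'.
  by apply: val_inj => /=; have := mk_inj o1 o2 ez; rewrite /outer_end /outer_last; lia.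
by rewrite mm.
Qed.

Let l (m : nat) : R := low R d (2 * m.+1).

(** The start contributes [N]. The offset [u] has m + 1 values, which cancel the m + 1 in the
    denominator of the covariance; the double sum left over has the shape of [decay_sum]. *)
Lemma nested_sum_le :
  N%:R / (8 * d%:R) * (\sum_(m < N) l m) ^+ (2 * a) *
    (\sum_(m < N) l m * \sum_(h < m.+1) h.+1%:R * l h) <=
  \sum_i \sum_j mean_cov R d (n := n) j0 i j.
Proof.
rewrite pair_bigA /=.
pose F (q : {ffun 'I_a.+2 -> 'I_n} * {ffun 'I_a.+2 -> 'I_n}) := mean_cov R d j0 q.1 q.2.
apply: le_trans (ler_sum_injective (F := F) param_pair_inj _); last first.
  by move=> q; apply: mean_cov_ge0.
pose T (p : param) : R := let: (tau, g, mu, u, h, eta) := p in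
  h.+1%:R / (8 * d%:R * mu.+1%:R) * (l mu * l h * \prod_k l (g k) * \prod_k l (eta k)).
apply: (@le_trans _ _ (\sum_(p | param_ok p) T p)); last first.
  apply: ler_sum => -[[[[[t g] m] u] h] e] /andP[um hm].
  exact: mean_cov_param.
have unfold_sum (G : param -> R) : \sum_p G p =
    \sum_t \sum_g \sum_m \sum_u \sum_h \sum_e G (t, g, m, u, h, e).
  by rewrite !pair_bigA /=; apply: eq_bigr => -[[[[[t g] m] u] h] e].
have l0 m : 0 <= l m by apply: low_ge0.
have prodE : \sum_(g : gaps) \prod_k l (g k) = (\sum_(m < N) l m) ^+ a.
  rewrite -(bigA_distr_bigA (fun _ (m : 'I_N) => l m)) prodr_const card_ord //.
rewrite [leRHS]big_mkcond unfold_sum.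
pose c (m h : nat) : R := h.+1%:R / (8 * d%:R * m.+1%:R) * (l m * l h).
have inner (t : 'I_N) : \sum_(g : gaps) \sum_(m < N) \sum_(u < N) \sum_(h < N) \sum_(e : gaps)
    (if param_ok (t, g, m, u, h, e) then T (t, g, m, u, h, e) else 0) =
    (\sum_(m < N) l m) ^+ a * (\sum_(m < N) \sum_(u < N) \sum_(h < N)
      (if (u <= m)%N && (h <= m)%N then c m h else 0)) * (\sum_(m < N) l m) ^+ a.
  rewrite -!prodE [in RHS]mulr_suml mulr_suml; apply: eq_bigr => g _.
  rewrite [X in _ = X * _]mulr_sumr mulr_suml; apply: eq_bigr => m _.
  rewrite [X in _ = X * _]mulr_sumr mulr_suml; apply: eq_bigr => u _.
  rewrite [X in _ = X * _]mulr_sumr mulr_suml; apply: eq_bigr => h _.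
  rewrite mulr_sumr; apply: eq_bigr => e _ /=.
  by case: ifP => _; [rewrite /c; ring|rewrite mulr0 mul0r].
rewrite [leRHS](eq_bigr _ (fun t _ => inner t)).
rewrite sumr_const card_ord -[leRHS]mulr_natl le_eqVlt; apply/orP; left; apply/eqP.
have -> : \sum_(m < N) \sum_(u < N) \sum_(h < N) (if (u <= m)%N && (h <= m)%N then c m h else 0) =
    (8 * d%:R)^-1 * \sum_(m < N) l m * \sum_(h < m.+1) h.+1%:R * l h.
  rewrite mulr_sumr; apply: eq_bigr => m _.
  transitivity (\sum_(u < N | (u < m.+1)%N) \sum_(h < N | (h < m.+1)%N) c m h).
    rewrite [RHS]big_mkcond; apply: eq_bigr => u _; rewrite ltnS; case: (u <= m)%N => /=; last by rewrite big1.
    by rewrite -big_mkcond.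
  rewrite -(big_ord_widen N (fun=> \sum_(h < N | (h < m.+1)%N) c m h))// sumr_const card_ord.
  rewrite -(big_ord_widen N (fun h => c m h))// -[LHS]mulr_natl !mulr_sumr.
  apply: eq_bigr => h _; rewrite /c.
  have m0 : m.+1%:R != 0 :> R by rewrite pnatr_eq0.
  have dd : d%:R != 0 :> R by rewrite pnatr_eq0 -lt0n.
  move: m0 dd; set M : R := m.+1%:R; set D : R := d%:R; set G : R := h.+1%:R => m0 dd.
  by field; apply/andP.
by rewrite mul2n -addnn exprD; ring.
Qed.

End NestedFamily.

(** * Lower bounds for the sums, compared with the rate *)

Section LowerSums.
Variable R : realType.

Lemma decay_sum1_ge N : N%:R ^+ 2 / 4 <= decay_sum R 1 N.
Proof.
have h (a : nat) : (a.+1%:R) / 2 <= decay R 1 a * \sum_(b < a.+1) b.+1%:R * decay R 1 b :> R.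
  have s0 : 0 < Num.sqrt a.+1%:R :> R by rewrite sqrtr_gt0 ltr0n.
  apply: (@le_trans _ _ (decay R 1 a * (decay R 1 a * \sum_(b < a.+1) b.+1%:R))).
    rewrite mulrA -expr2 -[decay R 1 a ^+ 2]exprM -/(decay R 2 a) decay2.
    rewrite -natr_sum; have -> : (\sum_(b < a.+1) b.+1 = 'C(a.+2, 2))%N.
      elim: a {s0} => [|a IHa]; first by rewrite big_ord1.
      by rewrite big_ord_recr /= IHa [RHS]binS bin1 addnC.
    have e : 2 * ('C(a.+2, 2))%:R = a.+1%:R * (a.+1%:R + 1) :> R.
      by have := mul_bin_diag a.+2 1; rewrite bin1 natr1 -!natrM /= => <-; rewrite mulnC.
    have a0 : 0 < a.+1%:R :> R by rewrite ltr0n.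
    rewrite ler_pdivlMl//; nra.
  rewrite ler_wpM2l ?decay_ge0// mulr_sumr; apply: ler_sum => b _.
  rewrite mulrC ler_wpM2l// /decay !expr1 lef_pV2 ?posrE ?sqrtr_gt0 ?ltr0n//.
  by rewrite ler_wsqrtr// ler_nat ltn_ord.
have : \sum_(a < N) a.+1%:R / 2 <= decay_sum R 1 N by apply: ler_sum => a _; apply: h.
apply: le_trans; elim: N => [|N IHN]; first by rewrite big_ord0 expr0n mul0r.
rewrite big_ord_recr /=; apply: le_trans (lerD IHN (lexx _)).
by rewrite -natr1; have : 0 <= N%:R :> R by []; nra.
Qed.

Lemma decay_sum2_eq N : decay_sum R 2 N = N%:R.
Proof.
rewrite -[N in RHS]card_ord -sumr_const; apply: eq_bigr => a _.
under eq_bigr do rewrite mul_decay2.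
by rewrite sumr_const card_ord mulrC mul_decay2.
Qed.

Lemma decay_sum3_ge N : ln N.+1%:R <= decay_sum R 3 N.
Proof.
apply: le_trans (sum_inv_ge R N) _; apply: ler_sum => a _.
have s0 : 0 < Num.sqrt a.+1%:R :> R by rewrite sqrtr_gt0 ltr0n.
apply: (@le_trans _ _ (decay R 3 a * (a.+1%:R * decay R 1 a))).
  rewrite mulrCA [decay R 3 a * _]mulrC -decay1D (_ : decay R 4 a = decay R 2 a * decay R 2 a).
    by rewrite mulrA mul_decay2 mul1r decay2.
  by rewrite /decay -exprD.
rewrite ler_wpM2l ?decay_ge0// mulr_natl -[X in _ *+ X]card_ord -sumr_const.
apply: ler_sum => b _.
rewrite (_ : decay R 3 b = decay R 2 b * decay R 1 b); last by rewrite /decay -exprD.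
rewrite mulrA mul_decay2 mul1r /decay !expr1 lef_pV2 ?posrE ?sqrtr_gt0 ?ltr0n//.
by rewrite ler_wsqrtr// ler_nat ltn_ord.
Qed.

Lemma decay_sum_ge1 d N : (0 < N)%N -> 1 <= decay_sum R d N.
Proof.
move=> N0; rewrite /decay_sum (bigD1 (Ordinal N0))//= big_ord1 /decay /= sqrtr1 invr1 expr1n !mulr1.
by rewrite lerDl sumr_ge0// => m _; rewrite mulr_ge0 ?decay_ge0// sumr_ge0// => b _; rewrite mulr_ge0 ?decay_ge0.
Qed.

Lemma sum_decay_ge1 d N : (0 < N)%N -> 1 <= \sum_(m < N) decay R d m.
Proof.
move=> N0; rewrite (bigD1 (Ordinal N0))//= /decay /= sqrtr1 invr1 expr1n.
by rewrite lerDl sumr_ge0// => m _; apply: decay_ge0.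
Qed.

Lemma sum_decay1_sqr_ge N : N%:R <= (\sum_(m < N) decay R 1 m) ^+ 2.
Proof.
have s0 : 0 <= Num.sqrt N%:R :> R by apply: sqrtr_ge0.
have le : Num.sqrt N%:R <= \sum_(m < N) decay R 1 m.
  apply: (@le_trans _ _ (\sum_(m < N) (Num.sqrt N%:R)^-1)).
    rewrite sumr_const card_ord -[leRHS]mulr_natr.
    case: N s0 => [|N] s0; first by rewrite sqrtr0 mulr0.
    rewrite ler_pdivlMl ?sqrtr_gt0 ?ltr0n// -expr2 sqr_sqrtr//.
  apply: ler_sum => m _; rewrite /decay expr1 lef_pV2 ?posrE ?sqrtr_gt0 ?ltr0n//.
    by rewrite ler_wsqrtr// ler_nat ltn_ord.
  exact: leq_ltn_trans (ltn_ord m).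
by rewrite -{1}[N%:R]sqr_sqrtr// lerXn2r ?nnegrE// (le_trans s0).
Qed.

(** Let D be the sum of the decay and X the [decay_sum]. Then D^2 >= N and X >= N^2/4 for d = 1, D
    >= ln(N+1) and X = N for d = 2, D >= 1 and X >= ln(N+1) for d = 3, and both are at least 1
    beyond. The moment order is a + 2, so 2a is the exponent 2 alpha - 4. *)
Lemma vrate_le_sums d a q : (0 < d)%N -> (0 < q)%N -> exists2 C : R, 0 < C &
  forall n N : nat, (3 <= n)%N -> (0 < N)%N -> (n <= q * N.+1)%N ->
  vrate R d a.+2 n <= C * (N%:R * (\sum_(m < N) decay R d m) ^+ (2 * a) * decay_sum R d N).
Proof.
(* [q2] and [lq] pass from n to N: q (N + 1) <= 2qN, and ln q <= 2 ln q ln(N+1) since ln(N+1) >=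
   1/2. *)
move=> d0 q0; pose lq : R := 2 * ln q%:R + 1; pose q2 : R := (2 * q)%:R.
have lq1 : 1 <= lq by rewrite lerDr mulr_ge0// ln_ge0// ler1n.
have q21 : 1 <= q2 by rewrite ler1n; lia.
have lq0 : 0 <= lq by apply: le_trans lq1.
have q20 : 0 <= q2 by apply: le_trans q21.
have nq n N : (0 < N)%N -> (n <= q * N.+1)%N -> n%:R <= q2 * N%:R :> R.
  by move=> N0 nN; rewrite -natrM ler_nat; nia.
have lnq n N : (3 <= n)%N -> (0 < N)%N -> (n <= q * N.+1)%N -> ln n%:R <= lq * ln N.+1%:R :> R.
  move=> n3 N0 nN; have lh := ln_ge_half R (_ : 2 <= N.+1)%N.
  apply: (@le_trans _ _ (ln q%:R + ln N.+1%:R)).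
    rewrite -lnM ?posrE ?ltr0n// -natrM ler_ln ?posrE ?ltr0n ?ler_nat ?muln_gt0 ?q0//.
    exact: leq_trans n3.
  rewrite /lq mulrDl mul1r lerD2r; have : 0 <= ln q%:R :> R by rewrite ln_ge0// ler1n.
  by have := lh N0; nra.
case: d d0 => [//|[|[|[|d]]]] _.
- exists (4 * q2 ^+ (a + 3)); first by rewrite mulr_gt0// exprn_gt0// (lt_le_trans ltr01).
  move=> n N n3 N0 nN; rewrite /vrate.
  apply: (@le_trans _ _ ((q2 * N%:R) ^+ (a + 3))).
    by rewrite (_ : 1 + a.+2 = a + 3)%N ?lerXn2r ?nnegrE ?mulr_ge0 ?nq//; lia.
  rewrite exprMn [4 * _]mulrC -[leRHS]mulrA ler_wpM2l ?exprn_ge0//.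
  have D2 : N%:R ^+ a <= (\sum_(m < N) decay R 1 m) ^+ (2 * a).
    by rewrite exprM lerXn2r ?nnegrE ?sqr_ge0 ?sum_decay1_sqr_ge.
  have S4 := decay_sum1_ge N.
  rewrite (_ : a + 3 = a.+1 + 2)%N; last by lia.
  rewrite exprD [_ ^+ a.+1]exprS.
  have -> : N%:R * N%:R ^+ a * N%:R ^+ 2 = 4 * (N%:R * N%:R ^+ a * (N%:R ^+ 2 / 4)) :> R by field.
  by rewrite ler_pM2l// ler_pM ?mulr_ge0 ?divr_ge0 ?exprn_ge0// ler_wpM2l.
- exists (q2 ^+ 2 * lq ^+ (2 * a)); first by rewrite mulr_gt0// exprn_gt0// (lt_le_trans ltr01).
  move=> n N n3 N0 nN; rewrite /vrate decay_sum2_eq.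
  have -> : ((2 * a.+2)%N%:Z - 4 = (2 * a)%N)%R by lia.
  rewrite -exprnP.
  have lnN0 : 0 <= ln n%:R :> R by rewrite ln_ge0// ler1n (leq_trans _ n3).
  have lN10 : 0 <= ln N.+1%:R :> R by rewrite ln_ge0// ler1n.
  have D1 : ln N.+1%:R <= \sum_(m < N) decay R 2 m.
    by under eq_bigr do rewrite decay2; apply: sum_inv_ge.
  apply: (@le_trans _ _ ((q2 * N%:R) ^+ 2 * (lq * ln N.+1%:R) ^+ (2 * a))).
    by rewrite ler_pM ?exprn_ge0 ?lerXn2r ?nnegrE ?mulr_ge0 ?nq ?lnq.
  rewrite !exprMn.
  have -> : q2 ^+ 2 * N%:R ^+ 2 * (lq ^+ (2 * a) * ln N.+1%:R ^+ (2 * a)) =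
    q2 ^+ 2 * lq ^+ (2 * a) * (N%:R * ln N.+1%:R ^+ (2 * a) * N%:R) :> R by ring.
  by rewrite ler_wpM2l ?mulr_ge0 ?exprn_ge0// ler_wpM2r// ler_wpM2l// lerXn2r ?nnegrE// (le_trans lN10).
- exists (q2 * lq); first by rewrite mulr_gt0// (lt_le_trans ltr01).
  move=> n N n3 N0 nN; rewrite /vrate.
  have lnN0 : 0 <= ln n%:R :> R by rewrite ln_ge0// ler1n (leq_trans _ n3).
  have lN10 : 0 <= ln N.+1%:R :> R by rewrite ln_ge0// ler1n.
  apply: (@le_trans _ _ ((q2 * N%:R) * (lq * ln N.+1%:R))).
    by rewrite ler_pM ?nq ?lnq.
  have -> : q2 * N%:R * (lq * ln N.+1%:R) = q2 * lq * (N%:R * ln N.+1%:R) :> R by ring.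
  rewrite ler_wpM2l ?mulr_ge0// -[X in X * ln _]mulr1 ler_pM ?mulr_ge0 ?decay_sum3_ge//.
  by rewrite ler_wpM2l// exprn_ege1// sum_decay_ge1.
- exists q2; first by rewrite (lt_le_trans ltr01).
  move=> n N n3 N0 nN; rewrite /vrate; apply: le_trans (nq n N N0 nN) _.
  rewrite ler_wpM2l// -[leLHS]mulr1 ler_pM ?decay_sum_ge1//.
  by rewrite -[leLHS]mulr1 ler_wpM2l// exprn_ege1// sum_decay_ge1.
Qed.

End LowerSums.

(** * The lower bound for the simple walk *)

Section LowerBound.
Variable R : realType.

Lemma cbin_le1 N : cbin R N <= 1.
Proof.
have [oN|eN] := boolP (odd N); first by rewrite /cbin oN.
by apply: le_trans (cbin_add_le R 0 eN) _; rewrite /cbin /= bin0 expr0 divr1.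
Qed.

Lemma cbin_le_half N : (0 < N)%N -> cbin R N <= 2^-1.
Proof.
case: N => [//|[|N]] _; first by rewrite /cbin /= invr_ge0.
have [oN|eN] := boolP (odd N); first by rewrite /cbin /= negbK oN invr_ge0.
apply: le_trans (cbin_add_le R 2 eN) _.
by rewrite /cbin /= (_ : 'C(2, 1) = 2)%N// le_eqVlt; apply/orP; left; apply/eqP; field.
Qed.

Lemma beta_le_half d n (k : {ffun 'I_n -> 'I_d}) (A : {set 'I_n}) :
  A != set0 -> beta R k A <= 2^-1.
Proof.
move=> /set0Pn[s sA]; rewrite /beta (bigD1 (k s))//= -[leRHS]mulr1.
rewrite ler_pM ?cbin_ge0 ?cbin_le_half//.
- by apply: prodr_ge0 => c _; apply: cbin_ge0.
- by apply/card_gt0P; exists s; rewrite !inE sA eqxx.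
by apply: prodr_ile1 => c _; rewrite cbin_ge0 cbin_le1.
Qed.

(** The 5 comes from 4(m + 1) + 1 <= 5(m + 1). *)
Lemma low_ge_decay d m :
  2^-1 ^+ d * (Num.sqrt 5)^-1 ^+ d * decay R d m <= low R d (2 * m.+1).
Proof.
rewrite /low /decay -mulrA -exprMn ler_wpM2l ?exprn_ge0// lerXn2r ?nnegrE ?mulr_ge0 ?invr_ge0 ?sqrtr_ge0//.
rewrite -invfM -sqrtrM// lef_pV2 ?posrE ?sqrtr_gt0.
- by rewrite ler_wsqrtr// natrM; have : 1 <= m.+1%:R :> R; [rewrite ler1n|lra].
- by rewrite mulr_gt0// ltr0n.
by rewrite ltr_wpDl// mulr_ge0.
Qed.

(* Covers the finitely many n that are too small for the nested family. *)
Lemma mean_cov_diag_ge d n a (j0 : 'I_a.+2) : (0 < d)%N -> (3 <= n)%N ->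
  low R d 2 / 2 <= \sum_i \sum_j mean_cov R d (n := n) j0 i j.
Proof.
move=> d0 n3; have o0n : (0 < n)%N by apply: ltn_trans n3.
pose x : 'I_n := Ordinal o0n; pose y : 'I_n := Ordinal n3.
(* A tuple using only two times, two steps apart. Given the directions its indicator has variance
   beta - beta^2, at least beta/2 because beta <= 1/2. *)
pose i : {ffun 'I_a.+2 -> 'I_n} := [ffun l => if l == ord0 then x else y].
have ci : codom i =i [:: x; y].
  move=> t; rewrite !inE; apply/codomP/orP => [[l ->]|[/eqP ->|/eqP ->]].
  - by rewrite ffunE; case: ifP => _; [left|right].
  - by exists ord0; rewrite ffunE eqxx.
  - by exists ord_max; rewrite ffunE.
have pi : path (fun s t : 'I_n => (s < t)%N) x [:: y] by [].
have A2 : #|iv x y| = 2%N by rewrite card_iv.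
apply: (@le_trans _ _ (mean_cov R d j0 i i)); last first.
  rewrite (bigD1 i)//= (bigD1 i)//= -addrA lerDl addr_ge0// sumr_ge0// => j _.
    exact: mean_cov_ge0.
  by apply: sumr_ge0 => j' _; apply: mean_cov_ge0.
have cE k : condE R k j0 i = beta R k (iv x y).
  rewrite /condE (@eq_pE _ _ _ _ _ (fun e => (all (block_zero k e) (ivs x [:: y]))%:R)).
    by rewrite pE_all_block_zero ?ivs_disjoint//= big_seq1.
  by move=> e; rewrite (coincide_ivs _ _ _ ci pi).
have cE2 k : condE2 R k j0 i i = condE R k j0 i.
  by apply: eq_pE => e; case: coincide; rewrite ?mulr1 ?mulr0.
rewrite mulrC; apply: (@le_trans _ _ (2^-1 * pE (unif R (d := d)) (fun k => beta R k (iv x y)))).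
  by rewrite ler_wpM2l// -[in low R d 2]A2 pE_beta_ge// A2.
rewrite -pEZ; apply: le_pE => [c|k]; first exact: unif_ge0.
rewrite cE2 cE; have b0 : 0 <= beta R k (iv x y) by apply: beta_ge0.
have bh : beta R k (iv x y) <= 2^-1.
  by apply: beta_le_half; rewrite -card_gt0 A2.
by nra.
Qed.

Lemma vrate_ge0 d a n : (0 < n)%N -> 0 <= vrate R d a n.
Proof.
move=> n0; have ln0 : 0 <= ln n%:R :> R by rewrite ln_ge0// ler1n.
case: d => [|[|[|[|d]]]]; rewrite /vrate ?exprn_ge0 ?mulr_ge0 ?sqr_ge0//.
by rewrite exprz_ge0.
Qed.

Theorem pVar_srw_ge d a (j0 : 'I_a.+2) : (0 < d)%N -> exists2 c : R, 0 < c &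
  forall n, (3 <= n)%N -> c * vrate R d a.+2 n <=
    pVar (srw_weight R (d := d)) (num_coincide R (@srw_step d) (n := n) j0).
Proof.
move=> d0; pose q := (4 * a + 5)%N; have q0 : (0 < q)%N by rewrite /q addn_gt0 orbT.
have [C C0 hC] := vrate_le_sums R a d0 q0.
pose l0 : R := 2^-1 ^+ d * (Num.sqrt 5)^-1 ^+ d.
have l00 : 0 < l0 by rewrite mulr_gt0// exprn_gt0// invr_gt0// sqrtr_gt0.
pose c1 : R := l0 ^+ (2 * a + 2) / (8 * d%:R) / C.
have c10 : 0 < c1 by rewrite !divr_gt0 ?exprn_gt0 ?mulr_gt0// ltr0n.
(* [V] dominates the rate for all n < q, where the nested family is empty and the diagonal bound
   takes over. *)
pose V : R := \sum_(n < q) `|vrate R d a.+2 n| + 1.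
have V0 : 0 < V by rewrite ltr_wpDl// sumr_ge0.
have low0 : 0 < low R d 2.
  by rewrite mulr_gt0// exprn_gt0// invr_gt0// sqrtr_gt0 ltr_wpDl// mulr_ge0.
pose c2 : R := low R d 2 / 2 / V.
have c20 : 0 < c2 by rewrite !divr_gt0.
exists (Num.min c1 c2); first by rewrite lt_min c10.
move=> n n3; have n0 : (0 < n)%N by apply: ltn_trans n3.
apply: le_trans (sum_mean_cov_le R n j0 d0).
have vr0 := vrate_ge0 d a.+2 n0.
have [nq|qn] := ltnP n q.
  apply: le_trans (mean_cov_diag_ge j0 d0 n3).
  apply: (@le_trans _ _ (c2 * V)); last by rewrite divfK// gt_eqF.
  rewrite ler_pM ?ge_min ?lexx ?orbT ?le_min ?(ltW c10) ?(ltW c20)//.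
  apply: ler_wpDr => //; rewrite (bigD1 (Ordinal nq))//= (le_trans (ler_norm _))// lerDl.
  exact: sumr_ge0.
pose N := (n %/ q)%N; have N0 : (0 < N)%N by rewrite divn_gt0.
have nN : (n <= q * N.+1)%N by rewrite mulnC ltnW// ltn_ceil.
have Nn : (q * N <= n)%N by rewrite mulnC leq_trunc_div.
apply: le_trans (nested_sum_le R j0 d0 Nn (Ordinal n0)).
apply: (@le_trans _ _ (c1 * vrate R d a.+2 n)).
  by rewrite ler_wpM2r// ge_min lexx.
apply: (@le_trans _ _ (c1 * (C * (N%:R * (\sum_(m < N) decay R d m) ^+ (2 * a) * decay_sum R d N)))).
  by rewrite ler_wpM2l ?(ltW c10)// hC.
set D := \sum_(m < N) _; set X := decay_sum _ _ _.
have D0 : 0 <= D by apply: sumr_ge0 => m _; apply: decay_ge0.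
have X0 : 0 <= X.
  by apply: sumr_ge0 => m _; rewrite mulr_ge0 ?decay_ge0// sumr_ge0// => h _; rewrite mulr_ge0 ?decay_ge0.
have -> : c1 * (C * (N%:R * D ^+ (2 * a) * X)) =
    N%:R / (8 * d%:R) * (l0 * D) ^+ (2 * a) * (l0 ^+ 2 * X).
  rewrite /c1 [(l0 * D) ^+ _]exprMn [l0 ^+ (_ + 2)]exprD; set u := l0 ^+ (2 * a); field.
  by rewrite pnatr_eq0 -lt0n d0 (gt_eqF C0).
rewrite ler_pM ?mulr_ge0 ?exprn_ge0 ?mulr_ge0 ?invr_ge0 ?(ltW l00)//.
  rewrite ler_wpM2l ?divr_ge0 ?mulr_ge0// lerXn2r ?nnegrE ?mulr_ge0 ?(ltW l00)//.
    by rewrite sumr_ge0// => m _; apply: low_ge0.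
  by rewrite mulr_sumr; apply: ler_sum => m _; apply: low_ge_decay.
rewrite mulr_sumr; apply: ler_sum => m _.
rewrite expr2 mulrACA ler_pM ?mulr_ge0 ?decay_ge0 ?(ltW l00) ?low_ge_decay//.
  by rewrite sumr_ge0// => h _; rewrite mulr_ge0 ?decay_ge0.
rewrite mulr_sumr; apply: ler_sum => h _; rewrite mulrCA ler_wpM2l//.
exact: low_ge_decay.
Qed.

End LowerBound.

(** * The simple random walk as a law on the lattice *)

Section SrwLaw.
Variables (R : realType) (d : nat).
Hypothesis d_gt0 : (0 < d)%N.
Local Notation law := (@srw_law R d).
Local Notation step := (@srw_step d).

Lemma srw_law_step t : law (step t) = srw_weight R t.
Proof.
rewrite /srw_law ifT; last first.
  by apply/existsP; exists t.1; rewrite /srw_step; case: t.2; rewrite eqxx ?orbT.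
by rewrite /srw_weight /unif /coin natrM invfM mulrC.
Qed.

Lemma srw_step_inj : injective step.
Proof.
move=> [k b] [k' b'] e.
have : step (k, b) 0 k = step (k', b') 0 k by rewrite e.
rewrite /srw_step /=.
by case: b {e}; case: b'; rewrite !mxE !eqxx /=; case: eqP => // ->.
Qed.

Lemma srw_law_off z : z \notin codom step -> law z = 0.
Proof.
move=> /negP zn; rewrite /srw_law; case: ifP => // /existsP[k /orP[/eqP zk|/eqP zk]]; case: zn.
  by apply/codomP; exists (k, true).
by apply/codomP; exists (k, false).
Qed.

Lemma sum_srw_weight : \sum_t srw_weight R (d := d) t = 1.
Proof.
rewrite -(pair_bigA _ (fun c b => unif R c * coin R b)) /=.
by under eq_bigr do rewrite -mulr_sumr sum_coin mulr1; apply: sum_unif.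
Qed.

Lemma srw_law_ge0 z : 0 <= law z.
Proof. by rewrite /srw_law; case: ifP; rewrite // invr_ge0. Qed.

Lemma srw_is_law : is_law law.
Proof.
split=> [z|]; first exact: srw_law_ge0.
rewrite (esum_supported (s := codom step)) ?(map_inj_uniq srw_step_inj) ?enum_uniq//.
- rewrite big_map big_enum /=; congr _%:E; rewrite -[RHS]sum_srw_weight.
  by apply: eq_bigr => t _; apply: srw_law_step.
- exact: srw_law_ge0.
- exact: srw_law_off.
Qed.

Lemma srw_genuine : genuinely_d_dim law.
Proof.
have pos t : 0 < law (step t).
  by rewrite srw_law_step mulr_gt0// ?invr_gt0// ltr0n.
move=> v; exists d, (fun k => step (k, true)), (fun k => step (k, false)), (fun k => v 0 k / 2).
split=> [k|]; first by split; apply: pos.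
rewrite [LHS]row_sum_delta; apply: eq_bigr => k _.
rewrite /srw_step /= opprK map_mxD map_delta_mx.
by rewrite scalerDr -scalerDl -splitr.
Qed.

Lemma var_SILT_srw n a (j0 : 'I_a) :
  var_SILT law n a = pVar (srw_weight R (d := d)) (num_coincide R step (n := n) j0).
Proof.
rewrite /var_SILT /Defs.variance /pVar.
have weightE (F : {ffun 'I_n -> 'I_d * bool} -> R) :
    pE (fun t => law (step t)) F = pE (srw_weight R (d := d)) F.
  apply: eq_bigr => x _; congr (_ * _).
  by apply: eq_bigr => i _; apply: srw_law_step.
rewrite !(expect_finite srw_is_law _ srw_step_inj srw_law_off) ?weightE.
- congr (_ - _ ^+ 2); by apply: eq_pE => x; rewrite (SILT_num_coincide _ _ j0).
- by move=> x; apply: ler0n.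
- by move=> x; apply: sqr_ge0.
Qed.

End SrwLaw.


(** For n <= 2 the simple walk visits no site twice and its variance is 0, whereas a law with an
    atom at 0 may have positive variance at n = 2; hence the range of n. *)
Theorem theorem1 (R : realType) (d a : nat) (mu : 'rV[int]_d -> R) :
  (1 <= d)%N -> (0 < a)%N -> is_law mu -> genuinely_d_dim mu ->
  exists c C : R, forall n : nat, (3 <= n)%N ->
    var_SILT mu n a <= c * var_SILT (@srw_law R d) n a /\
    c * var_SILT (@srw_law R d) n a <= C * @vrate R d a n.
Proof.
move=> d0 a0 law gen; have [a2|a1] := ltnP 1 a; last first.
  have -> : a = 1%N by lia.
  (* L_n(1) = n is deterministic, so the variance vanishes for every truncation and hence for
     [mu]. *)
  exists 0, 0 => n _; rewrite !mul0r lexx; split=> //.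
  apply: (var_SILT_le_finite law (pts := [::])) => // s us _ s0 j0.
  rewrite /pVar; set w := fun k => _.
  have w1 : \sum_k w k = 1 by rewrite -mulr_sumr sum_seq_mu mulVf// gt_eqF.
  set F := num_coincide _ _ _.
  have FE x : F x = n%:R.
    rewrite /F /num_coincide (eq_bigr (fun=> 1)); last first.
      by move=> i _; rewrite (_ : coincide _ _ _ _ = true)//; apply/coincideP => l l'; rewrite !ord1.
    by rewrite sumr_const card_ffun !card_ord expn1.
  have F2E x : F x ^+ 2 = n%:R ^+ 2 by rewrite FE.
  by rewrite (eq_pE _ FE) (eq_pE _ F2E) !pE1// subrr.
have [C1 h1] := var_SILT_le d0 a2 law gen.
have [C2 h2] := var_SILT_le d0 a2 (@srw_is_law R d d0) (@srw_genuine R d d0).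
case: a a2 {a0} h1 h2 => [//|[//|a]] _ h1 h2.
have [c c0 h3] := pVar_srw_ge R (ord0 : 'I_a.+2) d0.
(* The absolute value makes [c'] nonnegative whatever the sign of [C1], so the upper bound for the
   simple walk may be multiplied by it. *)
pose c' : R := `|C1| / c; have c'0 : 0 <= c' by rewrite divr_ge0// ltW.
exists c', (c' * C2) => n n3; split; last by rewrite -[leRHS]mulrA ler_wpM2l// h2.
apply: le_trans (h1 n n3) _; apply: (@le_trans _ _ (c' * (c * vrate R d a.+2 n))).
  rewrite [leRHS]mulrA divfK ?gt_eqF// ler_wpM2r ?ler_norm//.
  by rewrite vrate_ge0// (ltn_trans _ n3).
by rewrite ler_wpM2l// (var_SILT_srw _ d0 n ord0) h3.
Qed.
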